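(* Consider the boundary value problem $$H(x,u(x),\nabla u(x))=0\ \text{ in }\Omega,\qquad B(x,u(x),\nabla u(x))=0\ \text{ on }\partial\Omega, \tag{P}$$ with the boundary condition understood in the viscosity sense (definitions in the context), and with $H^{L},H^{ON},H^{PH},H^{BP}$ as defined in the context. (i) Let $H$ be $H^{L}$, $H^{PH}$ or $H^{BP}$, and let the boundary condition be either Dirichlet, Neumann or state constraints. Then (P) satisfies the Maximum Principle for discontinuous viscosity solutions: if $u$ is an upper semicontinuous (on $\overline\Omega$) viscosity subsolution and $v$ a lower semicontinuous (on $\overline\Omega$) viscosity supersolution of (P), then $u\le v$ in $\Omega$ in the Dirichlet and state constraints cases, and $u\le v$ in $\overline\Omega$ in the Neumann case. Consequently (P) admits at most one viscosity solution. (ii) Let $H=H^{ON}$ and let the boundary condition be Neumann. Then (P) satisfies the Maximum Principle for discontinuous viscosity solutions: if $u$ is an upper semicontinuous (on $\overline\Omega$) viscosity subsolution and $v$ a lower semicontinuous (on $\overline\Omega$) viscosity supersolution of (P), then $u\le v$ in $\overline\Omega$. Consequently (P) admits at most one viscosity solution.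
   Context: Let $\Omega\subset\mathbb{R}^2$ be a bounded open set with $\partial\Omega$ of class $W^{2,\infty}$, and $f>0$ a constant. For $x\in\mathbb{R}^2$, $p\in\mathbb{R}^2$ put $$Q(x)=\frac{f}{\sqrt{f^2+|x|^2}},\qquad W(x,p)=\frac{f^2|p|^2+(p\cdot x)^2}{Q(x)^2}.$$ Constants: for the Oren-Nayar model, $\sigma\in[0,\pi/2)$, $A=1-0.5\,\sigma^2(\sigma^2+0.33)^{-1}$, and the constant denoted $B$ in the formula for $F_{ON}$ below (not to be confused with the boundary operator) is $0.45\,\sigma^2(\sigma^2+0.09)^{-1}$; for the Phong and Blinn-Phong models, $k_A,k_D,k_S\ge 0$ with $k_A+k_D+k_S=1$ and $k_D>0$; $\alpha\ge1$ is an integer; $c\ge 1$ is a real number. Define on $[0,+\infty)$ $$F_L(r)=\sqrt{r+1},\qquad F_{ON}(r)=\frac{r+1}{A\sqrt{r+1}+Br},\qquad F_{BP}(r)=\frac{(r+1)^{c/2}}{k_D(r+1)^{\frac{c-1}{2}}+k_S},$$ $$F_{PH}(r)=\begin{cases}\dfrac{\sqrt{r+1}}{k_D}& r\ge 1,\\[2mm] \dfrac{(r+1)^{\alpha+1/2}}{k_D(r+1)^{\alpha}+k_S(r+1)^{1/2}(1-r)^{\alpha}}& 0\le r<1.\end{cases}$$ Let $I,I_A:\overline\Omega\to\mathbb{R}$ be given functions (image intensity and ambient light component). For $M\in\{L,ON,PH,BP\}$ the Hamiltonian is $$H^{M}(x,r,p)=-e^{-2r}+\mathcal{I}(x)\,f^2\,F_M(W(x,p)),\qquad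 x\in\overline\Omega,\ r\in\mathbb{R},\ p\in\mathbb{R}^2,$$ where $\mathcal{I}=I$ if $M\in\{L,ON\}$ and $\mathcal{I}=I-k_AI_A$ if $M\in\{PH,BP\}$. Standing assumption: $\mathcal{I}$ is Lipschitz continuous in $\overline\Omega$, and there exist $\delta>0$ and a neighborhood $\Gamma$ of $\partial\Omega$ such that $\mathcal{I}(x)\ge\delta>0$ for $x\in\Gamma$ (i.e. for $x\in\Gamma\cap\overline\Omega$). Boundary operators $B(x,r,p)$ on $\partial\Omega\times\mathbb{R}\times\mathbb{R}^2$: Dirichlet: $B(x,r,p)=r-g(x)$ with $g:\partial\Omega\to\mathbb{R}$ continuous; Neumann: $B(x,r,p)=N(x)\cdot p-g(x)$ with $N(x)$ the outward unit normal to $\partial\Omega$ at $x$ and $g:\partial\Omega\to\mathbb{R}$ continuous; state constraints: formally $B(x,r,p)=r-g(x)$ with $g\equiv+\infty$, i.e. no condition is imposed on subsolutions at boundary points, and supersolutions must satisfy $H\ge0$ in the viscosity sense at boundary points. Viscosity solutions of (P): a viscosity subsolution is an upper semicontinuous $u:\overline\Omega\to\mathbb{R}$ such that for any $\phi\in C^1(\overline\Omega)$, if $x_0\in\overline\Omega$ is a local maximum point of $u-\phi$ (on $\overline\Omega$), then $H(x_0,u(x_0),\nabla\phi(x_0))\le0$ if $x_0\in\Omega$, and $\min[H(x_0,u(x_0),\nabla\phi(x_0)),\,B(x_0,u(x_0),\nabla\phi(x_0))]\le0$ if $x_0\in\partial\Omega$. A viscosity supersolution is a lower semicontinuous $u:\overline\Omega\to\mathbb{R}$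 such that for any $\phi\in C^1(\overline\Omega)$, if $x_0\in\overline\Omega$ is a local minimum point of $u-\phi$ (on $\overline\Omega$), then $H(x_0,u(x_0),\nabla\phi(x_0))\ge0$ if $x_0\in\Omega$, and $\max[H(x_0,u(x_0),\nabla\phi(x_0)),\,B(x_0,u(x_0),\nabla\phi(x_0))]\ge0$ if $x_0\in\partial\Omega$. A viscosity solution is both a subsolution and a supersolution; in particular it belongs to $C(\overline\Omega)$. *)

(* Defs.v *)
From HB Require Import structures.
From mathcomp Require Import all_boot all_order all_algebra.
From mathcomp Require Import all_classical all_reals all_analysis.

Set Implicit Arguments.
Unset Strict Implicit.
Unset Printing Implicit Defensive.

Import Order.TTheory GRing.Theory Num.Theory.
Import numFieldNormedType.Exports.

Local Open Scope classical_set_scope.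
Local Open Scope ring_scope.

(* The library norm on 'rV[R]_2 is the sup norm; all Euclidean quantities below
   go through dotv. *)
Definition dotv (R : realType) (p q : 'rV[R]_2) : R :=
  \sum_(i < 2) p 0 i * q 0 i.

Definition frontier (T : topologicalType) (A : set T) : set T :=
  closure A `\` interior A.

(** W^{2,oo} functions on an open subset of the line *)

Definition C1_test (R : realType) (U : set R) (phi : R -> R) : Prop :=
  [/\ forall t, derivable phi t 1, continuous (derive1 phi) &
      exists K : set R, [/\ compact K, K `<=` U & forall t, ~ K t -> phi t = 0]].

Definition weak_derivative (R : realType) (U : set R) (g h : R -> R) : Prop :=
  forall phi, C1_test U phi ->
    \int[lebesgue_measure]_(t in U) (g t * derive1 phi t) =
    - \int[lebesgue_measure]_(t in U) (h t * phi t).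

Definition in_Linfty (R : realType) (U : set R) (g : R -> R) : Prop :=
  g \_ U \in Lfun (@lebesgue_measure R) +oo%E.

Definition in_W2infty (R : realType) (U : set R) (g : R -> R) : Prop :=
  exists g1 g2, [/\ weak_derivative U g g1, weak_derivative U g1 g2,
    in_Linfty U g, in_Linfty U g1 & in_Linfty U g2].

(** Domains with boundary of class W^{2,oo} *)

(* In the coordinates y = (x - x0) O, O orthogonal, the part of Omega in the
   Euclidean ball B(x0, r) is the part of { y_2 > gamma(y_1) } in that ball.
   Continuity selects the continuous representative of the W^{2,oo} class. *)
Definition W2infty_chart (R : realType) (Omega : set 'rV[R]_2) (x0 : 'rV[R]_2)
    (r : R) (O : 'M[R]_2) (gamma : R -> R) : Prop :=
  [/\ 0 < r, O *m O^T = 1%:M,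
      {within `]- r, r[, continuous gamma}, in_W2infty `]- r, r[ gamma &
      forall x, dotv (x - x0) (x - x0) < r ^+ 2 ->
        (Omega x <-> gamma (((x - x0) *m O) 0 0) < ((x - x0) *m O) 0 1)].

Definition W2infty_boundary (R : realType) (Omega : set 'rV[R]_2) : Prop :=
  forall x0, frontier Omega x0 ->
    exists r O gamma, W2infty_chart Omega x0 r O gamma.

(* In the coordinates of a chart at x, Omega lies above the graph of gamma and x
   is the origin, so the outward unit normal is
   (gamma'(0), -1) / sqrt (1 + gamma'(0)^2). *)
Definition is_outward_unit_normal (R : realType) (Omega : set 'rV[R]_2)
    (x n : 'rV[R]_2) : Prop :=
  exists r O gamma, W2infty_chart Omega x r O gamma /\
    n *m O = (Num.sqrt (1 + derive1 gamma 0 ^+ 2))^-1 *: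
             \row_(i < 2) (if i == 0 then derive1 gamma 0 else -1).

Definition outward_unit_normal (R : realType) (Omega : set 'rV[R]_2)
    (x : 'rV[R]_2) : 'rV[R]_2 :=
  xget 0 [set n | is_outward_unit_normal Omega x n].

(** Hamiltonians *)

Definition Q (R : realType) (f : R) (x : 'rV[R]_2) : R :=
  f / Num.sqrt (f ^+ 2 + dotv x x).

Definition W (R : realType) (f : R) (x p : 'rV[R]_2) : R :=
  (f ^+ 2 * dotv p p + dotv p x ^+ 2) / Q f x ^+ 2.

Inductive reflectance (R : realType) : Type :=
| Lambert
| OrenNayar of R                         (* sigma *)
| Phong of R & R & R & nat               (* k_A, k_D, k_S, alpha *)
| BlinnPhong of R & R & R & R.           (* k_A, k_D, k_S, c *)

Arguments Lambert {R}.

Definition is_oren_nayar (R : realType) (M : reflectance R) : bool :=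
  if M is OrenNayar _ then true else false.

Definition admissible (R : realType) (M : reflectance R) : Prop :=
  match M with
  | Lambert => True
  | OrenNayar sigma => 0 <= sigma < pi / 2
  | Phong kA kD kS alpha =>
      [/\ [/\ 0 <= kA, 0 <= kD & 0 <= kS], kA + kD + kS = 1, 0 < kD
        & (1 <= alpha)%N]
  | BlinnPhong kA kD kS c =>
      [/\ [/\ 0 <= kA, 0 <= kD & 0 <= kS], kA + kD + kS = 1, 0 < kD
        & 1 <= c]
  end.

Definition F_L (R : realType) (r : R) : R := Num.sqrt (r + 1).

Definition A_ON (R : realType) (sigma : R) : R :=
  1 - 5 / 10 * sigma ^+ 2 * (sigma ^+ 2 + 33 / 100)^-1.

Definition B_ON (R : realType) (sigma : R) : R :=
  45 / 100 * sigma ^+ 2 * (sigma ^+ 2 + 9 / 100)^-1.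

Definition F_ON (R : realType) (sigma r : R) : R :=
  (r + 1) / (A_ON sigma * Num.sqrt (r + 1) + B_ON sigma * r).

Definition F_BP (R : realType) (kD kS c r : R) : R :=
  (r + 1) `^ (c / 2) / (kD * (r + 1) `^ ((c - 1) / 2) + kS).

Definition F_PH (R : realType) (kD kS : R) (alpha : nat) (r : R) : R :=
  if 1 <= r then Num.sqrt (r + 1) / kD
  else (r + 1) `^ (alpha%:R + 1 / 2) /
       (kD * (r + 1) ^+ alpha + kS * (r + 1) `^ (1 / 2) * (1 - r) ^+ alpha).

Definition F_of (R : realType) (M : reflectance R) : R -> R :=
  match M with
  | Lambert => @F_L R
  | OrenNayar sigma => F_ON sigma
  | Phong _ kD kS alpha => F_PH kD kS alpha
  | BlinnPhong _ kD kS c => F_BP kD kS c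
  end.

Definition intensity (R : realType) (M : reflectance R) (I IA : 'rV[R]_2 -> R)
    (x : 'rV[R]_2) : R :=
  match M with
  | Lambert | OrenNayar _ => I x
  | Phong kA _ _ _ | BlinnPhong kA _ _ _ => I x - kA * IA x
  end.

Definition hamiltonian (R : realType) (f : R) (I IA : 'rV[R]_2 -> R)
    (M : reflectance R) (x : 'rV[R]_2) (r : R) (p : 'rV[R]_2) : R :=
  - expR (- (2 * r)) + intensity M I IA x * f ^+ 2 * F_of M (W f x p).

Definition intensity_assumption (R : realType) (Omega : set 'rV[R]_2)
    (J : 'rV[R]_2 -> R) : Prop :=
  [lipschitz J x | x in closure Omega] /\
  exists (delta : R) (Gamma : set 'rV[R]_2),
    [/\ 0 < delta, forall x, frontier Omega x -> nbhs x Gamma &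
        forall x, Gamma x -> closure Omega x -> delta <= J x].

(** Boundary conditions *)

Inductive boundary_condition (R : realType) : Type :=
| Dirichlet of ('rV[R]_2 -> R)
| Neumann of ('rV[R]_2 -> R)
| StateConstraints.

Arguments StateConstraints {R}.

Definition continuous_data (R : realType) (Omega : set 'rV[R]_2)
    (bc : boundary_condition R) : Prop :=
  match bc with
  | Dirichlet g | Neumann g => {within frontier Omega, continuous g}
  | StateConstraints => True
  end.

(* Extended-real valued because of state constraints, where B is r - g with
   g = +oo. *)
Definition boundary_operator (R : realType) (Omega : set 'rV[R]_2)
    (bc : boundary_condition R) (x : 'rV[R]_2) (r : R) (p : 'rV[R]_2) : \bar R :=
  match bc with
  | Dirichlet g => (r - g x)%:E
  | Neumann g => (dotv (outward_unit_normal Omega x) p - g x)%:E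
  | StateConstraints => (r%:E - +oo)%E
  end.

(** Viscosity solutions; a function on the closure of Omega is represented by a
    function on the plane, of which only the values on the closure matter *)

(* phi is C^1 in Omega, and phi and its gradient Dphi extend continuously to the
   closure of Omega; at frontier points Dphi is that extension. *)
Definition C1_closure (R : realType) (Omega : set 'rV[R]_2)
    (phi : 'rV[R]_2 -> R) (Dphi : 'rV[R]_2 -> 'rV[R]_2) : Prop :=
  [/\ {within closure Omega, continuous phi},
      {within closure Omega, continuous Dphi} &
      forall x, Omega x -> differentiable phi x /\
        forall h, 'd phi x h = dotv (Dphi x) h].

Definition lsc_on (R : realType) (A : set 'rV[R]_2) (u : 'rV[R]_2 -> R) : Prop :=
  lower_semicontinuous (fun x : subspace A => (u x)%:E).

Definition usc_on (R : realType) (A : set 'rV[R]_2) (u : 'rV[R]_2 -> R) : Prop :=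
  lsc_on A (fun x => - u x).

Definition local_max_on (R : realType) (A : set 'rV[R]_2) (w : 'rV[R]_2 -> R)
    (x0 : 'rV[R]_2) : Prop :=
  A x0 /\ \forall x \near x0, A x -> w x <= w x0.

Definition local_min_on (R : realType) (A : set 'rV[R]_2) (w : 'rV[R]_2 -> R)
    (x0 : 'rV[R]_2) : Prop :=
  A x0 /\ \forall x \near x0, A x -> w x0 <= w x.

Definition viscosity_subsolution (R : realType) (Omega : set 'rV[R]_2)
    (H : 'rV[R]_2 -> R -> 'rV[R]_2 -> R) (bc : boundary_condition R)
    (u : 'rV[R]_2 -> R) : Prop :=
  usc_on (closure Omega) u /\
  forall phi Dphi x0, C1_closure Omega phi Dphi ->
    local_max_on (closure Omega) (fun x => u x - phi x) x0 ->
    (Omega x0 -> H x0 (u x0) (Dphi x0) <= 0) /\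
    (frontier Omega x0 ->
      (mine (H x0 (u x0) (Dphi x0))%:E
            (boundary_operator Omega bc x0 (u x0) (Dphi x0)) <= 0)%E).

Definition viscosity_supersolution (R : realType) (Omega : set 'rV[R]_2)
    (H : 'rV[R]_2 -> R -> 'rV[R]_2 -> R) (bc : boundary_condition R)
    (u : 'rV[R]_2 -> R) : Prop :=
  lsc_on (closure Omega) u /\
  forall phi Dphi x0, C1_closure Omega phi Dphi ->
    local_min_on (closure Omega) (fun x => u x - phi x) x0 ->
    (Omega x0 -> 0 <= H x0 (u x0) (Dphi x0)) /\
    (frontier Omega x0 ->
      (0 <= maxe (H x0 (u x0) (Dphi x0))%:E
                 (boundary_operator Omega bc x0 (u x0) (Dphi x0)))%E).

Definition viscosity_solution (R : realType) (Omega : set 'rV[R]_2)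
    (H : 'rV[R]_2 -> R -> 'rV[R]_2 -> R) (bc : boundary_condition R)
    (u : 'rV[R]_2 -> R) : Prop :=
  viscosity_subsolution Omega H bc u /\ viscosity_supersolution Omega H bc u.

Definition comparison_set (R : realType) (Omega : set 'rV[R]_2)
    (bc : boundary_condition R) : set 'rV[R]_2 :=
  if bc is Neumann _ then closure Omega else Omega.

Definition maximum_principle (R : realType) (Omega : set 'rV[R]_2)
    (H : 'rV[R]_2 -> R -> 'rV[R]_2 -> R) (bc : boundary_condition R) : Prop :=
  forall u v, viscosity_subsolution Omega H bc u ->
    viscosity_supersolution Omega H bc v ->
    forall x, comparison_set Omega bc x -> u x <= v x.

Definition at_most_one_solution (R : realType) (Omega : set 'rV[R]_2)
    (H : 'rV[R]_2 -> R -> 'rV[R]_2 -> R) (bc : boundary_condition R) : Prop :=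
  forall u v, viscosity_solution Omega H bc u -> viscosity_solution Omega H bc v ->
    forall x, closure Omega x -> u x = v x.

(* Main.v *)
Require Import Defs.
From HB Require Import structures.
From mathcomp Require Import all_boot all_order all_algebra.
From mathcomp Require Import all_classical all_reals all_analysis.
From mathcomp Require Import ess_sup_inf measurable_realfun.
From mathcomp Require Import ring lra.

Set Implicit Arguments.
Unset Strict Implicit.
Unset Printing Implicit Defensive.

Import Order.TTheory GRing.Theory Num.Theory.
Import numFieldNormedType.Exports.

Local Open Scope classical_set_scope.
Local Open Scope ring_scope.

(** Comparison is proved by doubling the variables. Let A be the set on which
    [u <= v] is claimed, and suppose that [u - v] is positive somewhere on A. Let
    [m > 0] be the limit, as d tends to 0, of the supremum of [u x - v y] over x in
    A and y in the closure of Omega at distance less than d, and let xh be a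
    cluster point of maximising pairs ([merging_sup]). Maximising
    [u x - v y] minus the penalty

      [|x - y - eps xi|^2 / eps^2 + a . (x - y) + b . (x + y - 2 xh) + kap |y - xh|^2]

    produces points x, y near xh and gradients p, q of test functions touching u
    at x from above and v at y from below ([doubling]); with [beta >= |b|] small
    and eps much smaller, both [|p - q|] and [|x - y| (1 + |p|)] are of order beta
    ([doubling_bounds]). If the equation holds at both points, that is
    [H x (u x) p <= 0 <= H y (v y) q], this is absurd. Indeed every admissible
    reflectance is a Lipschitz function of [sqrt (r + 1)] ([F_of_root]) and
    [sqrt (W + 1)] is Lipschitz in p, and in x up to a factor [1 + |p|]
    ([sqrtW_lip]), so [exp (- 2 v y) - exp (- 2 u x)] is of order beta
    ([hamiltonian_gap]), whereas [u x - v y] stays above [m / 2] and u is bounded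
    above ([no_gap]).

    It remains to choose xi, a, b and kap so that the boundary conditions are
    inactive at x and y ([comparison_step]).

    If xh is interior there is nothing to do ([interior_case]).

    For the Neumann condition, A is the closure and [xi = 0]. A boundary of class
    W^{2,oo} is of class C^{1,1}: testing the weak second derivative against cubic
    splines bounds second differences ([W2infty_diff2]), which makes the chart both
    semiconvex and semiconcave ([C11_of_diff2]). Hence
    [(y - x) . N x <= C |y - x|^2] for boundary points x and y in the closure, with
    C locally uniform ([boundary_geometry]): on the unfavourable side, the normal
    component of the quadratic penalties is small compared to beta once kap is
    large. Taking [a = g xh N xh] to match the data and [b = beta N xh] gives
    [N x . p > g x] and [N y . q < g y], so that the equation itself must hold
    ([neumann_case]). This covers the Oren-Nayar model, whose Hamiltonian is in
    general not coercive.

    For Dirichlet and state-constraint conditions, A is Omega, [a = b = 0], and xi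
    is the axis of an interior cone ([chart_cone]); it forces x into Omega. The
    maximum is then compared with the pair [(xh + eps xi, xh)], and one has to know
    that u does not drop along xi. This is where coercivity enters: for the other
    three models H bounds [|p|] near the boundary ([hamiltonian_coercive]), and a
    subsolution of a coercive equation decreases at a bounded rate along xi
    ([directional_estimate]). At y, state constraints impose the equation; in the
    Dirichlet case coercivity also gives [u <= g] on the boundary
    ([subsolution_le_data]), so that [v y < g y] and the equation holds again
    ([coercive_case]).

    Uniqueness follows because solutions are continuous on the closure. *)

(** * Splines as test functions on the line *)

Lemma is_derive_of_quadratic_remainder (R : realType) (f : R -> R) (x d C e : R) :
  0 < e ->
  (forall h, `|h| < e -> `|f (x + h) - f x - d * h| <= C * h ^+ 2) ->
  is_derive x 1 f d.
Proof.
move=> e0 H.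
have C0 : 0 <= C.
  have := H (e / 2); rewrite gtr0_norm ?divr_gt0// => /(_ _)/(le_trans (normr_ge0 _)).
  rewrite pmulr_lge0 ?exprn_gt0 ?divr_gt0//; apply.
  by rewrite ltr_pdivrMr// mulr_natr mulr2n ltrDl.
have cv : (fun h => h^-1 *: (f (h *: 1 + x) - f x)) @ 0^' --> d.
  apply/cvgrPdist_le => /= t t0; near=> h.
  have h0 : h != 0 by near: h; exact: nbhs_dnbhs_neq.
  have he : `|h| < e.
    near: h; apply: dnbhs0_lt => //.
  rewrite -normrN opprB.
  have -> : h^-1 *: (f (h *: 1 + x) - f x) - d = h^-1 * (f (x + h) - f x - d * h).
    rewrite /GRing.scale/= mulr1 (addrC h x) !mulrBr; congr (_ - _).
    by rewrite mulrCA mulVf// mulr1.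
  rewrite normrM normfV ler_pdivrMl ?normr_gt0//.
  apply: (le_trans (H _ he)); rewrite -real_normK ?num_real// expr2 mulrCA.
  apply: ler_wpM2l => //.
  have : `|h| < t / (C + 1).
    by near: h; apply: dnbhs0_lt => //; rewrite divr_gt0// ltr_wpDl.
  rewrite ltr_pdivlMr ?ltr_wpDl// => ht; apply/ltW/(le_lt_trans _ ht).
  by rewrite mulrC ler_wpM2l// lerDl.
split; first by apply/cvg_ex; exists d.
by apply/cvg_lim => //; exact: cv.
Unshelve. all: by end_near. Qed.

(** The truncated power [t_+ ^ n]. *)
Definition tpow {R : realType} (n : nat) (t : R) : R := (Num.max 0 t) ^+ n.

Lemma is_derive_tpow2 (R : realType) (t : R) :
  is_derive t 1 (tpow 2) (2 * tpow 1 t).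
Proof.
apply: (@is_derive_of_quadratic_remainder _ _ _ _ 1 1) => // h _.
rewrite /tpow /Num.max.
rewrite ler_norml !expr1 !expr2; apply/andP; split; case: ifPn; case: ifPn; rewrite -?leNgt => *; nra.
Qed.

Lemma tpow3E (R : realType) : tpow 3 = (fun t : R => t * tpow 2 t).
Proof.
by apply/funext => t; rewrite /tpow /Num.max; case: ifPn => _; rewrite ?exprS //; ring.
Qed.

Lemma is_derive_tpow3 (R : realType) (t : R) :
  is_derive t 1 (tpow 3) (3 * tpow 2 t).
Proof.
rewrite tpow3E.
have H := @is_deriveM _ _ id (tpow 2) t 1 1 (2 * tpow 1 t) (is_derive_id _ _) (is_derive_tpow2 t).
apply: (is_derive_eq H); rewrite /GRing.scale/= /tpow /Num.max.
by case: ifPn => _; rewrite ?exprS; ring.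
Qed.

Lemma continuous_tpow1 (R : realType) : continuous (@tpow R 1).
Proof.
move=> t; rewrite /tpow; apply/cvgrPdist_lt => e e0.
near=> s; rewrite !expr1.
have : `|t - s| < e by near: s; exact: cvgr_dist_lt.
by rewrite /Num.max !ltr_norml => /andP[? ?]; apply/andP; split;
  case: ifPn; case: ifPn; rewrite -?leNgt => *; lra.
Unshelve. all: by end_near. Qed.

Lemma continuous_tpow2 (R : realType) : continuous (@tpow R 2).
Proof.
move=> t; apply/differentiable_continuous/derivable1_diffP.
by case: (is_derive_tpow2 t).
Qed.

(** It commutes with differentiation, so that differentiating a spline only
    lowers its truncated powers. *)
Definition diff2 {R : realType} (h : R) (F : R -> R) (t : R) : R :=
  F (t + h) - 2 * F t + F (t - h).

Lemma is_derive_translate (R : realType) (F dF : R -> R) (c t : R) :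
  (forall t : R, is_derive t 1 F (dF t)) ->
  is_derive t 1 (fun t => F (t + c)) (dF (t + c)).
Proof.
move=> H.
have H1 : is_derive t 1 (fun t : R => t + c) (1 + 0).
  by apply: is_deriveD.
have := @is_derive1_comp _ F (fun t => t + c) t _ _ (H (t + c)) H1.
by rewrite addr0 mulr1.
Qed.

Lemma is_derive_diff2 (R : realType) (h : R) (F dF : R -> R) (t : R) :
  (forall t : R, is_derive t 1 F (dF t)) ->
  is_derive t 1 (diff2 h F) (diff2 h dF t).
Proof.
move=> H; rewrite /diff2.
have H1 := is_derive_translate h t H.
have H2 := is_derive_translate (- h) t H.
have H3 : is_derive t 1 (fun t => 2 * F t) (2 * dF t).
  exact: (@is_deriveZ _ _ _ F 2 t 1 (dF t) (H t)).
exact: (is_deriveD (is_deriveB H1 H3) H2).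
Qed.

Lemma continuous_translate (R : realType) (F : R -> R) (c : R) :
  continuous F -> continuous (fun t => F (t + c)).
Proof.
move=> cF t; apply: (@continuous_comp _ _ _ (fun t : R => t + c) F); last exact: cF.
by apply: cvgD; [exact: cvg_id|exact: cvg_cst].
Qed.

Lemma continuous_diff2 (R : realType) (h : R) (F : R -> R) :
  continuous F -> continuous (diff2 h F).
Proof.
move=> cF t; rewrite /diff2.
have H1 := @continuous_translate _ _ h cF t; have H2 := @continuous_translate _ _ (- h) cF t.
have H3 : {for t, continuous (fun t => 2 * F t)} by apply: cvgM; [exact: cvg_cst|exact: cF].
exact: (cvgD (cvgB H1 H3) H2).
Qed.

(** For [n = 1] and [c = s ^- 2] this is the second difference, with step h, of
    the unit-mass tent of half-width s centred at a; for [n = 3] it is a C^2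
    function having that second difference as second derivative. The factor c
    absorbs the constants produced by differentiation. *)
Definition spline {R : realType} (n : nat) (a h s : R) (c : R) (t : R) : R :=
  c * diff2 h (diff2 s (tpow n)) (t - a).

Lemma is_derive_spline (R : realType) (n : nat) (a h s c k t : R) :
  (forall t : R, is_derive t 1 (tpow n.+1) (k * tpow n t)) ->
  is_derive t 1 (spline n.+1 a h s c) (spline n a h s (c * k) t).
Proof.
move=> H; rewrite /spline.
have H1 := is_derive_translate (- a) t (fun t => is_derive_diff2 h t (fun t => is_derive_diff2 s t H)).
have := @is_deriveZ _ _ _ (fun t => diff2 h (diff2 s (tpow n.+1)) (t - a)) c t 1 _ H1.
move=> H2; apply: (is_derive_eq H2).
by rewrite /GRing.scale/= /diff2; ring.
Qed.

Lemma continuous_spline (R : realType) (n : nat) (a h s c : R) :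
  continuous (@tpow R n) -> continuous (spline n a h s c).
Proof.
move=> H t; apply: cvgM; first exact: cvg_cst.
exact: (@continuous_translate _ _ (- a) (@continuous_diff2 _ h _ (@continuous_diff2 _ s _ H)) t).
Qed.

Lemma tpow_pos (R : realType) n (t : R) : 0 <= t -> tpow n t = t ^+ n.
Proof. by move=> t0; rewrite /tpow max_r. Qed.

Lemma tpow_neg (R : realType) n (t : R) : t <= 0 -> tpow n.+1 t = 0.
Proof. by move=> t0; rewrite /tpow max_l// expr0n. Qed.

(** To the left all truncated powers vanish; to the right they are polynomials
    of degree at most 3, which fourth differences annihilate. *)
Lemma spline_support (R : realType) (n : nat) (a h s c t : R) :
  (0 < n <= 3)%N -> 0 <= h -> 0 <= s -> h + s <= `|t - a| -> spline n a h s c t = 0.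
Proof.
move=> n03 h0 s0; rewrite /spline; move: (t - a) => {}t.
rewrite ler_normr => /orP[] H; rewrite /diff2.
  rewrite !tpow_pos; try lra.
  by move: n n03 => [|[|[|[|n]]]]// _; ring.
by move: n n03 => [|n]// _; rewrite !tpow_neg; lra.
Qed.

Lemma C1_test_spline (R : realType) (U : set R) (n : nat) (a h s c k : R) :
  0 <= h -> 0 <= s -> `[a - h - s, a + h + s] `<=` U -> (n < 3)%N ->
  (forall t : R, is_derive t 1 (tpow n.+1) (k * tpow n t)) ->
  continuous (@tpow R n) ->
  C1_test U (spline n.+1 a h s c) /\
  derive1 (spline n.+1 a h s c) = spline n a h s (c * k).
Proof.
move=> h0 s0 sub n3 H cn.
have D t := is_derive_spline a h s c t H.
have E : derive1 (spline n.+1 a h s c) = spline n a h s (c * k).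
  by apply/funext => t; rewrite derive1E; case: (D t).
split => //; split.
- by move=> t; case: (D t).
- by rewrite E; exact: continuous_spline.
- exists `[a - h - s, a + h + s]%classic; split => //; first exact: segment_compact.
  move=> t /=; rewrite in_itv/= => /negP; rewrite negb_and -!ltNge => nt.
  apply: spline_support => //.
  by rewrite ler_normr; case/orP: nt => nt; apply/orP; [right|left]; lra.
Qed.

Lemma Rintegral_support (R : realType) (D E : set R) (F : R -> R) :
  E `<=` D -> (forall t, D t -> ~ E t -> F t = 0) ->
  \int[lebesgue_measure]_(t in D) F t = \int[lebesgue_measure]_(t in E) F t.
Proof.
move=> ED F0; rewrite Rintegral_mkcond [RHS]Rintegral_mkcond; congr Rintegral.
apply/funext => t; rewrite /patch.
case: ifPn => tD; case: ifPn => tE //.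
- by apply: F0; [exact: set_mem|move/mem_set; rewrite (negPf tE)].
- by move/set_mem/ED/mem_set : tE; rewrite (negPf tD).
Qed.

Lemma diff2_tpow2_bounds (R : realType) (s t : R) : 0 < s ->
  0 <= diff2 s (tpow 2) t <= 2 * s ^+ 2.
Proof.
move=> s0; rewrite /diff2 /tpow /Num.max.
by case: ifPn; case: ifPn; case: ifPn; rewrite -?leNgt => *; apply/andP; split; nra.
Qed.

(** The spline is the difference of two increments over h of a function with
    slopes between 0 and [6 s ^ 2]. The bound does not depend on s, which will
    tend to 0. *)
Lemma spline_le (R : realType) (a h s t : R) : 0 <= h -> 0 < s ->
  `|spline 3 a h s ((6 * s ^+ 2)^-1) t| <= 2 * h.
Proof.
move=> h0 s0; rewrite /spline /diff2 -/(diff2 _ _ _); move: (t - a) => {}t.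
pose B := diff2 s (@tpow R 3).
have dB (x : R) : is_derive x 1 B (3 * diff2 s (tpow 2) x).
  have H := is_derive_diff2 s x (@is_derive_tpow3 R).
  by apply: (is_derive_eq H); rewrite /diff2; ring.
have lip (x y : R) : x <= y -> 0 <= B y - B x <= 6 * s ^+ 2 * (y - x).
  move=> xy.
  have cB : {within `[x, y], continuous B}.
    apply: continuous_subspaceT => z.
    by apply/differentiable_continuous/derivable1_diffP; case: (dB z).
  have [c _ ->] := MVT_segment xy (fun z _ => dB z) cB.
  have /andP[d0 d1] := diff2_tpow2_bounds c s0.
  by apply/andP; split; nra.
have s2 : 0 < 6 * s ^+ 2 by rewrite mulr_gt0// exprn_gt0.
rewrite normrM gtr0_norm ?invr_gt0// ler_pdivrMl//.
have H1 : t <= t + h by lra.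
have H2 : t - h <= t by lra.
have /andP[] := lip _ _ H1; have /andP[] := lip _ _ H2; rewrite /B /diff2.
set u1 := _ + tpow 3 (t - s); set u2 := _ + tpow 3 (t + h - s); set u3 := _ + tpow 3 (t - h - s).
by move=> *; rewrite ler_norml; apply/andP; split; nra.
Qed.

(** * Functions of class W^{2,oo} are C^{1,1} *)

Lemma in_LinftyP (R : realType) (U : set R) (g : R -> R) :
  in_Linfty U g -> measurable U ->
  measurable_fun U g /\
  exists2 K : R, 0 <= K & {ae (@lebesgue_measure R), forall t, U t -> `|g t| <= K}.
Proof.
move=> /andP[]; rewrite !inE/= => mg fg mU; split.
  by have := (measurable_restrictT g mU).2 mg.
move: fg; rewrite /finite_norm unlock /=.
have muT : (0 < @lebesgue_measure R [set: R])%E.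
  apply: (@lt_le_trans _ _ (@lebesgue_measure R `[0, 1]%classic)).
    by rewrite lebesgue_measure_itv/= lte_fin ltr01 sube0 lte_fin ltr01.
  by apply: le_measure; rewrite ?inE.
rewrite muT => lty.
have [K K0 HK] : exists2 K : R, 0 <= K &
    (ess_sup lebesgue_measure (abse \o (EFin \o (g \_ U))) <= K%:E)%E.
  move: lty; case: (ess_sup _ _) => [r| |]// _.
    by exists `|r| => //; rewrite lee_fin ler_norm.
  by exists 0 => //; rewrite leNye.
exists K => //.
move/ess_supP : HK; apply: filterS => t /=; rewrite lee_fin /patch => + Ut.
by rewrite (mem_set Ut).
Qed.

Lemma continuous_tent (R : realType) (c s : R) :
  continuous (fun t : R => (s ^+ 2)^-1 * diff2 s (tpow 1) (t - c)).
Proof.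
move=> t; apply: cvgM; first exact: cvg_cst.
exact: (@continuous_translate _ _ (- c) (@continuous_diff2 _ s _ (@continuous_tpow1 R)) t).
Qed.

Lemma Rintegral_tent (R : realType) (c s : R) : 0 < s ->
  \int[lebesgue_measure]_(t in `[c - s, c + s]) ((s ^+ 2)^-1 * diff2 s (tpow 1) (t - c)) = 1.
Proof.
move=> s0.
have s2 : s ^+ 2 != 0 by rewrite expf_neq0// gt_eqF.
pose F (t : R) : R := (2 * s ^+ 2)^-1 * diff2 s (tpow 2) (t - c).
have dF (t : R) : is_derive t 1 F ((s ^+ 2)^-1 * diff2 s (tpow 1) (t - c)).
  have H1 := @is_derive_translate _ _ _ (- c) t (fun t => is_derive_diff2 s t (@is_derive_tpow2 R)).
  have H2 := @is_deriveZ _ _ _ (fun t => diff2 s (tpow 2) (t - c)) (2 * s ^+ 2)^-1 t 1 _ H1.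
  apply: (is_derive_eq H2); rewrite /GRing.scale/= /diff2; field.
  by apply/eqP; lra.
have cF : continuous F.
  by move=> z; apply/differentiable_continuous/derivable1_diffP; case: (dF z).
rewrite /Rintegral (@continuous_FTC2 _ _ F).
- have -> : F (c + s) = 1.
    by rewrite /F /diff2 !tpow_pos; first (by field; apply/eqP; lra); lra.
  have -> : F (c - s) = 0; last by rewrite -EFinB subr0.
  by rewrite /F /diff2 !tpow_neg; lra.
- by lra.
- by apply: continuous_subspaceT; exact: (@continuous_tent R c s).
- split.
  + by move=> x _; case: (dF x).
  + by apply: cvg_at_right_filter; exact: cF.
  + by apply: cvg_at_left_filter; exact: cF.
- by move=> x _; rewrite derive1E; case: (dF x).
Qed.

Lemma tent_ge0 (R : realType) (s t : R) : 0 < s -> 0 <= (s ^+ 2)^-1 * diff2 s (tpow 1) t.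
Proof.
move=> s0; apply: mulr_ge0; first by rewrite invr_ge0 exprn_ge0// ltW.
rewrite /diff2 /tpow !expr1 /Num.max.
by case: ifPn; case: ifPn; case: ifPn; rewrite -?leNgt => *; lra.
Qed.

(** The tent is nonnegative of unit mass, so the integral is an average of g over
    [[c - s, c + s]]; this recovers point values as s tends to 0. *)
Lemma tent_average (R : realType) (U : set R) (g : R -> R) (c s w : R) :
  0 < s -> `[c - s, c + s] `<=` U -> {within `[c - s, c + s], continuous g} ->
  (forall t, `|t - c| <= s -> `|g t - g c| <= w) ->
  `|\int[lebesgue_measure]_(t in U) (g t * ((s ^+ 2)^-1 * diff2 s (tpow 1) (t - c)))
    - g c| <= w.
Proof.
move=> s0 sub cg Hw.
pose b (t : R) : R := (s ^+ 2)^-1 * diff2 s (tpow 1) (t - c).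
have b0 t : 0 <= b t by exact: tent_ge0.
have cb : continuous b := @continuous_tent R c s.
rewrite (@Rintegral_support _ U `[c - s, c + s]) => //; last first.
  move=> t _ /=; rewrite in_itv/= => /negP; rewrite negb_and -!ltNge => nt.
  rewrite [X in _ * (_ * X)](_ : _ = 0) ?mulr0// /diff2.
  case/orP: nt => nt; first by rewrite !tpow_neg; lra.
  by rewrite !tpow_pos; lra.
have I1 := Rintegral_tent c s0.
have intb (F : R -> R) : {within `[c - s, c + s], continuous F} ->
    lebesgue_measure.-integrable `[c - s, c + s] (EFin \o (fun t => F t * b t)).
  move=> cF; apply: continuous_compact_integrable; first exact: segment_compact.
  by move=> x; apply: cvgM; [exact: cF|exact: continuous_subspaceT].
have cc (k : R) : {within `[c - s, c + s], continuous (fun _ : R => k)}.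
  by move=> x; exact: cvg_cst.
have -> : g c = \int[lebesgue_measure]_(t in `[c - s, c + s]) (g c * b t).
  rewrite RintegralZl//; first by rewrite I1 mulr1.
  have := intb _ (cc 1); congr (_.-integrable _ _).
  by apply/funext => t /=; rewrite mul1r.
rewrite -RintegralB//; [|exact: intb|exact: intb].
have E : (fun t => g t * b t - g c * b t) = (fun t => (g t - g c) * b t).
  by apply/funext => t; rewrite mulrBl.
rewrite E.
have cgc : {within `[c - s, c + s], continuous (fun t => g t - g c)}.
  by move=> x; apply: cvgB; [exact: cg|exact: cvg_cst].
apply: le_trans (le_normr_Rintegral _ (intb _ cgc)) _ => //.
have -> : w = \int[lebesgue_measure]_(t in `[c - s, c + s]) (w * b t).
  rewrite RintegralZl//; first by rewrite I1 mulr1.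
  have := intb _ (cc 1); congr (_.-integrable _ _).
  by apply/funext => t /=; rewrite mul1r.
apply: le_Rintegral => //; last 2 first.
- exact: intb.
- move=> t /=; rewrite in_itv/= => /andP[t1 t2].
  rewrite normrM (ger0_norm (b0 t)) ler_wpM2r// Hw// ler_norml.
  by apply/andP; split; lra.
have -> : EFin \o (fun t => `|(g t - g c) * b t|) = abse \o (EFin \o (fun t => (g t - g c) * b t)).
  by apply/funext.
by apply: integrable_abse; exact: intb.
Qed.

Lemma within_open_continuousP (R : realType) (U : set R) (g : R -> R) (x : R) :
  open U -> {within U, continuous g} -> U x ->
  forall e : R, 0 < e -> exists2 d : R, 0 < d & forall y : R, `|y - x| < d -> `|g y - g x| < e.
Proof.
move=> oU + Ux e e0; rewrite continuous_open_subspace// => /(_ x (mem_set Ux)).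
move=> /cvgrPdist_lt /(_ e e0) /nbhs_ballP[d /= d0 H].
exists d => // y yd; rewrite distrC; apply: H; rewrite /ball/= distrC//.
Qed.

Lemma integrable_EFinZl d (T : measurableType d) (R : realType)
    (mu : {measure set T -> \bar R}) (D : set T) (k : R) (f : T -> R) :
  measurable D -> mu.-integrable D (EFin \o f) ->
  mu.-integrable D (EFin \o (fun t => k * f t)).
Proof.
move=> mD /(integrableZl mD k); congr (_.-integrable _ _).
Qed.

Lemma integrable_EFinB d (T : measurableType d) (R : realType)
    (mu : {measure set T -> \bar R}) (D : set T) (f g : T -> R) :
  measurable D -> mu.-integrable D (EFin \o f) -> mu.-integrable D (EFin \o g) ->
  mu.-integrable D (EFin \o (fun t => f t - g t)).
Proof.
move=> mD mf mg; have := integrableB mD mf mg; congr (_.-integrable _ _).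
Qed.

(** Testing the weak second derivative against a spline whose second derivative
    is a second difference of tents bounds the second differences of g: the
    spline is at most [2 h] on an interval of length at most [4 h]. *)
Lemma W2infty_diff2 (R : realType) (r : R) (g : R -> R) :
  {within `]- r, r[, continuous g} -> in_W2infty `]- r, r[ g ->
  exists2 K : R, 0 <= K & forall a h : R, 0 < h -> - r < a - h -> a + h < r ->
    `|diff2 h g a| <= K * h ^+ 2.
Proof.
move=> cg [g1 [g2 [w1 w2 _ _ L2]]].
have mU : measurable (`]- r, r[%classic : set R) by [].
have [mg2 [K K0 aeK]] := in_LinftyP L2 mU.
exists (8 * K); first by rewrite mulr_ge0.
move=> a h h0 ah1 ah2.
suff H : forall w : R, 0 < w -> `|diff2 h g a| <= 8 * K * h ^+ 2 + 4 * w.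
  apply/ler_addgt0Pr => e e0; apply: le_trans (H (e / 4) _) _; first by rewrite divr_gt0.
  by rewrite lerD2l; lra.
move=> w w0.
have Uo : open (`]- r, r[%classic : set R) by exact: interval_open.
have HU (c : R) : - r < c -> c < r -> (`]- r, r[%classic : set R) c.
  by move=> c1 c2 /=; rewrite in_itv/= c1 c2.
have [d1 d10 H1] := within_open_continuousP Uo cg (HU a ltac:(lra) ltac:(lra)) w0.
have [d2 d20 H2] := within_open_continuousP Uo cg (HU (a + h) ltac:(lra) ltac:(lra)) w0.
have [d3 d30 H3] := within_open_continuousP Uo cg (HU (a - h) ltac:(lra) ltac:(lra)) w0.
pose m : R := Num.min (Num.min (Num.min d1 d2) (Num.min d3 h)) (Num.min (r - (a + h)) (a - h + r)).
have m0 : 0 < m by rewrite !lt_min d10 d20 d30 h0/=; apply/andP; split; lra.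
have [md1 md2 md3 mh [mr1 mr2]] : [/\ m <= d1, m <= d2, m <= d3, m <= h
   & m <= r - (a + h) /\ m <= a - h + r].
  by rewrite /m; split; [..|split]; rewrite !ge_min lexx ?orbT.
pose s : R := m / 2.
have s0 : 0 < s by rewrite divr_gt0.
have sm : s < m by rewrite /s; lra.
have sub3 : `[a - h - s, a + h + s] `<=` `]- r, r[.
  move=> t /=; rewrite !in_itv/= => /andP[t1 t2]; apply/andP.
  by move: t1 t2 sm mr1 mr2; clear => *; split; lra.
have [[ra1 ra2] [rb1 rb2] [rc1 rc2]] : [/\ - r < a - s /\ a + s < r,
    - r < a + h - s /\ a + h + s < r & - r < a - h - s /\ a - h + s < r].
  by move: sm mh mr1 mr2 h0 s0; clear => *; split; split; lra.
have [T3 E3] := C1_test_spline (n := 2) ((6 * s ^+ 2)^-1) (ltW h0) (ltW s0) sub3 isT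
   (@is_derive_tpow3 R) (@continuous_tpow2 R).
have [T2 E2] := C1_test_spline (n := 1) ((6 * s ^+ 2)^-1 * 3) (ltW h0) (ltW s0) sub3 isT
   (@is_derive_tpow2 R) (@continuous_tpow1 R).
have := w1 _ T2; rewrite E2 => W1.
have := w2 _ T3; rewrite E3 => W2.
rewrite W2 opprK in W1.
have cs : (6 * s ^+ 2)^-1 * 3 * 2 = (s ^+ 2)^-1 by field; apply/eqP; lra.
rewrite cs in W1.
have bound : `|\int[lebesgue_measure]_(t in `]- r, r[)
     (g2 t * spline 3 a h s (6 * s ^+ 2)^-1 t)| <= 8 * K * h ^+ 2.
  rewrite (@Rintegral_support _ _ `[a - h - s, a + h + s]) => //; last first.
    move=> t _ /= /negP; rewrite in_itv/= negb_and -!ltNge => nt.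
    rewrite spline_support ?mulr0//; try exact: ltW.
    by rewrite ler_normr; case/orP: nt => nt; apply/orP; [right|left]; move: nt; clear; lra.
  set E := `[_, _]%classic.
  have mE : measurable E by exact: measurable_itv.
  pose f t := g2 t * spline 3 a h s (6 * s ^+ 2)^-1 t.
  have mf : measurable_fun E f.
    apply: measurable_funM; first exact: measurable_funS mg2.
    apply: measurable_funTS; apply: continuous_measurable_fun.
    move=> t; apply/differentiable_continuous/derivable1_diffP.
    by case: (is_derive_spline a h s (6 * s ^+ 2)^-1 t (@is_derive_tpow3 R)).
  have HB := @integral_le_bound _ _ _ (@lebesgue_measure R) E (EFin \o f) (K * (2 * h))%:E mE.
  have mf' : measurable_fun E (EFin \o f) by exact/measurable_EFinP.
  have KH : (0 <= (K * (2 * h))%:E)%E by rewrite lee_fin mulr_ge0// mulr_ge0// ltW.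
  have aef : {ae (@lebesgue_measure R), forall x, E x -> (`|(EFin \o f) x| <= (K * (2 * h))%:E)%E}.
    case: aeK => N [mN N0 sN]; exists N; split => // t Ht; apply: sN => Ht'; apply: Ht => Et.
    move: (Ht' (sub3 _ Et)) => {}Ht /=; rewrite lee_fin normrM.
    apply: ler_pM => //.
    exact: (spline_le _ _ (ltW h0) s0).
  have {}HB := HB mf' KH aef.
  have muE : lebesgue_measure E = (2 * (h + s))%:E.
    rewrite /E lebesgue_measure_itv/= lte_fin ifT; last by lra.
    by rewrite -EFinB; congr EFin; lra.
  have {}HB : (\int[lebesgue_measure]_(x in E) `|(EFin \o f) x| <= (K * (2 * h) * (2 * (h + s)))%:E)%E.
    by rewrite EFinM -muE; exact: HB.
  have intf : lebesgue_measure.-integrable E (EFin \o f).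
    apply/integrableP; split => //; apply: le_lt_trans HB _; exact: ltry.
  have := le_abse_integral lebesgue_measure mE mf'.
  rewrite -EFin_normr_Rintegral// => /le_trans /(_ HB); rewrite lee_fin.
  move=> /le_trans; apply.
  have -> : 8 * K * h ^+ 2 = K * (2 * h) * (2 * (2 * h)) by ring.
  apply: ler_wpM2l; first by rewrite mulr_ge0// mulr_ge0// ltW.
  lra.
have cgE (c : R) : - r < c - s -> c + s < r -> {within `[c - s, c + s], continuous g}.
  move=> c1 c2; apply: continuous_subspaceW cg.
  move=> t /=; rewrite !in_itv/= => /andP[t1 t2].
  by rewrite (lt_le_trans c1 t1) (le_lt_trans t2 c2).
have subE (c : R) : - r < c - s -> c + s < r -> `[c - s, c + s] `<=` `]- r, r[.
  move=> c1 c2 t /=; rewrite !in_itv/= => /andP[t1 t2].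
  by rewrite (lt_le_trans c1 t1) (le_lt_trans t2 c2).
pose av (c : R) := \int[lebesgue_measure]_(t in `]- r, r[)
     (g t * ((s ^+ 2)^-1 * diff2 s (tpow 1) (t - c))).
have A (c d : R) : - r < c - s -> c + s < r -> m <= d ->
    (forall y, `|y - c| < d -> `|g y - g c| < w) -> `|av c - g c| <= w.
  move=> c1 c2 md Hd; apply: tent_average => //; [exact: subE|exact: cgE|].
  by move=> t ts; apply/ltW/Hd/(le_lt_trans ts)/(lt_le_trans sm).
have A1 := A a d1 ra1 ra2 md1 H1.
have A2 := A (a + h) d2 rb1 rb2 md2 H2.
have A3 := A (a - h) d3 rc1 rc2 md3 H3.
have EQ : \int[lebesgue_measure]_(t in `]- r, r[) (g t * spline 1 a h s (s ^+ 2)^-1 t)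
   = av (a + h) - 2 * av a + av (a - h).
  have int (c : R) : - r < c - s -> c + s < r -> lebesgue_measure.-integrable `]- r, r[
      (EFin \o (fun t => g t * ((s ^+ 2)^-1 * diff2 s (tpow 1) (t - c)))).
    move=> c1 c2.
    have I : lebesgue_measure.-integrable `[c - s, c + s]
      (EFin \o (fun t => g t * ((s ^+ 2)^-1 * diff2 s (tpow 1) (t - c)))).
      apply: continuous_compact_integrable; first exact: segment_compact.
      move=> x; apply: cvgM; first exact: cgE.
      exact: (continuous_subspaceT (@continuous_tent R c s)).
    have Z t : ~ (`[c - s, c + s]%classic : set R) t -> diff2 s (tpow 1) (t - c) = 0.
      move=> /= /negP; rewrite in_itv/= negb_and -!ltNge /diff2 => /orP[] nt.
        by rewrite !tpow_neg//; move: nt s0; clear; lra.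
      by rewrite !tpow_pos; first (by ring); move: nt s0; clear; lra.
    apply/integrable_mkcond => //.
    have /integrable_mkcond I' := I.
    have {I'} := I' (measurable_itv _).
    congr (_.-integrable _ _); apply/funext => t; rewrite /patch.
    case: ifPn => t1; case: ifPn => t2 //=.
      by move/set_mem/(subE _ c1 c2)/mem_set : t1; rewrite (negPf t2).
    by rewrite Z ?mulr0// => /mem_set; rewrite (negPf t1).
  have i1 := int a ra1 ra2.
  have i2 := int (a + h) rb1 rb2.
  have i3 := int (a - h) rc1 rc2.
  have i1' : lebesgue_measure.-integrable `]- r, r[ (EFin \o (fun t => 2 * (g t * ((s ^+ 2)^-1 * diff2 s (tpow 1) (t - a))))).
    exact: integrable_EFinZl.
  rewrite /av -RintegralZl// -RintegralB// -RintegralD//.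
  - apply: eq_Rintegral => t _; rewrite /spline.
    rewrite [diff2 h _ _]/diff2.
    have -> : t - a - h = t - (a + h) by ring.
    have -> : t - a + h = t - (a - h) by ring.
    by ring.
  - exact: integrable_EFinB.
rewrite EQ in W1; rewrite -W1 in bound.
rewrite /diff2; move: A1 A2 A3 bound; rewrite !ler_norml; clear.
by move=> /andP[? ?] /andP[? ?] /andP[? ?] /andP[? ?]; apply/andP; split; lra.
Qed.

(** A continuous function with positive second differences has no interior
    maximum after subtraction of a chord, hence lies below its chords. *)
Lemma chord_of_diff2_pos (R : realType) (g : R -> R) (x z : R) :
  x < z -> {within `[x, z], continuous g} ->
  (forall a h, 0 < h -> x <= a - h -> a + h <= z -> 0 < diff2 h g a) ->
  forall y, x <= y <= z -> (z - x) * g y <= (z - y) * g x + (y - x) * g z.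
Proof.
move=> xz cg H y /andP[xy yz].
pose e t := (z - x) * g t - (z - t) * g x - (t - x) * g z.
suff : e y <= 0 by rewrite /e; lra.
have ce : {within `[x, z], continuous e}.
  have c1 : continuous (fun t => (z - t) * g x).
    by move=> t; apply: cvgM; [apply: cvgB; [exact: cvg_cst|exact: cvg_id]|exact: cvg_cst].
  have c2 : continuous (fun t => (t - x) * g z).
    by move=> t; apply: cvgM; [apply: cvgB; [exact: cvg_id|exact: cvg_cst]|exact: cvg_cst].
  move=> t; apply: cvgB; first apply: cvgB.
  - by apply: cvgM; [exact: cvg_cst|exact: cg].
  - exact: (continuous_subspaceT c1).
  - exact: (continuous_subspaceT c2).
have [c + Hc] := EVT_max (ltW xz) ce.
rewrite in_itv/= => /andP[xc cz].
have ecy : e y <= e c by apply: Hc; rewrite in_itv/= xy yz.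
apply: (le_trans ecy).
move: xc; rewrite le_eqVlt => /predU1P[<-|xc]; first by rewrite /e; lra.
move: cz; rewrite le_eqVlt => /predU1P[->|cz]; first by rewrite /e; lra.
exfalso.
pose h := Num.min (c - x) (z - c).
have h0 : 0 < h by rewrite lt_min !subr_gt0 xc cz.
have [h1 h2] : h <= c - x /\ h <= z - c by rewrite !ge_min !lexx ?orbT.
have := H c h h0 ltac:(lra) ltac:(lra).
have := Hc (c - h) ltac:(by rewrite in_itv/=; apply/andP; split; lra).
have := Hc (c + h) ltac:(by rewrite in_itv/=; apply/andP; split; lra).
rewrite /e /diff2 => e1 e2 D.
have : 0 < (z - x) * (g (c + h) - 2 * g c + g (c - h)) by rewrite mulr_gt0// subr_gt0.
by nra.
Qed.

(** The slope is the supremum of the left difference quotients, which the right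
    ones bound from above. *)
Lemma support_line (R : realType) (g : R -> R) (a b t0 : R) :
  (forall x y z, a < x -> x <= y -> y <= z -> x < z -> z < b ->
     (z - x) * g y <= (z - y) * g x + (y - x) * g z) ->
  a < t0 < b ->
  exists m, forall s, a < s < b -> g t0 + m * (s - t0) <= g s.
Proof.
move=> H /andP[at0 t0b].
pose S := [set q | exists2 s, a < s < t0 & q = (g t0 - g s) / (t0 - s)].
have ub z : t0 < z -> z < b -> ubound S ((g z - g t0) / (z - t0)).
  move=> t0z zb q [s /andP[as_ st0] ->].
  rewrite ler_pdivrMr ?subr_gt0// mulrAC ler_pdivlMr ?subr_gt0//.
  have := H s t0 z as_ (ltW st0) (ltW t0z) (lt_trans st0 t0z) zb.
  by nra.
have S0 : S !=set0.
  exists ((g t0 - g ((a + t0) / 2)) / (t0 - (a + t0) / 2)); exists ((a + t0) / 2) => //.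
  by apply/andP; split; lra.
have hS : has_sup S.
  split => //; exists ((g ((b + t0) / 2) - g t0) / ((b + t0) / 2 - t0)).
  by apply: ub; lra.
exists (sup S) => s /andP[as_ sb].
have [st|ts|->] := ltgtP s t0; last by rewrite subrr mulr0 addr0.
- have : (g t0 - g s) / (t0 - s) <= sup S.
    by apply: ub_le_sup; [exact: hS.2|exists s => //; rewrite as_ st].
  by rewrite ler_pdivrMr ?subr_gt0//; lra.
- have : sup S <= (g s - g t0) / (s - t0) by apply: ge_sup => //; exact: ub.
  by rewrite ler_pdivlMr ?subr_gt0//; lra.
Qed.

(** Bounded second differences make [g + K t^2] convex and [g - K t^2] concave;
    the two supporting parabolas at a point must be tangent to each other. *)
Lemma C11_of_diff2 (R : realType) (r K : R) (g : R -> R) :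
  0 <= K -> {within `]- r, r[, continuous g} ->
  (forall a h : R, 0 < h -> - r < a - h -> a + h < r -> `|diff2 h g a| <= K * h ^+ 2) ->
  exists2 C : R, 0 <= C & forall t : R, `|t| < r -> derivable g t 1 /\
    forall s : R, `|s| < r -> `|g s - g t - derive1 g t * (s - t)| <= C * (s - t) ^+ 2.
Proof.
move=> K0 cg HK; exists (K + 1); first by lra.
have chord (e : R) : `|e| = 1 -> forall x y z : R, - r < x -> x <= y -> y <= z -> x < z -> z < r ->
   (z - x) * (e * g y + (K + 1) * y ^+ 2) <=
   (z - y) * (e * g x + (K + 1) * x ^+ 2) + (y - x) * (e * g z + (K + 1) * z ^+ 2).
  move=> e1 x y z rx xy yz xz zr.
  apply: (@chord_of_diff2_pos _ (fun t => e * g t + (K + 1) * t ^+ 2)) => //; last by rewrite xy yz.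
    have c1 : continuous (fun t : R => (K + 1) * t ^+ 2).
      by move=> t; apply: cvgM; [exact: cvg_cst|exact: exprn_continuous].
    move=> t; apply: cvgD; last exact: (continuous_subspaceT c1).
      apply: cvgM; first exact: cvg_cst.
      apply: (continuous_subspaceW _ cg) => u /=; rewrite !in_itv/= => /andP[? ?].
      by apply/andP; split; lra.
  move=> a h h0 xa az.
  have := HK a h h0 ltac:(lra) ltac:(lra).
  have -> : diff2 h (fun t => e * g t + (K + 1) * t ^+ 2) a = e * diff2 h g a + 2 * (K + 1) * h ^+ 2.
    by rewrite /diff2; ring.
  have : `|e * diff2 h g a| = `|diff2 h g a| by rewrite normrM e1 mul1r.
  have : 0 < h ^+ 2 by rewrite exprn_gt0.
  have := ler_norm (- (e * diff2 h g a)); rewrite normrN.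
  by nra.
move=> t tr.
have trr : - r < t < r by rewrite -ltr_norml.
have [m1 H1] := support_line (chord 1 (normr1 _)) trr.
have [m2 H2] := support_line (chord (-1) ltac:(by rewrite normrN1)) trr.
pose p1 := m1 - 2 * (K + 1) * t; pose p2 := - m2 + 2 * (K + 1) * t.
have B s : `|s| < r -> p1 * (s - t) - (K + 1) * (s - t) ^+ 2 <= g s - g t
      <= p2 * (s - t) + (K + 1) * (s - t) ^+ 2.
  rewrite ltr_norml => sr; have := H1 s sr; have := H2 s sr; rewrite /p1 /p2.
  by move=> *; apply/andP; split; nra.
have p12 : p1 = p2.
  have tr1 : 0 < r - `|t| by rewrite subr_gt0.
  have K1 : 0 < 2 * (K + 1) by lra.
  have P h : 0 < h -> h < r - `|t| -> `|p1 - p2| <= 2 * (K + 1) * h.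
    move=> h0 hr.
    have /B/andP[] : `|t + h| < r by apply: (le_lt_trans (ler_normD _ _)); rewrite (gtr0_norm h0); lra.
    have /B/andP[] : `|t - h| < r by apply: (le_lt_trans (ler_normB _ _)); rewrite (gtr0_norm h0); lra.
    have -> : t + h - t = h by ring.
    have -> : t - h - t = - h by ring.
    move=> *; rewrite ler_norml; apply/andP; split; rewrite -(ler_pM2r h0); nra.
  apply/eqP; rewrite -subr_eq0 -normr_le0; apply/ler_addgt0Pr => e e0; rewrite add0r.
  pose h := Num.min ((r - `|t|) / 2) (e / (2 * (K + 1))).
  have h0 : 0 < h by rewrite lt_min !divr_gt0.
  have [h1 h2] : h <= (r - `|t|) / 2 /\ h <= e / (2 * (K + 1)) by rewrite !ge_min !lexx ?orbT.
  apply: (le_trans (P h h0 _)); first lra.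
  by rewrite -ler_pdivlMl// mulrC.
have Q s : `|s| < r -> `|g s - g t - p1 * (s - t)| <= (K + 1) * (s - t) ^+ 2.
  by move=> /B /andP[]; rewrite -p12 ler_norml => *; apply/andP; split; lra.
have D : is_derive t 1 g p1.
  apply: (@is_derive_of_quadratic_remainder _ _ _ _ (K + 1) (r - `|t|)); first by rewrite subr_gt0.
  move=> h hr; have := Q (t + h).
  have -> : t + h - t = h by ring.
  by apply; apply: (le_lt_trans (ler_normD _ _)); lra.
have E : derive1 g t = p1 by rewrite derive1E; case: D.
by split; [case: D|rewrite E].
Qed.

Lemma W2infty_C11 (R : realType) (r : R) (g : R -> R) :
  {within `]- r, r[, continuous g} -> in_W2infty `]- r, r[ g ->
  exists2 C : R, 0 <= C & forall t : R, `|t| < r ->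
    forall s : R, `|s| < r -> `|g s - g t - derive1 g t * (s - t)| <= C * (s - t) ^+ 2.
Proof.
move=> cg wg; have [K K0 HK] := W2infty_diff2 cg wg.
have [C C0 HC] := C11_of_diff2 K0 cg HK.
by exists C => // t tr; case: (HC t tr).
Qed.

(** * Scalar products and test functions in the plane *)

Lemma dotvE (R : realType) (p q : 'rV[R]_2) :
  dotv p q = p 0 0 * q 0 0 + p 0 1 * q 0 1.
Proof.
rewrite /dotv !big_ord_recl big_ord0 addr0.
by rewrite (_ : lift ord0 ord0 = 1)//; apply/val_inj.
Qed.

Lemma dotvC (R : realType) (p q : 'rV[R]_2) : dotv p q = dotv q p.
Proof. by rewrite !dotvE; ring. Qed.

Lemma dotvDl (R : realType) (p q s : 'rV[R]_2) : dotv (p + q) s = dotv p s + dotv q s.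
Proof. by rewrite !dotvE !mxE; ring. Qed.

Lemma dotvNl (R : realType) (p s : 'rV[R]_2) : dotv (- p) s = - dotv p s.
Proof. by rewrite !dotvE !mxE; ring. Qed.

Lemma dotvBl (R : realType) (p q s : 'rV[R]_2) : dotv (p - q) s = dotv p s - dotv q s.
Proof. by rewrite dotvDl dotvNl. Qed.

Lemma dotvZl (R : realType) (k : R) (p s : 'rV[R]_2) : dotv (k *: p) s = k * dotv p s.
Proof. by rewrite !dotvE !mxE; ring. Qed.

Lemma dotvDr (R : realType) (s p q : 'rV[R]_2) : dotv s (p + q) = dotv s p + dotv s q.
Proof. by rewrite dotvC dotvDl !(dotvC s). Qed.

Lemma dotvNr (R : realType) (s p : 'rV[R]_2) : dotv s (- p) = - dotv s p.
Proof. by rewrite dotvC dotvNl (dotvC s). Qed.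

Lemma dotvBr (R : realType) (s p q : 'rV[R]_2) : dotv s (p - q) = dotv s p - dotv s q.
Proof. by rewrite dotvDr dotvNr. Qed.

Lemma dotvZr (R : realType) (k : R) (s p : 'rV[R]_2) : dotv s (k *: p) = k * dotv s p.
Proof. by rewrite dotvC dotvZl (dotvC s). Qed.

Lemma dotv0l (R : realType) (p : 'rV[R]_2) : dotv 0 p = 0.
Proof. by rewrite dotvE !mxE; ring. Qed.

Lemma dotvv_ge0 (R : realType) (p : 'rV[R]_2) : 0 <= dotv p p.
Proof. by rewrite dotvE; nra. Qed.

Lemma coord_le_norm (R : realType) (p : 'rV[R]_2) (i : 'I_2) : `|p 0 i| <= `|p|.
Proof.
have H : `|p 0 i| \in [seq `|p x.1 x.2| | x : 'I_1 * 'I_2].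
  by apply/mapP; exists (ord0, i) => //=; rewrite mem_enum.
move/mapP : H => [j Hj ->].
by rewrite [leRHS]/Num.Def.normr /= mx_normrE; apply/bigmax_geP; right => /=; exists j.
Qed.

Lemma row2_norm_eq (R : realType) (p : 'rV[R]_2) :
  `|p| = `|p 0 0| \/ `|p| = `|p 0 1|.
Proof.
have [/eqP|/mx_norm_neq0[[i j]/=]] := eqVneq (mx_norm p) 0.
  rewrite -[mx_norm p]/(`|p|) => /eqP p0; left; apply/eqP; rewrite p0 eq_le normr_ge0 -{1}p0.
  by rewrite coord_le_norm.
rewrite -[mx_norm p]/(`|p|) (ord1 i) => ->.
have : j = 0 \/ j = 1 by case: j => [[|[|m]] k]//; [left|right]; apply/val_inj.
by case=> ->; [left|right].
Qed.

Lemma dotvv_ge_norm (R : realType) (p : 'rV[R]_2) : `|p| ^+ 2 <= dotv p p.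
Proof.
rewrite dotvE; have [->|->] := row2_norm_eq p; rewrite real_normK ?num_real//; nra.
Qed.

Lemma normr_dotv_le (R : realType) (p q : 'rV[R]_2) : `|dotv p q| <= 2 * `|p| * `|q|.
Proof.
rewrite dotvE; apply: (le_trans (ler_normD _ _)); rewrite !normrM.
have := ler_pM (normr_ge0 _) (normr_ge0 _) (coord_le_norm p 0) (coord_le_norm q 0).
have := ler_pM (normr_ge0 _) (normr_ge0 _) (coord_le_norm p 1) (coord_le_norm q 1).
by lra.
Qed.

Lemma dotvv_le_norm (R : realType) (p : 'rV[R]_2) : dotv p p <= 2 * `|p| ^+ 2.
Proof. by have := normr_dotv_le p p; rewrite ger0_norm ?dotvv_ge0// -mulrA. Qed.

Lemma norm_unit (R : realType) (p : 'rV[R]_2) : dotv p p = 1 -> `|p| <= 1.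
Proof.
move=> H; rewrite -(ler_pXn2r (n := 2)) ?nnegrE//; apply: le_trans (dotvv_ge_norm _) _.
by rewrite H expr1n.
Qed.

Lemma dotv_cauchy (R : realType) (p q : 'rV[R]_2) : dotv p q ^+ 2 <= dotv p p * dotv q q.
Proof. by rewrite !dotvE; have := sqr_ge0 (p 0 0 * q 0 1 - p 0 1 * q 0 0); nra. Qed.

Lemma dotv_mulmx_orth (R : realType) (O : 'M[R]_2) (p q : 'rV[R]_2) :
  O *m O^T = 1%:M -> dotv (p *m O) (q *m O) = dotv p q.
Proof.
have E (s t : 'rV[R]_2) : dotv s t = (s *m t^T) 0 0.
  by rewrite mxE /dotv; apply: eq_bigr => i _; rewrite mxE.
by move=> OO; rewrite !E trmx_mul mulmxA -(mulmxA p) OO mulmx1.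
Qed.

Lemma continuous_dotv (R : realType) (T : topologicalType) (f g : T -> 'rV[R]_2) :
  continuous f -> continuous g -> continuous (fun x => dotv (f x) (g x)).
Proof.
move=> cf cg; have -> : (fun x => dotv (f x) (g x)) =
    (fun x => f x 0 0 * g x 0 0 + f x 0 1 * g x 0 1).
  by apply/funext => x; rewrite dotvE.
have C h i : continuous h -> continuous (fun x : T => (h x : 'rV[R]_2) 0 i).
  move=> ch x; apply: (@continuous_comp _ _ _ h (fun M : 'rV[R]_2 => M 0 i)); first exact: ch.
  exact: coord_continuous.
move=> x; apply: cvgD.
  by apply: cvgM; [exact: (C _ _ cf)|exact: (C _ _ cg)].
by apply: cvgM; [exact: (C _ _ cf)|exact: (C _ _ cg)].
Qed.

Lemma continuous_dotvr (R : realType) (e : 'rV[R]_2) : continuous (dotv e).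
Proof.
apply: (@continuous_dotv R 'rV[R]_2 (fun=> e) id) => x; first exact: cst_continuous.
by move=> A; apply.
Qed.

(** The quadratic remainder is checked by plain algebra on the penalties used
    below (ridge functions, squared distances and their combinations), also on
    those that are only C^{1,1}. *)
Definition smooth_test {R : realType} (phi : 'rV[R]_2 -> R) (D : 'rV[R]_2 -> 'rV[R]_2) :=
  continuous D /\
  forall x, exists2 C : R, 0 <= C & forall h, `|phi (x + h) - phi x - dotv (D x) h| <= C * dotv h h.

Lemma smooth_test_differentiable (R : realType) (phi : 'rV[R]_2 -> R) D x :
  smooth_test phi D ->
  differentiable phi x /\ forall h, 'd phi x h = dotv (D x) h.
Proof.
move=> [_ /(_ x)[C C0 HC]].
have lin : linear (dotv (D x)).
  by move=> k u v; rewrite dotvDr dotvZr.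
pose L := HB.pack_for {linear 'rV[R]_2 -> R} (dotv (D x))
  (GRing.isLinear.Build _ _ _ _ (dotv (D x)) lin).
have cL : continuous L.
  exact: continuous_dotvr.
have eqn : phi \o shift x = cst (phi x) + L +o_ (0 : 'rV[R]_2) id.
  apply/eqaddoP => e e0.
  have small : \forall h \near (0 : 'rV[R]_2), `|h| < e / (2 * C + 1).
    apply/nbhs_norm0P; exists (e / (2 * C + 1)) => //=.
    by rewrite divr_gt0// ltr_wpDl// mulr_ge0.
  near=> h.
  rewrite /= [X in `|X|](_ : _ = phi (x + h) - phi x - dotv (D x) h); last first.
    by rewrite (addrC x h) -[LHS]/(phi (h + x) - (phi x + dotv (D x) h)); ring.
  apply: (le_trans (HC h)); apply: (@le_trans _ _ (C * (2 * `|h| ^+ 2))).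
    by rewrite ler_wpM2l// dotvv_le_norm.
  have he : `|h| < e / (2 * C + 1).
    by near: h; exact: small.
  have C1 : 0 < 2 * C + 1 by rewrite ltr_wpDl// mulr_ge0.
  move: he; rewrite ltr_pdivlMr// => he; have h0 : 0 <= `|h| := normr_ge0 _.
  by nra.
have dL := diff_unique cL eqn.
split; last by move=> h; rewrite dL.
apply/diff_locallyP; rewrite dL; split => //.
Unshelve. all: by end_near. Qed.

Lemma smooth_test_C1 (R : realType) (Omega : set 'rV[R]_2) phi D :
  smooth_test phi D -> C1_closure Omega phi D.
Proof.
move=> H; have [cD _] := H; split.
- apply: continuous_subspaceT => x; apply: differentiable_continuous.
  by case: (smooth_test_differentiable x H).
- exact: continuous_subspaceT.
- by move=> x _; exact: smooth_test_differentiable.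
Qed.

Lemma smooth_testD (R : realType) (f g : 'rV[R]_2 -> R) Df Dg :
  smooth_test f Df -> smooth_test g Dg ->
  smooth_test (fun x => f x + g x) (fun x => Df x + Dg x).
Proof.
move=> [cf Hf] [cg Hg]; split; first by move=> x; exact: (cvgD (cf x) (cg x)).
move=> x; have [C1 C10 H1] := Hf x; have [C2 C20 H2] := Hg x.
exists (C1 + C2); first exact: addr_ge0.
move=> h; rewrite dotvDl mulrDl.
have -> : f (x + h) + g (x + h) - (f x + g x) - (dotv (Df x) h + dotv (Dg x) h) =
  (f (x + h) - f x - dotv (Df x) h) + (g (x + h) - g x - dotv (Dg x) h) by ring.
by apply: (le_trans (ler_normD _ _)); exact: lerD.
Qed.

Lemma smooth_testZ (R : realType) (k : R) (f : 'rV[R]_2 -> R) Df :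
  smooth_test f Df -> smooth_test (fun x => k * f x) (fun x => k *: Df x).
Proof.
move=> [cf Hf]; split.
  by move=> x; apply: (@cvgZl_tmp R 'rV[R]_2 _ _ _ k Df _ (cf x)).
move=> x; have [C C0 H] := Hf x; exists (`|k| * C); first exact: mulr_ge0.
move=> h; rewrite dotvZl -!mulrBr normrM -mulrA.
by apply: ler_wpM2l.
Qed.

Lemma smooth_test_ridge (R : realType) (e : 'rV[R]_2) (s0 K : R) (G g : R -> R) :
  0 <= K -> continuous g ->
  (forall t k, `|G (t + k) - G t - g t * k| <= K * k ^+ 2) ->
  smooth_test (fun x => G (dotv e x - s0)) (fun x => g (dotv e x - s0) *: e).
Proof.
move=> K0 cg H; split.
  have c1 : continuous (fun x : 'rV[R]_2 => dotv e x - s0).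
    move=> x; apply: (@cvgB _ R^o _ _ _ _ _ _ _ (@continuous_dotvr _ e x)).
    exact: cst_continuous.
  move=> x; apply: (@cvgZr_tmp R 'rV[R]_2 _ _ _ (fun x => g (dotv e x - s0)) _ e).
  - exact: nbhs_filter.
  - exact: (cvg_comp (fun x : 'rV[R]_2 => dotv e x - s0) g (c1 x) (cg _)).
move=> x; exists (K * dotv e e); first by rewrite mulr_ge0// dotvv_ge0.
move=> h; have := H (dotv e x - s0) (dotv e h).
rewrite dotvZl dotvDr (_ : dotv e x - s0 + dotv e h = dotv e x + dotv e h - s0); last by ring.
move=> /le_trans; apply; rewrite -mulrA; apply: ler_wpM2l => //.
exact: dotv_cauchy.
Qed.

Lemma smooth_test_lin (R : realType) (e : 'rV[R]_2) : smooth_test (dotv e) (fun=> e).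
Proof.
split; first exact: cst_continuous.
by move=> x; exists 0 => // h; rewrite dotvDr mul0r (_ : _ - _ - _ = 0) ?normr0//; ring.
Qed.

Lemma smooth_test_cst (R : realType) (k : R) : smooth_test (fun=> k) (fun=> 0 : 'rV[R]_2).
Proof.
split; first exact: cst_continuous.
by move=> x; exists 0 => // h; rewrite dotv0l mul0r subrr subr0 normr0.
Qed.

Lemma smooth_test_dist (R : realType) (a : 'rV[R]_2) :
  smooth_test (fun x => dotv (x - a) (x - a)) (fun x => 2 *: (x - a)).
Proof.
split.
  have c1 : continuous (fun x : 'rV[R]_2 => x - a).
    move=> x; apply: (@cvgB _ 'rV[R]_2 _ _ _ id (fun=> a)); last exact: cst_continuous.
      exact: nbhs_filter.
    by move=> A; apply.
  by move=> x; apply: (@cvgZl_tmp R 'rV[R]_2 _ _ _ 2 _ _ (c1 x)).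
move=> x; exists 1 => // h; rewrite mul1r.
rewrite (_ : _ - _ - _ = dotv h h); first by rewrite ger0_norm// dotvv_ge0.
by rewrite !dotvE !mxE; ring.
Qed.

(** * Geometry of the boundary *)

Lemma open_frontierP (R : realType) (Omega : set 'rV[R]_2) (x : 'rV[R]_2) :
  open Omega -> frontier Omega x <-> closure Omega x /\ ~ Omega x.
Proof.
move=> oO; rewrite /frontier /setD /=.
have E : interior Omega = Omega by rewrite interior_id in oO *.
by rewrite E.
Qed.

Lemma closure_ballP (R : realType) (A : set 'rV[R]_2) (x : 'rV[R]_2) :
  closure A x <-> forall d : R, 0 < d -> exists2 y, A y & `|y - x| < d.
Proof.
split=> [cl d d0|H B /nbhs_normP[d /= d0 dB]].
  have N : nbhs x [set y | `|y - x| < d].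
    by apply/(@nbhs_normP R 'rV[R]_2); exists d => //= y /=; rewrite distrC.
  by have [y [Ay yd]] := cl _ N; exists y.
by have [y Ay yd] := H d d0; exists y; split => //; apply: dB => /=; rewrite distrC.
Qed.

Definition chart_normal {R : realType} (O : 'M[R]_2) (m : R) : 'rV[R]_2 :=
  ((Num.sqrt (1 + m ^+ 2))^-1 *: \row_(i < 2) (if i == 0 then m else -1)) *m O^T.

(** Near x, Omega lies between the two paraboloids tangent to the half-plane of
    outward normal n; this chart-free property determines n. *)
Definition quad_normal {R : realType} (Omega : set 'rV[R]_2) (C rho : R) (x n : 'rV[R]_2) :=
  dotv n n = 1 /\
  forall y, `|y - x| < rho ->
    (Omega y -> dotv (y - x) n <= C * dotv (y - x) (y - x)) /\
    (dotv (y - x) n < - C * dotv (y - x) (y - x) -> Omega y).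

(** If [w . n < 0] then [x + t w] is in Omega for small t, hence [w . n' <= 0]; for
    w near [n' - (n . n') n] this forces [n . n' = 1]. *)
Lemma quad_normal_uniq (R : realType) (Omega : set 'rV[R]_2) (C C' rho rho' : R) x n n' :
  0 <= C -> 0 <= C' -> 0 < rho -> 0 < rho' ->
  quad_normal Omega C rho x n -> quad_normal Omega C' rho' x n' -> n = n'.
Proof.
move=> C0 C'0 r0 r'0 [n1 H] [n'1 H'].
have key w : dotv w n < 0 -> dotv w n' <= 0.
  move=> wn; apply/ler_addgt0Pr => e e0; rewrite add0r.
  have ww := dotvv_ge0 w; have w0 := normr_ge0 w.
  pose t := Num.min (Num.min (rho / (`|w| + 1)) (rho' / (`|w| + 1)))
    (Num.min (- dotv w n / (C * dotv w w + 1)) (e / (C' * dotv w w + 1))).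
  have d1 : 0 < `|w| + 1 by rewrite ltr_wpDl.
  have d2 : 0 < C * dotv w w + 1 by rewrite ltr_wpDl// mulr_ge0.
  have d3 : 0 < C' * dotv w w + 1 by rewrite ltr_wpDl// mulr_ge0.
  have t0 : 0 < t by rewrite !lt_min !divr_gt0// oppr_gt0.
  have [T1 T2 T3 T4] : [/\ t <= rho / (`|w| + 1), t <= rho' / (`|w| + 1),
      t <= - dotv w n / (C * dotv w w + 1) & t <= e / (C' * dotv w w + 1)].
    by split; rewrite !ge_min lexx ?orbT.
  move: T1 T2 T3 T4; rewrite !ler_pdivlMr// => T1 T2 T3 T4.
  have Ey : x + t *: w - x = t *: w by rewrite addrC addKr.
  have n_y : `|t *: w| = t * `|w| by rewrite normrZ gtr0_norm.
  have [|_ Oy] := H (x + t *: w); first by rewrite Ey n_y; lra.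
  have [|Oy' _] := H' (x + t *: w); first by rewrite Ey n_y; lra.
  have := Oy' (Oy _); rewrite Ey !(dotvZl, dotvZr) => HH.
  have : t * dotv w n < - C * (t * (t * dotv w w)) by nra.
  move=> /HH => H2.
  have : dotv w n' <= C' * (t * dotv w w) by rewrite -(ler_pM2l t0); lra.
  by nra.
pose p := dotv n n'.
have p0 : 0 <= p.
  have := key (- n); rewrite !dotvNl n1 oppr_lt0 ltr01 => /(_ isT).
  by rewrite oppr_le0.
have p1 : 1 <= p.
  have P e : 0 < e -> 1 <= (p + e) * p.
    move=> e0; have := key (n' - (p + e) *: n).
    rewrite !dotvBl !dotvZl n1 n'1 (dotvC n') -/p => K.
    have : p - (p + e) * 1 < 0 by lra.
    by move/K; lra.
  have : 1 <= p * p.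
    apply/ler_addgt0Pr => e e0.
    have := P (e / (p + 1)) ltac:(by rewrite divr_gt0// ltr_wpDl).
    move=> /le_trans; apply; rewrite mulrDl lerD2l mulrAC ler_pdivrMr ?ltr_wpDl//; nra.
  by nra.
have d0 : dotv (n - n') (n - n') <= 0.
  by rewrite !(dotvBl, dotvBr) n1 n'1 (dotvC n' n) -/p; lra.
have : `|n - n'| ^+ 2 <= 0 by apply: le_trans (dotvv_ge_norm _) d0.
rewrite exprn_even_le0//= normr_eq0 subr_eq0 => /eqP //.
Qed.

Lemma row2E (R : realType) (p q : R) (v : 'rV[R]_2) :
  dotv v (\row_(i < 2) (if i == 0 then p else q)) = v 0 0 * p + v 0 1 * q.
Proof. by rewrite dotvE !mxE. Qed.

Lemma sqrt1_ge1 (R : realType) (m : R) : 1 <= Num.sqrt (1 + m ^+ 2).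
Proof. by rewrite -{1}(sqrtr1 R) ler_wsqrtr// lerDl sqr_ge0. Qed.

Lemma dotv_chart_normal (R : realType) (O : 'M[R]_2) (m : R) (v : 'rV[R]_2) :
  O *m O^T = 1%:M ->
  dotv v (chart_normal O m) =
  (Num.sqrt (1 + m ^+ 2))^-1 * (m * (v *m O) 0 0 - (v *m O) 0 1).
Proof.
move=> OO; rewrite -(dotv_mulmx_orth _ _ OO) /chart_normal -mulmxA.
rewrite (mulmx1C OO) mulmx1 dotvZr row2E; congr (_ * _); ring.
Qed.

Lemma chart_normal_mulO (R : realType) (O : 'M[R]_2) (m : R) :
  O *m O^T = 1%:M -> chart_normal O m *m O =
  (Num.sqrt (1 + m ^+ 2))^-1 *: \row_(i < 2) (if i == 0 then m else -1).
Proof. by move=> OO; rewrite /chart_normal -mulmxA (mulmx1C OO) mulmx1. Qed.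

Lemma chart_normal_dot (R : realType) (O : 'M[R]_2) (m m' : R) :
  O *m O^T = 1%:M ->
  dotv (chart_normal O m) (chart_normal O m') =
  (Num.sqrt (1 + m ^+ 2))^-1 * (Num.sqrt (1 + m' ^+ 2))^-1 * (1 + m * m').
Proof.
move=> OO; rewrite dotv_chart_normal// chart_normal_mulO// !mxE/=; ring.
Qed.

Lemma chart_normal_unit (R : realType) (O : 'M[R]_2) (m : R) :
  O *m O^T = 1%:M -> dotv (chart_normal O m) (chart_normal O m) = 1.
Proof.
move=> OO; rewrite chart_normal_dot//.
have s0 : 0 < Num.sqrt (1 + m ^+ 2) := lt_le_trans ltr01 (sqrt1_ge1 m).
have s2 : Num.sqrt (1 + m ^+ 2) ^+ 2 = 1 + m ^+ 2.
  by rewrite sqr_sqrtr// addr_ge0// sqr_ge0.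
move: s0 s2; set s := Num.sqrt _ => s0 s2.
have -> : 1 + m * m = s ^+ 2 by rewrite s2 expr2.
by field; rewrite gt_eqF.
Qed.

(** The product of the two squared normalising factors exceeds [(1 + m m') ^ 2] by
    [(m - m') ^ 2], so the angle between the normals has sine at most [|m - m'|]. *)
Lemma chart_normal_close (R : realType) (O : 'M[R]_2) (m m' : R) :
  O *m O^T = 1%:M -> (m - m') ^+ 2 <= 1 ->
  1 - (m - m') ^+ 2 <= dotv (chart_normal O m) (chart_normal O m') <= 1.
Proof.
move=> OO mm; set d := dotv _ _.
have u1 := chart_normal_unit m OO; have u2 := chart_normal_unit m' OO.
have d1 : d <= 1.
  have := dotvv_ge0 (chart_normal O m - chart_normal O m').
  rewrite !(dotvBl, dotvBr) u1 u2 (dotvC (chart_normal O m') (chart_normal O m)) -/d; lra.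
rewrite d1 andbT.
have dE : d = (Num.sqrt (1 + m ^+ 2))^-1 * (Num.sqrt (1 + m' ^+ 2))^-1 * (1 + m * m').
  exact: chart_normal_dot.
move: dE; have := sqrt1_ge1 m; have := sqrt1_ge1 m'.
have := @sqr_sqrtr _ (1 + m ^+ 2) ltac:(by rewrite addr_ge0// sqr_ge0).
have := @sqr_sqrtr _ (1 + m' ^+ 2) ltac:(by rewrite addr_ge0// sqr_ge0).
set s := Num.sqrt (1 + m ^+ 2); set s' := Num.sqrt (1 + m' ^+ 2) => E' E s1 s'1 dE.
have ss : d * (s * s') = 1 + m * m'.
  by rewrite dE; field; rewrite !gt_eqF//; lra.
have ss1 : 1 <= s * s' by nra.
have mm0 : 0 <= 1 + m * m' by nra.
have d0 : 0 <= d by rewrite -(pmulr_lge0 _ (x := s * s')) ?ss//; lra.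
have sq : d ^+ 2 * (s ^+ 2 * s' ^+ 2) = (1 + m * m') ^+ 2 by rewrite -ss; ring.
have id1 : s ^+ 2 * s' ^+ 2 = (1 + m * m') ^+ 2 + (m - m') ^+ 2 by rewrite E E'; ring.
have S1 : 1 <= s ^+ 2 * s' ^+ 2 by nra.
have : (1 - d ^+ 2) * (s ^+ 2 * s' ^+ 2) = (m - m') ^+ 2 by lra.
have d2 : 0 <= 1 - d ^+ 2 by nra.
move=> H; have : 1 - d ^+ 2 <= (m - m') ^+ 2 by rewrite -H; nra.
by nra.
Qed.

Lemma norm_sq_le (R : realType) (a b : R) : 0 <= b -> a ^+ 2 <= b ^+ 2 -> `|a| <= b.
Proof.
move=> b0 H; rewrite -(ler_pXn2r (n := 2)) ?nnegrE// ?normr_ge0//.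
by rewrite real_normK ?num_real.
Qed.

Lemma coord_mulmx_orth (R : realType) (O : 'M[R]_2) (v : 'rV[R]_2) (i : 'I_2) :
  O *m O^T = 1%:M -> (v *m O) 0 i ^+ 2 <= dotv v v.
Proof.
move=> OO; rewrite -(dotv_mulmx_orth v v OO) dotvE.
have : i = 0 \/ i = 1 by case: i => [[|[|m]] k]//; [left|right]; apply/val_inj.
by case=> ->; nra.
Qed.

Lemma coord_mulmx_orth_le (R : realType) (O : 'M[R]_2) (v : 'rV[R]_2) (i : 'I_2) :
  O *m O^T = 1%:M -> `|(v *m O) 0 i| <= 2 * `|v|.
Proof.
move=> OO; apply: norm_sq_le; first by rewrite mulr_ge0.
apply: (le_trans (coord_mulmx_orth v i OO)); apply: (le_trans (dotvv_le_norm v)).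
by have := sqr_ge0 `|v|; nra.
Qed.

Lemma coord_chart_lt (R : realType) (O : 'M[R]_2) (v : 'rV[R]_2) (i : 'I_2) (r : R) :
  O *m O^T = 1%:M -> `|v| < r / 2 -> `|(v *m O) 0 i| < r.
Proof. by move=> OO vr; apply: (le_lt_trans (coord_mulmx_orth_le v i OO)); lra. Qed.

Lemma slope_diff (R : realType) (a b p q C t s : R) :
  `|b - a - p * (t - s)| <= C * (t - s) ^+ 2 -> `|a - b - q * (s - t)| <= C * (s - t) ^+ 2 ->
  `|(q - p) * (t - s)| <= 2 * (C * (t - s) ^+ 2).
Proof.
have -> : (s - t) ^+ 2 = (t - s) ^+ 2 by ring.
rewrite !ler_norml => /andP[? ?] /andP[? ?].
by apply/andP; split; lra.
Qed.

Section Chart.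
Context {R : realType} {Omega : set 'rV[R]_2} {x0 : 'rV[R]_2} {r : R} {O : 'M[R]_2}
  {gamma : R -> R}.
Hypothesis oO : open Omega.
Hypothesis ch : W2infty_chart Omega x0 r O gamma.

Let c (y : 'rV[R]_2) : 'rV[R]_2 := (y - x0) *m O.
Let r0 : 0 < r. Proof. by case: ch. Qed.
Let OO : O *m O^T = 1%:M. Proof. by case: ch. Qed.

Lemma chart_domain (y : 'rV[R]_2) : `|y - x0| < r / 2 ->
  (Omega y <-> gamma (c y 0 0) < c y 0 1) /\ forall i, `|c y 0 i| < r.
Proof.
move=> yr; split; last by move=> i; exact: coord_chart_lt.
case: ch => _ _ _ _; apply; apply: (le_lt_trans (dotvv_le_norm _)).
by have := normr_ge0 (y - x0); nra.
Qed.

Lemma chart_displ (x y : 'rV[R]_2) i : c y 0 i - c x 0 i = ((y - x) *m O) 0 i.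
Proof.
have -> : (y - x) *m O = c y - c x.
  by rewrite /c -mulmxBl; congr (_ *m _); rewrite opprB addrA subrK.
by rewrite [RHS]mxE; congr (_ + _); rewrite [RHS]mxE.
Qed.

Lemma chart_taylor : exists2 C : R, 0 <= C & forall t s : R, `|t| < r -> `|s| < r ->
   `|gamma s - gamma t - derive1 gamma t * (s - t)| <= C * (s - t) ^+ 2.
Proof.
case: ch => _ _ cg wg _; have [C C0 H] := W2infty_C11 cg wg.
by exists C => // t s tr sr; exact: H.
Qed.

Lemma chart_closure (x : 'rV[R]_2) : `|x - x0| < r / 2 -> closure Omega x ->
  gamma (c x 0 0) <= c x 0 1.
Proof.
move=> xr /closure_ballP clx; have [C C0 T] := chart_taylor.
have [_ cxr] := chart_domain xr.
rewrite leNgt; apply/negP => lt_.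
pose m := derive1 gamma (c x 0 0).
pose e := gamma (c x 0 0) - c x 0 1.
have e0 : 0 < e by rewrite subr_gt0.
have k0 : 0 < 4 + 2 * `|m| + 4 * C.
  by have := normr_ge0 m; lra.
pose d := Num.min (Num.min 1 (r / 2 - `|x - x0|)) (e / (4 + 2 * `|m| + 4 * C)).
have d0 : 0 < d by rewrite !lt_min ltr01 divr_gt0// subr_gt0 xr.
have [y Oy yd] := clx d d0.
have [[d1 d2] d3] : (d <= 1 /\ d <= r / 2 - `|x - x0|) /\ d <= e / (4 + 2 * `|m| + 4 * C).
  by split; [split|]; rewrite !ge_min lexx ?orbT.
have yr : `|y - x0| < r / 2.
  apply: (@le_lt_trans _ _ (`|y - x| + `|x - x0|)).
    exact: ler_distD.
  by lra.
have [/iffLR/(_ Oy) Gy cyr] := chart_domain yr.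
have := T _ _ (cxr 0) (cyr 0).
have := chart_displ x y 0; have := chart_displ x y 1.
have := coord_mulmx_orth_le (y - x) 0 OO; have := coord_mulmx_orth_le (y - x) 1 OO.
set D1 := (_ *m O) 0 0; set D2 := (_ *m O) 0 1 => B2 B1 E2 E1.
rewrite E1 -/m => TT.
move: d3; rewrite ler_pdivlMr// => d3.
have yx0 := normr_ge0 (y - x).
have mD : `|m * D1| <= `|m| * (2 * `|y - x|) by rewrite normrM ler_wpM2l.
have D1sq : D1 ^+ 2 <= 4 * `|y - x|.
  rewrite -real_normK ?num_real//; have := normr_ge0 D1; nra.
have H1 := ler_norm (- (m * D1)); rewrite normrN in H1.
have H2 := ler_norm (D2).
have H3 := ler_norm (- (gamma (c y 0 0) - gamma (c x 0 0) - m * D1)); rewrite normrN in H3.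
have CD : C * D1 ^+ 2 <= C * (4 * `|y - x|) by rewrite ler_wpM2l.
have bd : `|y - x| * (4 + 2 * `|m| + 4 * C) < e.
  by apply: lt_le_trans d3; rewrite ltr_pM2r.
rewrite /e in bd; nra.
Qed.

Lemma chart_frontier (x : 'rV[R]_2) : `|x - x0| < r / 2 -> frontier Omega x ->
  c x 0 1 = gamma (c x 0 0).
Proof.
move=> xr /(open_frontierP _ oO)[clx nOx]; apply/eqP; rewrite eq_le chart_closure// andbT.
by rewrite leNgt; apply/negP => /((chart_domain xr).1).2.
Qed.

(** The two paraboloids come from the Taylor bound on gamma: the normalising factor
    of the normal is at least 1. The Lipschitz bound on gamma' is recorded with the
    same constant. *)
Lemma chart_quad_normal : exists2 C : R, 0 <= C &
  (forall t s : R, `|t| < r -> `|s| < r -> `|derive1 gamma t - derive1 gamma s| <= 2 * C * `|t - s|) /\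
  forall x, `|x - x0| < r / 4 -> frontier Omega x ->
  quad_normal Omega C (r / 4) x (chart_normal O (derive1 gamma (c x 0 0))).
Proof.
have [C C0 T] := chart_taylor; exists C => //; split.
  move=> t s tr sr.
  have [->|ts] := eqVneq t s; first by rewrite !subrr normr0 mulr0.
  have ts0 : 0 < `|t - s| by rewrite normr_gt0 subr_eq0.
  rewrite -(ler_pM2r ts0) -normrM.
  have := T t s tr sr; have := T s t sr tr.
  have E : `|t - s| * `|t - s| = (t - s) ^+ 2 by rewrite -expr2 real_normK ?num_real.
  have -> : 2 * C * `|t - s| * `|t - s| = 2 * (C * (t - s) ^+ 2) by rewrite -E !mulrA.
  exact: slope_diff.
move=> x xr fx.
have r'0 := r0; have xr2 : `|x - x0| < r / 2 by lra.
have E := chart_frontier xr2 fx.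
have [_ cxr] := chart_domain xr2.
split; first exact: chart_normal_unit.
move=> y yx.
have yr : `|y - x0| < r / 2.
  apply: (@le_lt_trans _ _ (`|y - x| + `|x - x0|)).
    exact: ler_distD.
  by lra.
have [Gy cyr] := chart_domain yr.
have := T _ _ (cxr 0) (cyr 0).
have E1 := chart_displ x y 0; have E2 := chart_displ x y 1.
rewrite dotv_chart_normal// -(dotv_mulmx_orth (y - x) (y - x) OO) dotvE.
have s1 := sqrt1_ge1 (derive1 gamma (c x 0 0)).
move: E1 E2 s1; set D1 := (_ *m O) 0 0; set D2 := (_ *m O) 0 1.
set m := derive1 gamma _; set s := Num.sqrt _ => E1 E2 s1.
rewrite E1 ler_norml => /andP[T1 T2].
have s0 : 0 < s by lra.
have CD1 : 0 <= C * (D1 * D1) by rewrite mulr_ge0// -expr2 sqr_ge0.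
have CD2 : 0 <= C * (D2 * D2) by rewrite mulr_ge0// -expr2 sqr_ge0.
have CDD : 0 <= C * (D1 * D1 + D2 * D2) by lra.
split.
  move=> /Gy Oy.
  rewrite ler_pdivrMl//.
  apply: (@le_trans _ _ (C * (D1 * D1 + D2 * D2))); first by lra.
  by nra.
rewrite ltr_pdivrMl// => H; apply/Gy.
have : s * (- C * (D1 * D1 + D2 * D2)) <= - C * (D1 * D1 + D2 * D2).
  by nra.
by lra.
Qed.

(** The axis is the vertical of the chart: gamma is Lipschitz, so moving up by eps
    outweighs any further displacement of length at most [cc eps], cc small. *)
Lemma chart_cone : exists xi : 'rV[R]_2, exists cc : R, exists rho : R, [/\ dotv xi xi = 1, 0 < cc, 0 < rho &
  forall x y eps, closure Omega y -> `|y - x0| < rho -> 0 < eps < rho ->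
    dotv (x - y - eps *: xi) (x - y - eps *: xi) <= (cc * eps) ^+ 2 -> Omega x].
Proof.
have [C C0 [L _]] := chart_quad_normal; have [C' C'0 T] := chart_taylor.
pose L0 := `|derive1 gamma 0| + 2 * C * r.
have L00 : 0 <= L0 by rewrite addr_ge0// !mulr_ge0// ltW.
pose cc := (L0 + C' * r + 2)^-1.
have C'r : 0 <= C' * r by rewrite mulr_ge0// ltW.
have den0 : 0 < L0 + C' * r + 2 by lra.
have cc0 : 0 < cc by rewrite invr_gt0.
have ccE : cc * (L0 + C' * r + 2) = 1 by rewrite mulVf// gt_eqF.
have cc1 : cc <= 1 by nra.
pose xi : 'rV[R]_2 := (\row_(i < 2) (if i == 0 then 0 else 1)) *m O^T.
have xiO : xi *m O = \row_(i < 2) (if i == 0 then 0 else 1).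
  by rewrite /xi -mulmxA (mulmx1C OO) mulmx1.
have xi1 : dotv xi xi = 1.
  by rewrite -(dotv_mulmx_orth _ _ OO) xiO dotvE !mxE/=; ring.
exists xi, cc, (r / 8); split => //; first by rewrite divr_gt0.
move=> x y eps cly yr /andP[e0 er].
set w := x - y - eps *: xi => Hw.
have nxi := norm_unit xi1.
have ce0 : 0 <= cc * eps by rewrite mulr_ge0// ltW.
have nw : `|w| <= cc * eps.
  rewrite -(ler_pXn2r (n := 2)) ?nnegrE//; exact: le_trans (dotvv_ge_norm _) Hw.
have r'0 := r0; have yr2 : `|y - x0| < r / 2 by lra.
have xE : x = y + eps *: xi + w by rewrite /w -[x - y - _]addrA -opprD [RHS]addrC subrK.
have xr : `|x - x0| < r / 2.
  rewrite xE (_ : y + eps *: xi + w - x0 = (y - x0) + (eps *: xi + w)); last first.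
    by rewrite -[y + _ + w]addrA addrAC.
  apply: (le_lt_trans (ler_normD _ _)).
  have := ler_normD (eps *: xi) w; rewrite normrZ (gtr0_norm e0).
  by nra.
have [Gx cxr] := chart_domain xr; have [_ cyr] := chart_domain yr2.
apply/Gx.
have cy := chart_closure yr2 cly.
have := T _ _ (cyr 0) (cxr 0).
have E1 := chart_displ y x 0; have E2 := chart_displ y x 1.
have xyE : x - y = eps *: xi + w by rewrite {1}xE -[y + _ + w]addrA addrAC subrr add0r.
have D1E : ((x - y) *m O) 0 0 = (w *m O) 0 0.
  by rewrite xyE mulmxDl -scalemxAl xiO !mxE/= mulr0 add0r.
have D2E : ((x - y) *m O) 0 1 = eps + (w *m O) 0 1.
  by rewrite xyE mulmxDl -scalemxAl xiO !mxE/= mulr1.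
have w1 : `|(w *m O) 0 0| <= cc * eps.
  by apply: norm_sq_le => //; apply: le_trans (coord_mulmx_orth _ _ OO) Hw.
have w2 : `|(w *m O) 0 1| <= cc * eps.
  by apply: norm_sq_le => //; apply: le_trans (coord_mulmx_orth _ _ OO) Hw.
move: E1 E2; rewrite D1E D2E; move: w1 w2.
set w1 := (w *m O) 0 0; set w2 := (w *m O) 0 1 => b1 b2 E1 E2.
rewrite E1; set m := derive1 gamma _ => TT.
have mL : `|m| <= L0.
  have := L _ 0 (cyr 0) ltac:(by rewrite normr0); rewrite subr0 -/m => mm.
  have : 2 * C * `|c y 0 0| <= 2 * C * r.
    by rewrite ler_wpM2l// ?mulr_ge0// ltW.
  have := ler_normD (m - derive1 gamma 0) (derive1 gamma 0); rewrite subrK /L0.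
  by lra.
have mw : `|m * w1| <= L0 * (cc * eps) by rewrite normrM ler_pM.
have w1sq : w1 ^+ 2 <= r * (cc * eps).
  rewrite -real_normK ?num_real// expr2; apply: ler_pM => //.
  by apply: (le_trans b1); nra.
have Cw : C' * w1 ^+ 2 <= C' * (r * (cc * eps)) by rewrite ler_wpM2l.
have H1 := ler_norm (m * w1); have H2 := ler_norm (- w2); rewrite normrN in H2.
have H3 := ler_norm (gamma (c x 0 0) - gamma (c y 0 0) - m * w1).
have key : (cc * (L0 + C' * r + 2)) * eps = eps by rewrite ccE mul1r.
have ceps : 0 < cc * eps by rewrite mulr_gt0.
by nra.
Qed.

End Chart.

(** The chart behind the selected normal is unknown, but every chart at x yields
    quadratic tangency. *)
Lemma outward_unit_normalP (R : realType) (Omega : set 'rV[R]_2) (x : 'rV[R]_2) :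
  open Omega -> W2infty_boundary Omega -> frontier Omega x ->
  exists C rho : R, [/\ 0 <= C, 0 < rho & quad_normal Omega C rho x (outward_unit_normal Omega x)].
Proof.
move=> oO reg fx.
have [r1 [ O1 [g1 ch1]]] := reg x fx.
have [r0 OO _ _ _] := ch1.
have : is_outward_unit_normal Omega x (outward_unit_normal Omega x).
  apply: (@xgetPex _ 0 [set n | is_outward_unit_normal Omega x n]).
  exists (chart_normal O1 (derive1 g1 0)); exists r1, O1, g1; split => //.
  exact: chart_normal_mulO.
set n := outward_unit_normal Omega x => -[r [ O [g [ch nO]]]].
have [rr0 OO' _ _ _] := ch.
have nE : n = chart_normal O (derive1 g 0).
  by rewrite /chart_normal -nO -mulmxA OO' mulmx1.
have [C C0 [_ H]] := chart_quad_normal oO ch.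
have := H x; rewrite subrr normr0 mul0mx mxE => /(_ _ fx).
rewrite divr_gt0// => /(_ isT); rewrite -nE => Q.
by exists C, (r / 4); rewrite divr_gt0.
Qed.

(** Each normal is defined by a chart centred at its own point; by uniqueness of
    tangent half-planes they all are normals of one chart at x0, which makes the
    constants uniform. The last bound passes from Omega to its closure by
    continuity. *)
Lemma boundary_geometry (R : realType) (Omega : set 'rV[R]_2) (x0 : 'rV[R]_2) :
  open Omega -> W2infty_boundary Omega -> frontier Omega x0 ->
  exists C rho : R, [/\ 0 <= C, 0 < rho &
    forall x, frontier Omega x -> `|x - x0| < rho ->
      let N := outward_unit_normal Omega in
      [/\ dotv (N x) (N x) = 1,
          1 - C * `|x - x0| <= dotv (N x) (N x0) <= 1 &
          forall y, closure Omega y -> `|y - x| < rho ->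
            dotv (y - x) (N x) <= C * dotv (y - x) (y - x)]].
Proof.
move=> oO reg fx0.
have [r [ O [g ch]]] := reg x0 fx0.
have [r0 OO _ _ _] := ch.
have [C C0 [L H]] := chart_quad_normal oO ch.
have Nx x : frontier Omega x -> `|x - x0| < r / 4 ->
    outward_unit_normal Omega x = chart_normal O (derive1 g (((x - x0) *m O) 0 0)).
  move=> fx xr.
  have [C1 [rho1 [C10 rho10 Q1]]] := outward_unit_normalP oO reg fx.
  by apply: (quad_normal_uniq C10 C0 rho10 _ Q1 (H x xr fx)); rewrite divr_gt0.
pose L1 := 2 * C * 2.
have L10 : 0 <= L1 by rewrite !mulr_ge0.
pose rho := Num.min (r / 4) (L1 + 1)^-1.
have rho0 : 0 < rho by rewrite lt_min divr_gt0// invr_gt0 ltr_wpDl.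
have rho1 : rho <= r / 4 by rewrite ge_min lexx.
have rho2 : rho <= (L1 + 1)^-1 by rewrite ge_min lexx orbT.
exists (C + L1), rho; split => //; first by rewrite addr_ge0.
move=> x fx xr N.
have xr4 : `|x - x0| < r / 4 by lra.
have [Q1 Q2] := H x xr4 fx.
have NE := Nx x fx xr4; rewrite -NE in Q1 Q2.
split => //.
  rewrite /N NE Nx//; last by rewrite subrr normr0 divr_gt0.
  have -> : ((x0 - x0) *m O) 0 0 = 0 by rewrite subrr mul0mx mxE.
  set t := ((x - x0) *m O) 0 0.
  have tr : `|t| < r by apply: coord_chart_lt => //; lra.
  have := L t 0 tr ltac:(by rewrite normr0); rewrite subr0.
  have tb : `|t| <= 2 * `|x - x0| := coord_mulmx_orth_le _ _ OO.
  set a := derive1 g t; set b := derive1 g 0 => ab.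
  have ab1 : `|a - b| <= L1 * `|x - x0|.
    apply: (le_trans ab); rewrite /L1 -[2 * C * 2 * _]mulrA; apply: ler_wpM2l => //.
    by rewrite mulr_ge0.
  have ab2 : L1 * `|x - x0| <= 1.
    have : `|x - x0| <= (L1 + 1)^-1 by lra.
    rewrite -[(_)^-1]mul1r ler_pdivlMr ?ltr_wpDl// => ?.
    by have := normr_ge0 (x - x0); lra.
  have ab3 : (a - b) ^+ 2 <= L1 * `|x - x0|.
    rewrite -real_normK ?num_real// expr2.
    by have := normr_ge0 (a - b); nra.
  have /andP[k1 k2] := chart_normal_close OO (le_trans ab3 ab2).
  rewrite k2 andbT; apply: le_trans k1.
  by have := normr_ge0 (x - x0); nra.
move=> y cly yx.
have Cy z : Omega z -> `|z - x| < r / 4 -> dotv (z - x) (N x) <= C * dotv (z - x) (z - x).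
  by move=> Oz zx; have [+ _] := Q2 z zx; apply.
suff Hy : dotv (y - x) (N x) <= C * dotv (y - x) (y - x).
  apply: (le_trans Hy); rewrite ler_wpM2r ?dotvv_ge0//; lra.
rewrite leNgt; apply/negP => lt_.
pose F z := dotv (z - x) (N x) - C * dotv (z - x) (z - x).
have cF : continuous F.
  have c1 : smooth_test F (fun z => N x + (- C) *: (2 *: (z - x))).
    have -> : F = (fun z => (dotv (N x) z + (- C) * dotv (z - x) (z - x)) + (- dotv x (N x))).
      by apply/funext => z; rewrite /F dotvBl (dotvC z); ring.
    have := smooth_testD (smooth_testD (smooth_test_lin (N x)) (smooth_testZ (- C) (smooth_test_dist x)))
       (smooth_test_cst (- dotv x (N x))).
    by congr smooth_test; apply/funext => z; rewrite addr0.
  by move=> z; apply: differentiable_continuous; case: (smooth_test_differentiable z c1).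
have F0 : 0 < F y by rewrite subr_gt0.
have : nbhs y [set z | 0 < F z].
  have := cF y; move/(_ [set s | 0 < s]); apply.
  exact: lt_nbhsr.
move=> nF.
have nB : nbhs y [set z | `|z - x| < r / 4].
  apply/(@nbhs_normP R 'rV[R]_2); exists (r / 4 - `|y - x|) => /=; first by lra.
  move=> z /= yz; apply: (@le_lt_trans _ _ (`|y - z| + `|y - x|)); last by lra.
  by rewrite (distrC y z); exact: ler_distD.
have [z [ Oz [/= Fz zx]]] := cly _ (filterI nF nB).
by have := Cy z Oz zx; rewrite /F in Fz; lra.
Qed.

(** * Semicontinuous functions on compact sets *)

Lemma lsc_onP (R : realType) (A : set 'rV[R]_2) (u : 'rV[R]_2 -> R) :
  lsc_on A u -> forall x, A x -> forall e : R, 0 < e ->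
  exists2 d : R, 0 < d & forall y, A y -> `|y - x| < d -> u x - e < u y.
Proof.
move=> H x Ax e e0.
have [|V nV HV] := H x (u x - e); first by rewrite lte_fin ltrBlDr ltrDl.
move: nV; rewrite -[X in X V]/(nbhs_subspace (x : subspace A)) -nbhs_subspace_in//.
move=> /(@nbhs_normP R 'rV[R]_2)[d /= d0 dV]; exists d => // y Ay yd.
by rewrite -lte_fin; apply: HV; apply: dV => //=; rewrite distrC.
Qed.

Lemma usc_onP (R : realType) (A : set 'rV[R]_2) (u : 'rV[R]_2 -> R) :
  usc_on A u -> forall x, A x -> forall e : R, 0 < e ->
  exists2 d : R, 0 < d & forall y, A y -> `|y - x| < d -> u y < u x + e.
Proof.
move=> /lsc_onP H x Ax e e0; have [d d0 Hd] := H x Ax e e0.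
by exists d => // y Ay yd; have := Hd y Ay yd; lra.
Qed.

(** The superlevel sets form a filter base; any cluster point is a maximum. *)
Lemma usc_compact_max (R : realType) (T : topologicalType) (K : set T) (F : T -> R) :
  compact K -> K !=set0 ->
  (forall x, K x -> forall a : R, F x < a -> exists2 V, nbhs x V & forall y, V y -> K y -> F y < a) ->
  exists2 x, K x & forall y, K y -> F y <= F x.
Proof.
move=> cK [x0 Kx0] usc.
pose G := filter_from K (fun z => [set y | K y /\ F z <= F y]).
have PG : ProperFilter G.
  apply: filter_from_proper; last by move=> z Kz; exists z.
  apply: filter_from_filter; first by exists x0.
  move=> i j Ki Kj; have [ij|ji] := leP (F i) (F j).
    by exists j => // y [Ky jy]; split; split => //; exact: le_trans jy.
  by exists i => // y [Ky iy]; split; split => //; apply: le_trans iy; exact: ltW.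
have GK : G K by exists x0 => // y [].
have [x [Kx clx]] := cK G PG GK.
exists x => // z Kz; rewrite leNgt; apply/negP => xz.
have [V nV HV] := usc x Kx (F z) xz.
have Gz : G [set y | K y /\ F z <= F y] by exists z.
have [y [[Ky zy] Vy]] := clx _ _ Gz nV.
by have := HV y Vy Ky; rewrite ltNge zy.
Qed.

Lemma usc_on_compact_max (R : realType) (K : set 'rV[R]_2) (u : 'rV[R]_2 -> R) :
  compact K -> K !=set0 -> usc_on K u -> exists2 x, K x & forall y, K y -> u y <= u x.
Proof.
move=> cK K0 /usc_onP H; apply: usc_compact_max => // x Kx a xa.
have [d d0 Hd] := H x Kx (a - u x) ltac:(by rewrite subr_gt0).
exists [set y | `|y - x| < d].
  by apply/(@nbhs_normP R 'rV[R]_2); exists d => //= y /=; rewrite distrC.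
by move=> y yd Ky; have := Hd y Ky yd; lra.
Qed.

(** m is the limit, as d tends to 0, of the supremum of [u x - v y] over x in A
    and y in K at distance less than d, and xh is a cluster point of maximising
    pairs. The set A need not be closed: when it is the open domain, high values
    of u on the boundary stay out of the supremum while y still ranges over the
    compact closure. *)
Lemma merging_sup (R : realType) (A K : set 'rV[R]_2) (u v : 'rV[R]_2 -> R) (M : R) :
  compact K -> A `<=` K -> (forall x, K x -> u x <= M) -> (forall y, K y -> - M <= v y) ->
  forall z, A z ->
  exists xh (m : R), [/\ K xh, u z - v z <= m,
    forall t : R, 0 < t -> exists2 d : R, 0 < d & forall x y, A x -> K y -> `|x - y| < d ->
      u x - v y < m + t &
    forall t d : R, 0 < t -> 0 < d -> exists x y, [/\ A x, K y, `|x - xh| < d, `|y - xh| < d &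
      m - t < u x - v y]].
Proof.
move=> cK AK uM vM z Az.
pose S (d : R) := [set s | exists x y, [/\ A x, K y, `|x - y| < d & s = u x - v y]].
pose s0 := u z - v z.
have Sz d : 0 < d -> S d s0 by move=> d0; exists z, z; split => //; [exact: AK|rewrite subrr normr0].
have Sub d : ubound (S d) (M + M).
  by move=> _ [x [y [Ax Ky _ ->]]]; have := uM x (AK _ Ax); have := vM y Ky; lra.
have hS d : 0 < d -> has_sup (S d).
  by move=> d0; split; [exists s0; exact: Sz|exists (M + M)].
pose I := [set sup (S d) | d in [set d : R | 0 < d]].
have Ilb : lbound I s0.
  by move=> _ [d /= d0 <-]; apply: ub_le_sup; [exact: (hS d d0).2|exact: Sz].
have hI : has_inf I by split; [exists (sup (S 1)); exists 1 => //=|exists s0].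
pose m := inf I.
have P1 (t : R) : 0 < t -> exists2 d : R, 0 < d & forall x y, A x -> K y -> `|x - y| < d ->
      u x - v y < m + t.
  move=> t0; have [_ [d /= d0 <-] Hd] := inf_adherent t0 hI.
  exists d => // x y Ax Ky xy; apply: le_lt_trans Hd.
  by apply: ub_le_sup; [exact: (hS d d0).2|exists x, y].
have P2 (t d : R) : 0 < t -> 0 < d -> exists x y, [/\ A x, K y, `|x - y| < d & m - t < u x - v y].
  move=> t0 d0; have [_ [x [y [Ax Ky xy ->]]] Hs] := sup_adherent t0 (hS d d0).
  exists x, y; split => //; apply: le_lt_trans Hs; rewrite lerD2r.
  by apply: ge_inf; [exact: hI.2|exists d].
pose B (t : R) := [set y | exists x, [/\ A x, K y, `|x - y| < t & m - t < u x - v y]].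
pose G := filter_from [set t : R | 0 < t] B.
have PG : ProperFilter G.
  apply: filter_from_proper; last first.
    by move=> t /= t0; have [x [y [? ? ? ?]]] := P2 t t t0 t0; exists y; exists x.
  apply: filter_from_filter; first by exists 1 => /=.
  move=> i j /= i0 j0; exists (Num.min i j); first by rewrite /= lt_min i0 j0.
  have [ij1 ij2] : Num.min i j <= i /\ Num.min i j <= j by rewrite !ge_min !lexx ?orbT.
  move=> y [x [Ax Ky xy ms]]; split; exists x; split => //; lra.
have GK : G K by exists 1 => //= y [x []].
have [xh [Kx clx]] := cK G PG GK.
exists xh, m; split => //; first by apply: lb_le_inf => //; have [] := hI.
move=> t d t0 d0.
pose k := Num.min t (d / 2).
have k0 : 0 < k by rewrite lt_min t0 divr_gt0.
have [k1 k2] : k <= t /\ k <= d / 2 by rewrite !ge_min !lexx ?orbT.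
have Gk : G (B k) by exists k.
have nV : nbhs xh [set y | `|y - xh| < d / 2].
  by apply/(@nbhs_normP R 'rV[R]_2); exists (d / 2) => /=; [exact: divr_gt0|move=> y /=; rewrite distrC].
have [y [[x [Ax Ky xy ms]] /= yx]] := clx _ _ Gk nV.
exists x, y; split => //; try lra.
by apply: (le_lt_trans (ler_distD y _ _)); lra.
Qed.

(** * Doubling of variables *)

(** First-order semijets realised by [smooth_test] functions. *)
Definition touches_above {R : realType} (K : set 'rV[R]_2) (u : 'rV[R]_2 -> R) (x p : 'rV[R]_2) :=
  exists phi D, [/\ smooth_test phi D, D x = p & local_max_on K (fun z => u z - phi z) x].

Definition touches_below {R : realType} (K : set 'rV[R]_2) (v : 'rV[R]_2 -> R) (y q : 'rV[R]_2) :=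
  exists phi D, [/\ smooth_test phi D, D y = q & local_min_on K (fun z => v z - phi z) y].

Lemma nbhs_dotv_lt (R : realType) (x c : 'rV[R]_2) (k : R) :
  dotv (x - c) (x - c) < k -> nbhs x [set z | dotv (z - c) (z - c) < k].
Proof.
move=> H; have := @differentiable_continuous _ _ _ x _
  (smooth_test_differentiable x (smooth_test_dist c)).1.
by move/(_ [set s | s < k]); apply; exact: lt_nbhsl.
Qed.

Lemma continuous_subV (R : realType) (T : topologicalType) (f g : T -> 'rV[R]_2) :
  continuous f -> continuous g -> continuous (fun x => f x - g x).
Proof. by move=> cf cg x; exact: (@cvgB _ 'rV[R]_2 _ _ _ _ _ _ _ (cf x) (cg x)). Qed.

Lemma continuous_addV (R : realType) (T : topologicalType) (f g : T -> 'rV[R]_2) :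
  continuous f -> continuous g -> continuous (fun x => f x + g x).
Proof. by move=> cf cg x; exact: (@cvgD _ 'rV[R]_2 _ _ _ _ _ _ _ (cf x) (cg x)). Qed.

Lemma dotvNN (R : realType) (p : 'rV[R]_2) : dotv (- p) (- p) = dotv p p.
Proof. by rewrite dotvNl dotvNr opprK. Qed.

(** The penalty terms at a doubled maximum: the gap between the two estimates of
    the maximum controls both squares, the linear term being absorbed by the
    localising one. *)
Lemma penalty_bounds (R : realType) (m T kap beta D E1 E2 bxh s2 tt tau : R) :
  0 < beta <= 1 -> 1 <= kap -> T * kap = beta ^+ 2 -> T <= beta ->
  0 <= tau -> tau ^+ 2 <= tt -> 0 <= s2 ->
  m - T / 4 - E1 <= D - (s2 + E2 + 2 * bxh + kap * tt) -> D < m + T / 4 ->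
  `|E1| + `|E2| <= T / 2 -> `|bxh| <= 2 * beta * tau ->
  [/\ kap * s2 + kap * (kap * tt) / 2 <= 9 * beta ^+ 2, 0 <= kap * (kap * tt) &
      m - 21 * beta <= D].
Proof.
move=> /andP[b0 b1] k1 Tk Tb t0 tE s0 Low Up EE.
rewrite ler_norml => /andP[bx1 bx2].
have E1l := ler_norm E1; have E2l := ler_norm (- E2); rewrite normrN in E2l.
have main : s2 + kap * tt <= T + 4 * beta * tau by lra.
have kap0 : 0 < kap by lra.
(* completing the square absorbs [4 beta tau] into half of [kap tau ^ 2] *)
have sq : 0 <= (kap * tau - 4 * beta) ^+ 2 := sqr_ge0 _.
have kt : (kap * tau) ^+ 2 <= kap * (kap * tt).
  by rewrite exprMn expr2 -mulrA !ler_pM2l.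
have main2 : kap * (s2 + kap * tt) <= kap * (T + 4 * beta * tau) by rewrite ler_pM2l.
have main3 : kap * s2 + kap * (kap * tt) / 2 <= 9 * beta ^+ 2 by lra.
have kktt : 0 <= kap * (kap * tt) by apply: le_trans kt; exact: sqr_ge0.
have ks2 : 0 <= kap * s2 by rewrite mulr_ge0// ltW.
have ktau : kap * tau <= 5 * beta.
  have kt0 : 0 <= kap * tau by rewrite mulr_ge0// ltW.
  have b50 : 0 <= 5 * beta by rewrite mulr_ge0// ltW.
  rewrite -(ler_pXn2r (n := 2)) ?nnegrE// [(5 * _) ^+ 2]exprMn.
  by have := sqr_ge0 beta; lra.
have tau5 : tau <= 5 * beta by apply: le_trans ktau; rewrite ler_peMl.
split => //.
have bt : beta * tau <= 5 * beta.
  by apply: le_trans tau5; rewrite ler_piMl.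
have ktt : 0 <= kap * tt by rewrite -(pmulr_rge0 _ kap0).
by lra.
Qed.

Section Doubling.
Context {R : realType} {K A : set 'rV[R]_2} {u v : 'rV[R]_2 -> R} {m : R} {xh : 'rV[R]_2}.
Hypothesis cK : compact K.
Hypothesis clK : closed K.
Hypothesis uK : usc_on K u.
Hypothesis vK : lsc_on K v.
Hypothesis Kxh : K xh.

(** The shift [eps xi] moves x into the domain, a carries the boundary data, b tilts
    the two gradients in opposite directions, and kap localises at xh. *)
Definition penalty (eps kap : R) (xi a b : 'rV[R]_2) (q : 'rV[R]_2 * 'rV[R]_2) : R :=
  eps^-2 * dotv (q.1 - q.2 - eps *: xi) (q.1 - q.2 - eps *: xi) + dotv a (q.1 - q.2)
  + dotv b (q.1 + q.2 - 2 *: xh) + kap * dotv (q.2 - xh) (q.2 - xh).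

Lemma continuous_fst_rV : continuous (fun q : 'rV[R]_2 * 'rV[R]_2 => q.1).
Proof. by move=> q; exact: cvg_fst. Qed.

Lemma continuous_snd_rV : continuous (fun q : 'rV[R]_2 * 'rV[R]_2 => q.2).
Proof. by move=> q; exact: cvg_snd. Qed.

Lemma continuous_gap eps xi :
  continuous (fun q : 'rV[R]_2 * 'rV[R]_2 => dotv (q.1 - q.2 - eps *: xi) (q.1 - q.2 - eps *: xi)).
Proof.
have c1 : continuous (fun q : 'rV[R]_2 * 'rV[R]_2 => q.1 - q.2 - eps *: xi).
  apply: continuous_subV; last exact: cst_continuous.
  by apply: continuous_subV; [exact: continuous_fst_rV|exact: continuous_snd_rV].
exact: continuous_dotv.
Qed.

Lemma continuous_centre :
  continuous (fun q : 'rV[R]_2 * 'rV[R]_2 => dotv (q.2 - xh) (q.2 - xh)).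
Proof.
have c1 : continuous (fun q : 'rV[R]_2 * 'rV[R]_2 => q.2 - xh).
  by apply: continuous_subV; [exact: continuous_snd_rV|exact: cst_continuous].
exact: continuous_dotv.
Qed.

Lemma continuous_penalty eps kap xi a b : continuous (penalty eps kap xi a b).
Proof.
have c1 := @continuous_gap eps xi; have c2 := continuous_centre.
have c3 : continuous (fun q : 'rV[R]_2 * 'rV[R]_2 => dotv a (q.1 - q.2)).
  apply: (@continuous_dotv _ _ (fun=> a)); first exact: cst_continuous.
  by apply: continuous_subV; [exact: continuous_fst_rV|exact: continuous_snd_rV].
have c4 : continuous (fun q : 'rV[R]_2 * 'rV[R]_2 => dotv b (q.1 + q.2 - 2 *: xh)).
  apply: (@continuous_dotv _ _ (fun=> b)); first exact: cst_continuous.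
  apply: continuous_subV; last exact: cst_continuous.
  by apply: continuous_addV; [exact: continuous_fst_rV|exact: continuous_snd_rV].
move=> q; apply: cvgD; last by apply: cvgM; [exact: cvg_cst|exact: c2].
apply: cvgD; last exact: c4.
apply: cvgD; last exact: c3.
by apply: cvgM; [exact: cvg_cst|exact: c1].
Qed.

Definition doubling_domain (eps cc rho : R) (xi : 'rV[R]_2) : set ('rV[R]_2 * 'rV[R]_2) :=
  [set q | [/\ K q.1, K q.2, dotv (q.2 - xh) (q.2 - xh) <= rho ^+ 2 &
    dotv (q.1 - q.2 - eps *: xi) (q.1 - q.2 - eps *: xi) <= (cc * eps) ^+ 2]].

Lemma compact_doubling_domain eps cc rho xi : compact (doubling_domain eps cc rho xi).
Proof.
have cKK : compact (K `*` K) by apply: compact_setX.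
apply: (subclosed_compact _ cKK); last by move=> [x y] [].
have -> : doubling_domain eps cc rho xi = (K `*` K) `&`
   ((fun q : 'rV[R]_2 * 'rV[R]_2 => dotv (q.2 - xh) (q.2 - xh)) @^-1` [set s | s <= rho ^+ 2]) `&`
   ((fun q : 'rV[R]_2 * 'rV[R]_2 => dotv (q.1 - q.2 - eps *: xi) (q.1 - q.2 - eps *: xi))
      @^-1` [set s | s <= (cc * eps) ^+ 2]).
  apply/seteqP; split => [q [? ? ? ?]|q [[[? ?] ?] ?]]; first by split.
  by split.
apply: closedI; first apply: closedI.
- have -> : K `*` K = (fst @^-1` K) `&` (snd @^-1` K) by [].
  by apply: closedI; apply: closed_comp => // q _; [exact: continuous_fst_rV|exact: continuous_snd_rV].
- by apply: closed_comp; [move=> q _; exact: continuous_centre|exact: closed_le].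
- by apply: closed_comp; [move=> q _; exact: continuous_gap|exact: closed_le].
Qed.

Lemma doubling_max eps kap cc rho xi a b :
  doubling_domain eps cc rho xi !=set0 ->
  exists2 q, doubling_domain eps cc rho xi q & forall q', doubling_domain eps cc rho xi q' ->
    u q'.1 - v q'.2 - penalty eps kap xi a b q' <= u q.1 - v q.2 - penalty eps kap xi a b q.
Proof.
move=> E0.
apply: (@usc_compact_max _ _ _ (fun q => u q.1 - v q.2 - penalty eps kap xi a b q)) => //.
  exact: compact_doubling_domain.
move=> [x y] [/= Kx Ky _ _] t xt.
pose e := (t - (u x - v y - penalty eps kap xi a b (x, y))) / 3.
have e0 : 0 < e by rewrite divr_gt0// subr_gt0.
have [d1 d10 H1] := usc_onP uK Kx e0.
have [d2 d20 H2] := lsc_onP vK Ky e0.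
have n1 : nbhs (x, y) [set q : 'rV[R]_2 * 'rV[R]_2 | `|q.1 - x| < d1].
  apply: (@continuous_fst_rV (x, y) [set z | `|z - x| < d1]).
  by apply/(@nbhs_normP R 'rV[R]_2); exists d1 => //= z /=; rewrite distrC.
have n2 : nbhs (x, y) [set q : 'rV[R]_2 * 'rV[R]_2 | `|q.2 - y| < d2].
  apply: (@continuous_snd_rV (x, y) [set z | `|z - y| < d2]).
  by apply/(@nbhs_normP R 'rV[R]_2); exists d2 => //= z /=; rewrite distrC.
have n3 : nbhs (x, y) [set q | penalty eps kap xi a b (x, y) - e < penalty eps kap xi a b q].
  apply: (@continuous_penalty eps kap xi a b (x, y) [set s | penalty eps kap xi a b (x, y) - e < s]).
  by apply: lt_nbhsr; lra.
eexists; first exact: filterI n1 (filterI n2 n3).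
move=> [x' y'] [/= h1 [h2 h3]] [/= Kx' Ky' _ _].
have := H1 x' Kx' h1; have := H2 y' Ky' h2; move: h3; rewrite /e; lra.
Qed.

(** The pair [(xh + eps xi, xh)] nearly attains m at a negligible cost in penalty,
    and the merging supremum m cannot be exceeded by more than a tolerance
    [T = beta ^ 2 / kap]. The quadratic penalties at the maximum point are therefore
    of order T, the constraints of the doubling domain are inactive there, and
    freezing either variable gives a test function for the other. *)
Lemma doubling (xi a b : 'rV[R]_2) (cc rho kap beta eps1 : R) :
  (forall t : R, 0 < t -> exists2 d : R, 0 < d & forall x y, A x -> K y -> `|x - y| < d ->
      u x - v y < m + t) ->
  0 < cc -> 0 < rho -> 1 <= kap -> 0 < beta <= 1 -> 0 < eps1 -> `|b| <= beta ->
  (forall eps x y, 0 < eps < eps1 -> K x -> K y -> dotv (y - xh) (y - xh) <= rho ^+ 2 ->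
     dotv (x - y - eps *: xi) (x - y - eps *: xi) <= (cc * eps) ^+ 2 -> A x) ->
  (forall t : R, 0 < t -> exists2 d : R, 0 < d & forall eps, 0 < eps < d ->
     K (xh + eps *: xi) /\ m - t < u (xh + eps *: xi) - v xh) ->
  9 * beta ^+ 2 < cc ^+ 2 * kap -> 18 * beta ^+ 2 < rho ^+ 2 * kap ->
  forall t : R, 0 < t -> exists eps x y, let p := (2 * eps^-2) *: (x - y - eps *: xi) in
    [/\ 0 < eps < t, A x, K x & K y] /\
    [/\ kap * dotv (x - y - eps *: xi) (x - y - eps *: xi) <= 9 * beta ^+ 2 * eps ^+ 2,
        kap ^+ 2 * dotv (y - xh) (y - xh) <= 18 * beta ^+ 2,
        m - 21 * beta <= u x - v y,
        touches_above K u x (p + a + b) &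
        touches_below K v y (p + a - b - (2 * kap) *: (y - xh))].
Proof.
move=> H1 cc0 rho0 kap1 /andP[beta0 beta1] eps10 bb HA HL small1 small2 t t0.
have kap0 : 0 < kap by lra.
pose T := beta ^+ 2 / kap.
have b20 : 0 < beta ^+ 2 by rewrite exprn_gt0.
have T0 : 0 < T by rewrite divr_gt0.
have Tk : T * kap = beta ^+ 2 by rewrite divfK// gt_eqF.
have Tb : T <= beta.
  have b2 : beta ^+ 2 <= beta by rewrite expr2 ler_piMr// ltW.
  by apply: le_trans b2; rewrite ler_pdivrMr// ler_peMr// ltW.
have [d1 d10 D1] := H1 (T / 4) ltac:(by rewrite divr_gt0).
have [d2 d20 D2] := HL (T / 4) ltac:(by rewrite divr_gt0).
pose B := cc + `|xi|.
have B0 : 0 < B by rewrite /B ltr_wpDr.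
pose C0 := `|dotv a xi| + `|dotv b xi| + 2 * `|a| * B + 2 * beta * B.
have C00 : 0 <= C0.
  by rewrite /C0; do !apply: addr_ge0 => //; rewrite ?mulr_ge0// ltW.
pose eps := Num.min (Num.min (Num.min (t / 2) (eps1 / 2)) (Num.min (d1 / (2 * B)) (d2 / 2))) (T / (2 * (C0 + 1))).
have eps0 : 0 < eps by rewrite /eps !lt_min !divr_gt0// !mulr_gt0// ltr_wpDl.
have [[e1 e2] [e3 e4] e5] : [/\ eps <= t / 2 /\ eps <= eps1 / 2, eps <= d1 / (2 * B) /\ eps <= d2 / 2
   & eps <= T / (2 * (C0 + 1))].
  by split; [split|split|]; rewrite !ge_min lexx ?orbT.
have [Kz Lz] := D2 eps ltac:(by rewrite eps0; lra).
have ce0 : 0 < cc * eps by rewrite mulr_gt0.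
have in0 : doubling_domain eps cc rho xi (xh + eps *: xi, xh).
  split => //=; first by rewrite subrr dotv0l sqr_ge0.
  by rewrite [X in X - _](_ : _ = eps *: xi) ?subrr ?dotv0l ?sqr_ge0// addrC addKr.
have [[x y] [/= Kx Ky yr xyr] Max] := @doubling_max eps kap cc rho xi a b (ex_intro _ _ in0).
have Ax : A x by apply: (HA eps x y) => //; rewrite eps0; lra.
have ixh : penalty eps kap xi a b (xh + eps *: xi, xh) = eps * dotv a xi + eps * dotv b xi.
  rewrite /penalty /= subrr dotv0l mulr0 addr0.
  have -> : xh + eps *: xi - xh = eps *: xi by rewrite addrC addKr.
  have -> : xh + eps *: xi + xh - 2 *: xh = eps *: xi.
    by apply/rowP => i; rewrite !mxE; ring.
  by rewrite subrr dotv0l mulr0 add0r !dotvZr.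
pose s2 := eps^-2 * dotv (x - y - eps *: xi) (x - y - eps *: xi).
have s2E : dotv (x - y - eps *: xi) (x - y - eps *: xi) = s2 * eps ^+ 2.
  by rewrite /s2 mulrAC mulVf ?mul1r// expf_neq0// gt_eqF.
have nw : `|x - y - eps *: xi| <= cc * eps.
  by rewrite -(ler_pXn2r (n := 2)) ?nnegrE// ?(ltW ce0)//; exact: le_trans (dotvv_ge_norm _) xyr.
have nxy : `|x - y| <= B * eps.
  rewrite -(subrK (eps *: xi) (x - y)); apply: (le_trans (ler_normD _ _)).
  by rewrite normrZ (gtr0_norm eps0) /B mulrDl lerD// mulrC.
have Beps : B * eps < d1.
  have e3' : eps * (2 * B) <= d1 by rewrite -ler_pdivlMr// mulr_gt0.
  by apply: lt_le_trans e3'; rewrite mulrC ltr_pM2l// ltr_pMl// ltr1n.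
have Up := D1 x y Ax Ky (le_lt_trans nxy Beps).
have small (k : R) (w z : 'rV[R]_2) : `|w| <= k -> `|z| <= B * eps ->
    `|dotv w z| <= eps * (2 * k * B).
  move=> wk zB; have k0 : 0 <= k := le_trans (normr_ge0 _) wk.
  apply: (le_trans (normr_dotv_le _ _)).
  have -> : eps * (2 * k * B) = 2 * k * (B * eps) by ring.
  by apply: ler_pM => //; rewrite ?mulr_ge0// ler_wpM2l.
have nbE : dotv b (x + y - 2 *: xh) = 2 * dotv b (y - xh) + dotv b (x - y).
  by rewrite -dotvZr -dotvDr; congr dotv; apply/rowP => i; rewrite !mxE; ring.
have nb2 : `|dotv b (y - xh)| <= 2 * beta * `|y - xh|.
  by apply: (le_trans (normr_dotv_le _ _)); apply: ler_wpM2r => //; rewrite ler_wpM2l.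
have eC : eps * C0 <= T / 2.
  have e5' : eps * (2 * (C0 + 1)) <= T by rewrite -ler_pdivlMr// mulr_gt0// ltr_wpDl.
  rewrite ler_pdivlMr//; apply: le_trans e5'; rewrite -mulrA ler_pM2l// mulrC ler_pM2l//.
  by rewrite lerDl.
pose E1 := eps * dotv a xi + eps * dotv b xi; pose E2 := dotv a (x - y) + dotv b (x - y).
have EE : `|E1| + `|E2| <= T / 2.
  apply: le_trans eC; rewrite /C0 -addrA mulrDr; apply: lerD.
    by apply: (le_trans (ler_normD _ _)); rewrite !normrM (gtr0_norm eps0) mulrDr.
  apply: (le_trans (ler_normD _ _)); rewrite mulrDr; apply: lerD.
    exact: small nxy.
  exact: small nxy.
have s20 : 0 <= s2 by rewrite mulr_ge0 ?dotvv_ge0// invr_ge0 exprn_ge0// ltW.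
have Low : m - T / 4 - E1 <= u x - v y - (s2 + E2 + 2 * dotv b (y - xh) + kap * dotv (y - xh) (y - xh)).
  apply: (@le_trans _ _ (u (xh + eps *: xi) - v xh - E1)); first by rewrite lerD2r ltW.
  have MM := Max _ in0; rewrite ixh in MM.
  apply: (le_trans MM); rewrite /penalty /= -/s2 nbE /E2 lerD2l lerN2.
  rewrite le_eqVlt; apply/orP; left; apply/eqP; ring.
have [main kktt mD] := penalty_bounds (ltac:(by rewrite beta0) : 0 < beta <= 1) kap1 Tk Tb
  (normr_ge0 _) (dotvv_ge_norm _) s20 Low Up EE nb2.
have e20 : 0 < eps ^+ 2 by rewrite exprn_gt0.
have ks2 : kap * s2 <= 9 * beta ^+ 2.
  by apply: le_trans main; rewrite lerDl divr_ge0.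
have ktt : kap * (kap * dotv (y - xh) (y - xh)) <= 18 * beta ^+ 2.
  have ks20 : 0 <= kap * s2 by rewrite mulr_ge0// ltW.
  move: main ks20; clear; set X := kap * (kap * _); set Y := kap * s2; lra.
have et : eps < t by apply: (le_lt_trans e1); rewrite ltr_pdivrMr// mulr_natr mulr2n ltrDl.
exists eps, x, y; split; first by split => //; rewrite eps0.
have str1 : dotv (x - y - eps *: xi) (x - y - eps *: xi) < (cc * eps) ^+ 2.
  by rewrite s2E exprMn ltr_pM2r// -(ltr_pM2l kap0) [X in _ < X]mulrC; exact: le_lt_trans small1.
have str2 : dotv (y - xh) (y - xh) < rho ^+ 2.
  rewrite -(ltr_pM2l kap0) [X in _ < X]mulrC; apply: le_lt_trans small2; apply: le_trans ktt.
  by apply: ler_peMl => //; rewrite mulr_ge0 ?dotvv_ge0// ltW.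
split.
- by rewrite s2E mulrA ler_pM2r.
- by rewrite [kap ^+ 2]expr2 -mulrA.
- exact: mD.
- exists (fun z => eps^-2 * dotv (z - (y + eps *: xi)) (z - (y + eps *: xi)) + dotv (a + b) z).
  exists (fun z => eps^-2 *: (2 *: (z - (y + eps *: xi))) + (a + b)); split.
  + by apply: smooth_testD; [exact: smooth_testZ (smooth_test_dist _)|exact: smooth_test_lin].
  + by apply/rowP => i; rewrite !mxE; ring.
  + split => //.
    have N : nbhs x [set z | dotv (z - (y + eps *: xi)) (z - (y + eps *: xi)) < (cc * eps) ^+ 2].
      by apply: nbhs_dotv_lt; rewrite opprD addrA.
    apply: filterS N => z /= zlt Kz'.
    have zE : z - (y + eps *: xi) = z - y - eps *: xi by rewrite opprD addrA.
    have xE : x - (y + eps *: xi) = x - y - eps *: xi by rewrite opprD addrA.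
    rewrite zE in zlt *; rewrite xE.
    have inz : doubling_domain eps cc rho xi (z, y) by split => //=; exact: ltW.
    have := Max _ inz; rewrite /penalty /=.
    move: (eps^-2) (dotv (z - y - _) _) (dotv (x - y - _) _) (dotv (y - xh) _) => k X Y Z.
    by rewrite !(dotvDl a b) !(dotvBr a) !dotvBr !dotvDr; clear; lra.
- exists (fun z => (- eps^-2) * dotv (z - (x - eps *: xi)) (z - (x - eps *: xi)) + dotv (a - b) z
           + (- kap) * dotv (z - xh) (z - xh)).
  exists (fun z => (- eps^-2) *: (2 *: (z - (x - eps *: xi))) + (a - b) + (- kap) *: (2 *: (z - xh))); split.
  + apply: smooth_testD; last exact: smooth_testZ (smooth_test_dist _).
    by apply: smooth_testD; [exact: smooth_testZ (smooth_test_dist _)|exact: smooth_test_lin].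
  + by apply/rowP => i; rewrite !mxE; ring.
  + split => //.
    have E z : z - (x - eps *: xi) = - (x - z - eps *: xi).
      by apply/rowP => i; rewrite !mxE; ring.
    have N : nbhs y [set z | dotv (z - (x - eps *: xi)) (z - (x - eps *: xi)) < (cc * eps) ^+ 2].
      by apply: nbhs_dotv_lt; rewrite E dotvNN.
    have N' : nbhs y [set z | dotv (z - xh) (z - xh) < rho ^+ 2] by exact: nbhs_dotv_lt.
    apply: filterS (filterI N N') => z [/= zlt zr] Kz'.
    rewrite !E !dotvNN in zlt *.
    have inz : doubling_domain eps cc rho xi (x, z) by split => //=; exact: ltW.
    have := Max _ inz; rewrite /penalty /=.
    move: (eps^-2) (dotv (x - z - _) _) (dotv (x - y - _) _) (dotv (z - xh) _) (dotv (y - xh) _).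
    move=> k X Y Z Y'; rewrite !(dotvBl a b) !(dotvBr a) !dotvBr !dotvDr; clear; lra.
Qed.

End Doubling.

(** * The quantity W and the reflectance functions *)

Lemma normr_le_sqrt (R : realType) (a z : R) : a ^+ 2 <= z -> `|a| <= Num.sqrt z.
Proof. by move=> H; rewrite -sqrtr_sqr ler_wsqrtr. Qed.

(** The length of the vector [(a1, a2, a3, sqrt k)] is a 1-Lipschitz function of it. *)
Lemma sqrt_sum_lip (R : realType) (k a1 a2 a3 b1 b2 b3 : R) : 0 < k ->
  `|Num.sqrt (a1 ^+ 2 + a2 ^+ 2 + a3 ^+ 2 + k) - Num.sqrt (b1 ^+ 2 + b2 ^+ 2 + b3 ^+ 2 + k)|
   <= `|a1 - b1| + `|a2 - b2| + `|a3 - b3|.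
Proof.
move=> k0.
have A1 := sqr_ge0 a1; have A2 := sqr_ge0 a2; have A3 := sqr_ge0 a3.
have B1 := sqr_ge0 b1; have B2 := sqr_ge0 b2; have B3 := sqr_ge0 b3.
set X := _ + k; set Y := _ + _ + k.
have X0 : 0 < X by rewrite /X; lra.
have Y0 : 0 < Y by rewrite /Y; lra.
have sX := sqr_sqrtr (ltW X0); have sY := sqr_sqrtr (ltW Y0).
have s0 : 0 < Num.sqrt X by rewrite sqrtr_gt0.
have t0 : 0 < Num.sqrt Y by rewrite sqrtr_gt0.
have la1 : `|a1| <= Num.sqrt X by apply: normr_le_sqrt; rewrite /X; lra.
have la2 : `|a2| <= Num.sqrt X by apply: normr_le_sqrt; rewrite /X; lra.
have la3 : `|a3| <= Num.sqrt X by apply: normr_le_sqrt; rewrite /X; lra.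
have lb1 : `|b1| <= Num.sqrt Y by apply: normr_le_sqrt; rewrite /Y; lra.
have lb2 : `|b2| <= Num.sqrt Y by apply: normr_le_sqrt; rewrite /Y; lra.
have lb3 : `|b3| <= Num.sqrt Y by apply: normr_le_sqrt; rewrite /Y; lra.
set s := Num.sqrt X in sX s0 la1 la2 la3 *; set t := Num.sqrt Y in sY t0 lb1 lb2 lb3 *.
have st0 : 0 < s + t by lra.
rewrite -(ler_pM2r st0) -{1}(gtr0_norm st0) -normrM.
have -> : (s - t) * (s + t) = (a1 - b1) * (a1 + b1) + (a2 - b2) * (a2 + b2) + (a3 - b3) * (a3 + b3).
  by have : s ^+ 2 - t ^+ 2 = X - Y by [rewrite sX sY]; rewrite /X /Y => H; lra.
have P (a b : R) : `|a| <= s -> `|b| <= t -> `|(a - b) * (a + b)| <= `|a - b| * (s + t).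
  move=> la lb; rewrite normrM ler_wpM2l//.
  by apply: (le_trans (ler_normD _ _)); exact: lerD.
have := P _ _ la1 lb1; have := P _ _ la2 lb2; have := P _ _ la3 lb3.
set u1 := (a1 - b1) * _; set u2 := (a2 - b2) * _; set u3 := (a3 - b3) * _.
have := ler_normD (u1 + u2) u3; have := ler_normD u1 u2.
by lra.
Qed.

Definition lam {R : realType} (f : R) (x : 'rV[R]_2) : R := Num.sqrt (f ^+ 2 + dotv x x).

Section Geometry_of_W.
Context {R : realType} {f : R}.
Hypothesis f0 : 0 < f.

Lemma lamE (x : 'rV[R]_2) :
  lam f x = Num.sqrt ((x 0 0) ^+ 2 + (x 0 1) ^+ 2 + 0 ^+ 2 + f ^+ 2).
Proof. by rewrite /lam dotvE; congr Num.sqrt; ring. Qed.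

Lemma lam_lip (x y : 'rV[R]_2) : `|lam f x - lam f y| <= 2 * `|x - y|.
Proof.
rewrite !lamE; apply: (le_trans (sqrt_sum_lip _ _ _ _ _ _ _)); first by rewrite exprn_gt0.
rewrite subrr normr0 addr0.
have := coord_le_norm (x - y) 0; have := coord_le_norm (x - y) 1; rewrite !mxE; lra.
Qed.

Lemma lam_ge (x : 'rV[R]_2) : f <= lam f x.
Proof.
have := @normr_le_sqrt R f (f ^+ 2 + dotv x x); rewrite gtr0_norm//; apply.
by rewrite lerDl dotvv_ge0.
Qed.

Lemma lam_le (x : 'rV[R]_2) : lam f x <= f + 2 * `|x|.
Proof.
have l0 : lam f 0 = f by rewrite /lam dotv0l addr0 sqrtr_sqr gtr0_norm.
by have := lam_lip x 0; rewrite subr0 l0 ler_norml => /andP[]; lra.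
Qed.

(** W is the squared length of the vector [(lam p, lam (p . x) / f)]; this makes
    [sqrt (W + 1)] the length of a vector that is linear in p and locally
    Lipschitz in x. *)
Lemma W_sum (x p : 'rV[R]_2) : W f x p =
  (lam f x * p 0 0) ^+ 2 + (lam f x * p 0 1) ^+ 2 + (lam f x * dotv p x / f) ^+ 2.
Proof.
have l0 : lam f x != 0 by rewrite gt_eqF// (lt_le_trans f0)// lam_ge.
have f1 : f != 0 by rewrite gt_eqF.
rewrite /W /Q -/(lam f x) (dotvE p p); field.
by rewrite l0 f1.
Qed.

Lemma W_ge0 (x p : 'rV[R]_2) : 0 <= W f x p.
Proof. by rewrite W_sum; do !apply: addr_ge0; exact: sqr_ge0. Qed.

Lemma sqrtW_ge (x p : 'rV[R]_2) : f * `|p| <= Num.sqrt (W f x p + 1).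
Proof.
have f0' := f0; have l1 := lam_ge x; have p0 := normr_ge0 p.
apply: (@le_trans _ _ (lam f x * `|p|)); first by rewrite ler_wpM2r.
have lp : lam f x * `|p| = `|lam f x * `|p| |.
  by rewrite ger0_norm// mulr_ge0//; lra.
rewrite lp; apply: normr_le_sqrt; rewrite W_sum.
have S1 := sqr_ge0 (lam f x * p 0 0); have S2 := sqr_ge0 (lam f x * p 0 1).
have S3 := sqr_ge0 (lam f x * dotv p x / f).
have E (a : R) : (lam f x * `|a|) ^+ 2 = (lam f x * a) ^+ 2.
  by rewrite !exprMn real_normK ?num_real.
by have [->|->] := row2_norm_eq p; rewrite E; lra.
Qed.

Lemma sqrtW_lip (M : R) : 0 <= M -> exists2 C : R, 0 <= C & forall x y p q : 'rV[R]_2,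
  `|x| <= M -> `|y| <= M ->
  `|Num.sqrt (W f x p + 1) - Num.sqrt (W f y q + 1)|
    <= C * (`|p - q| + `|x - y| * (1 + `|p|)).
Proof.
move=> M0; have f0' := f0; pose L := f + 2 * M.
have L0 : 0 < L by rewrite /L; lra.
exists (4 + 2 * L + (4 * M + 2 * L * M + 2 * L) / f).
  have : 0 <= (4 * M + 2 * L * M + 2 * L) / f.
    by rewrite divr_ge0 ?(ltW f0)// ?addr_ge0// ?mulr_ge0// ltW.
  lra.
move=> x y p q xM yM; rewrite !W_sum.
apply: (le_trans (sqrt_sum_lip _ _ _ _ _ _ ltr01)).
have ll := lam_lip x y; have ly : `|lam f y| <= L.
  rewrite ger0_norm; last by apply: le_trans (lam_ge y); exact: ltW.
  by apply: (le_trans (lam_le y)); rewrite /L; lra.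
set d := `|x - y| in ll *; set e := `|p - q|; set P := `|p|.
have d0 : 0 <= d := normr_ge0 _; have e0 : 0 <= e := normr_ge0 _; have P0 : 0 <= P := normr_ge0 _.
have prod (a b a' b' : R) : `|a * b - a' * b'| <= `|a - a'| * `|b| + `|a'| * `|b - b'|.
  have -> : a * b - a' * b' = (a - a') * b + a' * (b - b') by ring.
  by apply: (le_trans (ler_normD _ _)); rewrite !normrM.
have coord i : `|lam f x * p 0 i - lam f y * q 0 i| <= 2 * d * P + L * e.
  apply: (le_trans (prod _ _ _ _)); apply: lerD.
    by apply: ler_pM => //; exact: coord_le_norm.
  by apply: ler_pM => //; have := coord_le_norm (p - q) i; rewrite !mxE.
have px : `|dotv p x| <= 2 * P * M.
  by apply: (le_trans (normr_dotv_le _ _)); rewrite ler_wpM2l// mulr_ge0.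
have pq : `|dotv p x - dotv q y| <= 2 * e * M + 2 * P * d.
  have -> : dotv p x - dotv q y = dotv (p - q) y + dotv p (x - y).
    by rewrite dotvBl dotvBr; ring.
  apply: (le_trans (ler_normD _ _)); apply: lerD; last exact: normr_dotv_le.
  by apply: (le_trans (normr_dotv_le _ _)); rewrite ler_wpM2l// mulr_ge0.
have third : `|lam f x * dotv p x / f - lam f y * dotv q y / f| <=
    (2 * d * (2 * P * M) + L * (2 * e * M + 2 * P * d)) / f.
  rewrite -mulrBl normrM (gtr0_norm (_ : 0 < f^-1)) ?invr_gt0//.
  rewrite ler_pM2r ?invr_gt0//.
  apply: (le_trans (prod _ _ _ _)); apply: lerD; exact: ler_pM.
have c0 := coord 0; have c1 := coord 1.
apply: (le_trans (lerD (lerD c0 c1) third)).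
have -> : 2 * d * P + L * e + (2 * d * P + L * e) + (2 * d * (2 * P * M) + L * (2 * e * M + 2 * P * d)) / f
  = 4 * (d * P) + 2 * L * e + (4 * M * (d * P) + 2 * L * M * e + 2 * L * (d * P)) / f.
  by field; rewrite gt_eqF.
rewrite [X in _ <= X]mulrDl; apply: lerD.
  have : 0 <= d * P by rewrite mulr_ge0.
  have : 0 <= L * d * P by rewrite !mulr_ge0// ltW.
  have : 0 <= L * d by rewrite mulr_ge0// ltW.
  by nra.
rewrite [X in _ <= X]mulrAC ler_pM2r ?invr_gt0//.
have dP : 0 <= d * P by rewrite mulr_ge0.
have MdP : 0 <= M * (d * P) by rewrite mulr_ge0.
have Me : 0 <= M * e by rewrite mulr_ge0.
have Md : 0 <= M * d by rewrite mulr_ge0.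
have LM : 0 <= L * M by rewrite mulr_ge0// ltW.
have LMd : 0 <= L * M * d by rewrite mulr_ge0.
have LMdP : 0 <= L * M * (d * P) by rewrite mulr_ge0.
have Le : 0 <= L * e by rewrite mulr_ge0// ltW.
have Ld : 0 <= L * d by rewrite mulr_ge0// ltW.
have LdP : 0 <= L * (d * P) by rewrite mulr_ge0// ltW.
by nra.
Qed.

End Geometry_of_W.

Lemma exprn_lip (R : realType) (n : nat) (a b : R) : 0 <= a <= 1 -> 0 <= b <= 1 ->
  `|a ^+ n - b ^+ n| <= n%:R * `|a - b|.
Proof.
move=> /andP[a0 a1] /andP[b0 b1]; elim: n => [|n IH].
  by rewrite !expr0 subrr normr0 mul0r.
have -> : a ^+ n.+1 - b ^+ n.+1 = a * (a ^+ n - b ^+ n) + (a - b) * b ^+ n.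
  by rewrite !exprS; ring.
apply: (le_trans (ler_normD _ _)); rewrite !normrM -natr1 mulrDl mul1r.
apply: lerD.
  by rewrite ger0_norm//; have := normr_ge0 (a ^+ n - b ^+ n); nra.
have bn : `|b ^+ n| <= 1 by rewrite ger0_norm ?exprn_ge0// exprn_ile1.
by have := normr_ge0 (a - b); nra.
Qed.

Lemma quotient_lip (R : realType) (k U C s t D E : R) :
  0 < k -> k <= D <= U -> k <= E <= U -> 0 <= C -> `|t * (D - E)| <= C * `|s - t| ->
  `|s / D - t / E| <= (U + C) / k ^+ 2 * `|s - t|.
Proof.
move=> k0 /andP[kD DU] /andP[kE EU] C0 H.
have D0 : 0 < D by lra.
have E0 : 0 < E by lra.
have -> : s / D - t / E = ((s - t) * E - t * (D - E)) / (D * E).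
  by field; rewrite !gt_eqF.
have DE : 0 < D * E by rewrite mulr_gt0.
have kk : 0 < k ^+ 2 by rewrite exprn_gt0.
rewrite normrM normfV (gtr0_norm DE) ler_pdivrMr//.
have N : `|(s - t) * E - t * (D - E)| <= (U + C) * `|s - t|.
  apply: (le_trans (ler_normB _ _)); rewrite normrM (gtr0_norm E0) mulrDl.
  apply: lerD => //; rewrite mulrC; exact: ler_wpM2r.
apply: (le_trans N).
have st := normr_ge0 (s - t).
have X0 : 0 <= (U + C) * `|s - t| by rewrite mulr_ge0//; lra.
have -> : (U + C) / k ^+ 2 * `|s - t| * (D * E) = (U + C) * `|s - t| * (D * E / k ^+ 2).
  by ring.
rewrite ler_peMr// ler_pdivlMr// mul1r expr2.
by apply: ler_pM => //; exact: ltW.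
Qed.

(** Negative powers are Lipschitz at unit scale: with [q = y / x <= 1] this is
    Bernoulli's inequality [1 - q ^ N <= N (1 - q)] for an integer [N >= b]. *)
Lemma powRN_gap (R : realType) (N : nat) (b x y : R) :
  0 <= b -> b <= N%:R -> 1 <= y -> y <= x ->
  0 <= y `^ (- b) - x `^ (- b) /\ y * (y `^ (- b) - x `^ (- b)) <= N%:R * (x - y).
Proof.
move=> b0 bN y1 yx.
have x0 : 0 < x by lra.
have y0 : 0 < y by lra.
have [q qE] : exists q, q = y / x by exists (y / x).
have q0 : 0 < q by rewrite qE divr_gt0.
have q1 : q <= 1 by rewrite qE ler_pdivrMr// mul1r.
have ys1 : y `^ (- b) <= 1.
  by rewrite -(powRr0 y); apply: ler_powR => //; rewrite oppr_le0.
have ys0 : 0 < y `^ (- b) by rewrite powR_gt0.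
have -> : x `^ (- b) = y `^ (- b) * q `^ b.
  rewrite qE powRM ?invr_ge0 ?ltW// mulrA -powRD; last by apply/implyP => _; rewrite gt_eqF.
  rewrite addNr powRr0 mul1r -powR_inv1 ?ltW//.
  by rewrite -powRrM mulN1r.
have qN : q ^+ N <= q `^ b.
  by rewrite -powR_mulrn ?(ltW q0)//; apply: ger_powR => //; rewrite q0.
have bern : 1 - q ^+ N <= N%:R * (1 - q).
  have := @exprn_lip _ N 1 q ltac:(by rewrite ler01 lexx) ltac:(by rewrite q1 ltW).
  by rewrite expr1n => /ler_normlW; rewrite (ger0_norm (_ : 0 <= 1 - q))// subr_ge0.
have qb1 : q `^ b <= 1.
  by rewrite -(powRr0 q); apply: ger_powR => //; rewrite q0.
have yq : y * (1 - q) <= x - y.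
  have -> : y * (1 - q) = y / x * (x - y) by rewrite qE; field; rewrite gt_eqF.
  by rewrite -qE ler_piMl// subr_ge0.
move: ys0 ys1 qN qb1; move: (y `^ (- b)) (q `^ b) => w p w0 w1 qN p1.
have -> : w - w * p = w * (1 - p) by ring.
have p0 : 0 <= 1 - p by rewrite subr_ge0.
split; first by rewrite mulr_ge0// ltW.
have h1 : w * (1 - p) <= N%:R * (1 - q).
  by apply: (@le_trans _ _ (1 - p)); [rewrite ler_piMl|lra].
apply: (@le_trans _ _ (y * (N%:R * (1 - q)))); first by rewrite ler_wpM2l// ltW.
by rewrite mulrCA ler_wpM2l.
Qed.

Section Reflectance.
Context {R : realType}.
Implicit Types (r : R).

Let root r : R := Num.sqrt (r + 1).

Lemma root_ge1 r : 0 <= r -> 1 <= root r.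
Proof. by move=> r0; rewrite /root -{1}(sqrtr1 R) ler_wsqrtr// lerDr. Qed.

Lemma root_sqr r : 0 <= r -> root r ^+ 2 = r + 1.
Proof. by move=> r0; rewrite sqr_sqrtr// addr_ge0. Qed.

Definition root_lipschitz (F : R -> R) := exists2 C : R, 0 <= C & forall r s, 0 <= r -> 0 <= s ->
  `|F r - F s| <= C * `|Num.sqrt (r + 1) - Num.sqrt (s + 1)|.

Definition root_coercive (F : R -> R) := exists2 c : R, 0 < c & forall r, 0 <= r ->
  c * Num.sqrt (r + 1) <= F r.

(** Lambert, Phong and Blinn-Phong reflectances are quotients of [sqrt (r + 1)] by
    a denominator D lying between positive constants. Comparing pairs [s <= r]
    suffices by symmetry. *)
Lemma root_quotient (F D : R -> R) (k U C : R) :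
  0 < k -> 0 <= C ->
  (forall r, 0 <= r -> F r = root r / D r /\ k <= D r <= U) ->
  (forall r s, 0 <= s -> s <= r -> `|root s * (D r - D s)| <= C * `|root r - root s|) ->
  root_lipschitz F /\ root_coercive F.
Proof.
move=> k0 C0 HD HC; split.
  exists ((U + C) / k ^+ 2).
    have [_ /andP[k1 k2]] := HD 0 (lexx _).
    by rewrite divr_ge0 ?sqr_ge0//; lra.
  have wl r s : 0 <= s -> s <= r -> `|F r - F s| <= (U + C) / k ^+ 2 * `|root r - root s|.
    move=> s0 sr; have [-> Dr] := HD r (le_trans s0 sr); have [-> Ds] := HD s s0.
    by apply: quotient_lip => //; exact: HC.
  move=> r s r0 s0; have [sr|rs] := leP s r; first exact: wl.
  by rewrite distrC [X in _ <= _ * X]distrC; apply: wl => //; exact: ltW.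
have U0 : 0 < U by have [_ /andP[k1 k2]] := HD 0 (lexx _); lra.
exists U^-1; first by rewrite invr_gt0.
move=> r r0; have [-> /andP[D1 D2]] := HD r r0; rewrite mulrC ler_wpM2l ?sqrtr_ge0//.
by rewrite lef_pV2 ?posrE//; lra.
Qed.

Lemma F_L_root : root_lipschitz (@F_L R) /\ root_coercive (@F_L R).
Proof.
apply: (@root_quotient _ (fun=> 1) 1 1 0) => //.
  by move=> r r0; rewrite divr1 lexx.
by move=> r s _ _; rewrite subrr mulr0 normr0 mul0r.
Qed.

(** With [x = sqrt (r + 1)] the function is [x ^ 2 / (A x + B (x ^ 2 - 1))]. It is
    bounded when [B > 0], unlike the other three. *)
Lemma F_ON_root (sigma : R) : root_lipschitz (F_ON sigma).
Proof.
have s2 := sqr_ge0 sigma.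
have A1 : 1 / 2 <= A_ON sigma.
  rewrite /A_ON.
  have : 5 / 10 * sigma ^+ 2 * (sigma ^+ 2 + 33 / 100)^-1 <= 1 / 2.
    by rewrite ler_pdivrMr; lra.
  lra.
have B0 : 0 <= B_ON sigma.
  by rewrite /B_ON; apply: mulr_ge0; [lra|rewrite invr_ge0; lra].
set A := A_ON sigma in A1; set B := B_ON sigma in B0.
exists ((A + 2 * B) / A ^+ 2); first by rewrite divr_ge0 ?sqr_ge0//; lra.
move=> r s r0 s0; rewrite /F_ON -/A -/B.
have x1 := root_ge1 r0; have y1 := root_ge1 s0.
have := root_sqr r0; have := root_sqr s0.
move: x1 y1; rewrite /root; set x := Num.sqrt (r + 1); set y := Num.sqrt (s + 1) => x1 y1 ys xs.
have -> : r = x ^+ 2 - 1 by rewrite xs; ring.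
have -> : s = y ^+ 2 - 1 by rewrite ys; ring.
rewrite !subrK.
have A0 : 0 < A by lra.
have d1 : A * x <= A * x + B * (x ^+ 2 - 1) by rewrite lerDl mulr_ge0//; nra.
have d2 : A * y <= A * y + B * (y ^+ 2 - 1) by rewrite lerDl mulr_ge0//; nra.
have Ax0 : 0 < A * x by rewrite mulr_gt0//; lra.
have Ay0 : 0 < A * y by rewrite mulr_gt0//; lra.
set D := _ + _ in d1 *; set E := A * y + _ in d2 *.
have D0 : 0 < D by lra.
have E0 : 0 < E by lra.
have -> : x ^+ 2 / D - y ^+ 2 / E = (x - y) * (A * x * y - B * (x + y)) / (D * E).
  rewrite -[RHS]/(_ * _ / _).
  have -> : (x - y) * (A * x * y - B * (x + y)) = x ^+ 2 * E - y ^+ 2 * D.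
    by rewrite /D /E; ring.
  by field; rewrite !gt_eqF.
have DE : 0 < D * E by rewrite mulr_gt0.
rewrite normrM normfV (gtr0_norm DE) normrM -mulrA mulrC ler_wpM2r// ler_pdivrMr//.
have xy1 : 1 <= x * y by nra.
have N : `|A * x * y - B * (x + y)| <= (A + 2 * B) * (x * y).
  have h1 : x + y <= 2 * (x * y) by nra.
  have h2 : B * (x + y) <= B * (2 * (x * y)) by rewrite ler_wpM2l.
  have h3 : 0 <= B * (x + y) by rewrite mulr_ge0//; lra.
  have h4 : 0 <= A * (x * y) by rewrite mulr_ge0//; lra.
  have h5 : 0 <= B * (x * y) by rewrite mulr_ge0//; lra.
  by rewrite ler_norml; apply/andP; split; lra.
apply: (le_trans N).
have -> : (A + 2 * B) / A ^+ 2 * (D * E) = (A + 2 * B) * (D * E / A ^+ 2) by ring.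
rewrite ler_pM2l; last by lra.
rewrite ler_pdivlMr ?exprn_gt0//.
have -> : x * y * A ^+ 2 = (A * x) * (A * y) by ring.
by apply: ler_pM => //; exact: ltW.
Qed.

Lemma F_BP_root (kD kS c : R) : 0 < kD -> 0 <= kS -> 1 <= c ->
  root_lipschitz (F_BP kD kS c) /\ root_coercive (F_BP kD kS c).
Proof.
move=> kD0 kS0 c1.
pose b := c - 1; have b0 : 0 <= b by rewrite /b; lra.
(* dividing through by [root r ^ b], the denominator becomes [kD + kS root r ^ -b] *)
pose w r := root r `^ (- b).
have [N bN] : exists N : nat, b <= N%:R.
  by exists (Num.truncn b).+1; exact/ltW/truncnS_gt.
have w01 r : 0 <= r -> 0 < w r <= 1.
  move=> r0; have r1 := root_ge1 r0.
  rewrite powR_gt0 ?(lt_le_trans ltr01)//=.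
  by rewrite -(powRr0 (root r)); apply: ler_powR => //; lra.
apply: (@root_quotient _ (fun r => kD + kS * w r) kD (kD + kS) (kS * N%:R)) => //.
- by rewrite mulr_ge0.
- move=> r r0; split; last first.
    by have /andP[w0 w1] := w01 r r0; apply/andP; split; nra.
  have r1 := root_ge1 r0.
  have rr : r + 1 = root r `^ 2 by rewrite powR_mulrn ?root_sqr//; lra.
  rewrite /F_BP rr -!powRrM.
  have -> : 2 * (c / 2) = 1 + b by rewrite /b; field.
  have -> : 2 * ((c - 1) / 2) = b by rewrite /b; field.
  have rn0 : root r != 0 by rewrite gt_eqF//; lra.
  rewrite powRD; last by apply/implyP => /eqP y0; lra.
  rewrite powRr1; last lra.
  rewrite /w powRN.
  have p0 : 0 < root r `^ b by rewrite powR_gt0//; lra.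
  have q0 : 0 < kD * root r `^ b + kS by rewrite ltr_wpDr// mulr_gt0.
  move: p0 q0; set p := _ `^ b => p0 q0.
  have -> : kD + kS / p = (kD * p + kS) / p by field; rewrite gt_eqF.
  by field; rewrite !gt_eqF.
- move=> r s s0 sr.
  have r0 := le_trans s0 sr.
  have s1 := root_ge1 s0; have r1 := root_ge1 r0.
  have rs : root s <= root r by rewrite /root ler_wsqrtr// lerD2r.
  have [g0 g1] := powRN_gap b0 bN s1 rs.
  have -> : kD + kS * w r - (kD + kS * w s) = - (kS * (w s - w r)) by ring.
  rewrite mulrN normrN mulrCA -mulrA normrM ger0_norm//; apply: ler_wpM2l => //.
  rewrite (ger0_norm (_ : 0 <= root r - root s)); last by rewrite subr_ge0.
  by rewrite ger0_norm// mulr_ge0// (le_trans ler01).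
Qed.

Lemma F_PH_root (kD kS : R) (alpha : nat) : 0 < kD -> 0 <= kS -> (1 <= alpha)%N ->
  root_lipschitz (F_PH kD kS alpha) /\ root_coercive (F_PH kD kS alpha).
Proof.
move=> kD0 kS0 a1.
(* dividing through by [(r + 1) ^ alpha], the denominator becomes
   [kD + kS root r (rho r) ^ alpha] *)
pose rho r : R := if 1 <= r then 0 else (1 - r) / (r + 1).
have rho01 r : 0 <= r -> 0 <= rho r <= 1.
  move=> r0; rewrite /rho; case: ifPn => [_|]; first by rewrite lexx ler01.
  rewrite -ltNge => r1; rewrite divr_ge0 ?ler_pdivrMr ?mul1r/=; lra.
have rhoa r : 0 <= r -> 0 <= rho r ^+ alpha <= rho r.
  move=> /rho01 /andP[p0 p1]; rewrite exprn_ge0//=.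
  by case: (alpha) a1 => // n _; rewrite exprS ler_piMr// exprn_ile1.
have sqrho r : 0 <= r -> root r * rho r <= 2.
  move=> r0; have s1 := root_ge1 r0; rewrite /rho; case: ifPn => [_|]; first by rewrite mulr0.
  rewrite -ltNge => r1; rewrite -(root_sqr r0) mulrA ler_pdivrMr ?exprn_gt0//; last lra.
  by nra.
apply: (@root_quotient _ (fun r => kD + kS * (root r * rho r ^+ alpha)) kD (kD + 2 * kS)
   (kS * (2 + 4 * alpha%:R))) => //.
- by rewrite mulr_ge0// addr_ge0// mulr_ge0.
- move=> r r0; have s1 := root_ge1 r0; have /andP[p0 p1] := rhoa r r0.
  have q1 := sqrho r r0.
  have q2 : 0 <= root r * rho r ^+ alpha by rewrite mulr_ge0//; lra.
  have q3 : root r * rho r ^+ alpha <= 2 by apply: le_trans q1; rewrite ler_wpM2l//; lra.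
  split; last by apply/andP; split; nra.
  rewrite /F_PH /rho; case: ifPn => r1; first by rewrite expr0n gtn_eqF// !mulr0 addr0.
  rewrite -ltNge in r1.
  have R0 : 0 < r + 1 by lra.
  have powE : (r + 1) `^ (1 / 2) = root r by rewrite mul1r powR12_sqrt// ltW.
  rewrite powRD; last by apply/implyP => /eqP y0; lra.
  rewrite powE powR_mulrn ?ltW// expr_div_n.
  have A0 : 0 < (r + 1) ^+ alpha by rewrite exprn_gt0.
  have B0 : 0 <= (1 - r) ^+ alpha by rewrite exprn_ge0// subr_ge0 ltW.
  move: A0 B0; set a := (r + 1) ^+ alpha; set b := (1 - r) ^+ alpha => A0 B0.
  have n0 : 0 < kD * a + kS * root r * b.
    by rewrite ltr_wpDr ?mulr_gt0// !mulr_ge0//; lra.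
  have -> : kD + kS * (root r * (b / a)) = (kD * a + kS * root r * b) / a.
    by field; rewrite gt_eqF.
  by field; rewrite !gt_eqF.
- move=> r s s0 sr; have r0 := le_trans s0 sr.
  have y1 := root_ge1 s0; have x1 := root_ge1 r0.
  have yx : root s <= root r by rewrite /root ler_wsqrtr// lerD2r.
  have /andP[pr0 pr1] := rho01 r r0; have /andP[ps0 ps1] := rho01 s s0.
  have /andP[ar0 ar1] := rhoa r r0.
  have xr2 := sqrho r r0.
  have rl : root s ^+ 2 * `|rho r - rho s| <= 4 * (root r - root s).
    have xs := root_sqr r0; have ys := root_sqr s0.
    set x := root r in x1 yx xs xr2 *; set y := root s in y1 yx ys *.
    rewrite /rho; case: ifPn => hr; case: ifPn => hs; rewrite -?ltNge in hr hs.
    + by rewrite subrr normr0 mulr0; lra.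
    + rewrite sub0r normrN ger0_norm; last by rewrite divr_ge0; lra.
      rewrite ys mulrCA mulfV ?mulr1; last by rewrite gt_eqF//; lra.
      have [x2|x2] := leP x 2; first by nra.
      by have : y <= 3 / 2 by [nra]; nra.
    + by lra.
    + have -> : (1 - r) / (r + 1) - (1 - s) / (s + 1) = - (2 * (r - s) / ((r + 1) * (s + 1))).
        by field; rewrite !gt_eqF//; lra.
      rewrite normrN ger0_norm; last by rewrite divr_ge0 ?mulr_ge0//; lra.
      have -> : y ^+ 2 * (2 * (r - s) / ((r + 1) * (s + 1))) = 2 * (r - s) / (r + 1).
        by rewrite ys; field; rewrite !gt_eqF//; lra.
      have -> : r - s = x ^+ 2 - y ^+ 2 by rewrite xs ys; ring.
      rewrite -xs ler_pdivrMr ?exprn_gt0//; last lra.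
      have h : x + y <= 2 * x ^+ 2 by nra.
      have h' : (x - y) * (x + y) <= (x - y) * (2 * x ^+ 2) by rewrite ler_wpM2l// subr_ge0.
      by lra.
  have La := @exprn_lip _ alpha _ _ (rho01 r r0) (rho01 s s0).
  have -> : kD + kS * (root r * rho r ^+ alpha) - (kD + kS * (root s * rho s ^+ alpha)) =
    kS * ((root r - root s) * rho r ^+ alpha + root s * (rho r ^+ alpha - rho s ^+ alpha)) by ring.
  rewrite mulrCA normrM (ger0_norm kS0) -mulrA; apply: ler_wpM2l => //.
  rewrite mulrDr [X in _ <= X]mulrDl; apply: (le_trans (ler_normD _ _)); apply: lerD.
    rewrite mulrCA normrM mulrC; apply: ler_wpM2r => //.
    rewrite ger0_norm; last by rewrite mulr_ge0//; lra.
    apply: le_trans xr2; apply: ler_pM => //; lra.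
  rewrite mulrA -expr2 normrM ger0_norm ?sqr_ge0//.
  apply: (@le_trans _ _ (alpha%:R * (root s ^+ 2 * `|rho r - rho s|))).
    by rewrite mulrCA; apply: ler_wpM2l => //; exact: sqr_ge0.
  rewrite (ger0_norm (_ : 0 <= root r - root s)); last by lra.
  have -> : 4 * alpha%:R * (root r - root s) = alpha%:R * (4 * (root r - root s)) by ring.
  by apply: ler_wpM2l.
Qed.

Lemma F_of_root (M : reflectance R) : admissible M ->
  root_lipschitz (F_of M) /\ (~~ is_oren_nayar M -> root_coercive (F_of M)).
Proof.
case: M => [|sigma|kA kD kS alpha|kA kD kS c] /=.
- by move=> _; have [H1 H2] := F_L_root.
- by move=> _; split => //; exact: F_ON_root.
- by move=> [[_ _ kS0] _ kD0 a1]; have [] := F_PH_root kD0 kS0 a1.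
- by move=> [[_ _ kS0] _ kD0 c1]; have [] := F_BP_root kD0 kS0 c1.
Qed.

End Reflectance.

(** * Structure and coercivity of the Hamiltonian *)

Lemma bounded_closure (R : realType) (Omega : set 'rV[R]_2) : bounded_set Omega ->
  (exists2 M : R, 0 <= M & forall x, closure Omega x -> `|x| <= M) /\ compact (closure Omega).
Proof.
move=> bO.
have [M M0 HM] : exists2 M : R, 0 <= M & forall x, closure Omega x -> `|x| <= M.
  move: bO => [M [_ HM]]; exists (`|M| + 2); first by rewrite addr_ge0.
  move=> x /closure_ballP/(_ 1 ltr01)[y Oy yx].
  have : `|y| <= `|M| + 1 by apply: HM => //; have := ler_norm M; lra.
  have := ler_normD (x - y) y; rewrite subrK distrC; lra.
split; first by exists M.
apply: bounded_closed_compact; last exact: closed_closure.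
exists M; split; first exact: num_real.
by move=> k Mk x /= clx; apply: (le_trans (HM x clx)); exact: ltW.
Qed.

Lemma lipschitz_onP (R : realType) (K : set 'rV[R]_2) (J : 'rV[R]_2 -> R) :
  [lipschitz J x | x in K] ->
  exists2 L : R, 0 <= L & forall x y, K x -> K y -> `|J x - J y| <= L * `|x - y|.
Proof.
move=> [M [_ HM]]; exists (`|M| + 1); first by rewrite addr_ge0.
move=> x y Kx Ky; have := HM (`|M| + 1) ltac:(have := ler_norm M; lra) (x, y).
by apply.
Qed.

(** Both the intensity and, through [sqrt (W + 1)], the reflectance are Lipschitz,
    so the first-order parts at [(x, p)] and [(y, q)] differ by the usual modulus;
    this bounds the difference of the zeroth-order parts. *)
Lemma hamiltonian_gap (R : realType) (K : set 'rV[R]_2) (f MK : R) (I IA : 'rV[R]_2 -> R) (M : reflectance R) :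
  0 < f -> admissible M -> 0 <= MK -> (forall x, K x -> `|x| <= MK) ->
  [lipschitz intensity M I IA x | x in K] ->
  exists2 C : R, 0 <= C & forall x y r s p q, K x -> K y ->
    hamiltonian f I IA M x r p <= 0 -> 0 <= hamiltonian f I IA M y s q ->
    expR (- (2 * s)) - expR (- (2 * r)) <= C * (`|p - q| + `|x - y| * (1 + `|p|)).
Proof.
move=> f0 aM MK0 HK /lipschitz_onP[L L0 HL].
have [[CF CF0 HF] _] := F_of_root aM.
have [CW CW0 HW] := sqrtW_lip f0 MK0.
set J := intensity M I IA in HL *.
have [[z Kz]|K0] := pselect (exists z, K z); last first.
  by exists 0 => // x y r s p q Kx; case: K0; exists x.
pose JM := `|J z| + L * (2 * MK).
have JM0 : 0 <= JM by rewrite addr_ge0// !mulr_ge0.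
have HJ x : K x -> `|J x| <= JM.
  move=> Kx; have := ler_normD (J x - J z) (J z); rewrite subrK /JM.
  have := HL x z Kx Kz; have := ler_normB x z; have := HK x Kx; have := HK z Kz => *.
  have : L * `|x - z| <= L * (2 * MK) by rewrite ler_wpM2l//; lra.
  lra.
pose F0 := `|F_of M 0|.
have F00 : 0 <= F0 := normr_ge0 _.
have f20 : 0 < f ^+ 2 by rewrite exprn_gt0.
exists (f ^+ 2 * (JM * (CF * CW) + L * (F0 + CF * CW))).
  by rewrite mulr_ge0 ?(ltW f20)// addr_ge0// !mulr_ge0// addr_ge0// mulr_ge0.
move=> x y r s p q Kx Ky; rewrite /hamiltonian -/J => h1 h2.
set P := `|p - q| + `|x - y| * (1 + `|p|).
have P1 : 0 <= `|p - q| := normr_ge0 _.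
have d0 : 0 <= `|x - y| := normr_ge0 _.
have p0 : 0 <= `|p| := normr_ge0 _.
have P0 : 0 <= P by rewrite addr_ge0// mulr_ge0// addr_ge0.
have Wx := W_ge0 f0 x p; have Wy := W_ge0 f0 y q; have W0 := W_ge0 f0 x 0.
set Fx := F_of M (W f x p) in h1 *; set Fy := F_of M (W f y q) in h2 *.
have FF : `|Fy - Fx| <= CF * (CW * P).
  rewrite distrC; apply: (le_trans (HF _ _ Wx Wy)); rewrite ler_wpM2l//.
  exact: HW (HK x Kx) (HK y Ky).
have W00 : W f x 0 = 0.
  by rewrite /W !dotv0l expr0n/= mulr0 addr0 mul0r.
have FX : `|Fx| <= F0 + CF * CW * `|p|.
  have := HF _ _ Wx W0; rewrite W00 => H1.
  have := HW x x p 0 (HK x Kx) (HK x Kx); rewrite W00 subrr normr0 mul0r addr0 subr0 => H2.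
  have H3 : CF * `|Num.sqrt (W f x p + 1) - Num.sqrt (0 + 1)| <= CF * (CW * `|p|) by rewrite ler_wpM2l.
  have := ler_normD (Fx - F_of M 0) (F_of M 0); rewrite subrK -/F0.
  by move: H1; rewrite -/Fx; lra.
have key : f ^+ 2 * (J y * Fy - J x * Fx) <= f ^+ 2 * ((JM * (CF * CW) + L * (F0 + CF * CW)) * P).
  rewrite ler_pM2l//.
  have -> : J y * Fy - J x * Fx = J y * (Fy - Fx) + (J y - J x) * Fx by ring.
  have T1 : `|J y * (Fy - Fx)| <= JM * (CF * (CW * P)) by rewrite normrM ler_pM// HJ.
  have T2 : `|(J y - J x) * Fx| <= (L * `|x - y|) * (F0 + CF * CW * `|p|).
    by rewrite normrM ler_pM// distrC; exact: HL.
  have T3 : `|x - y| * (F0 + CF * CW * `|p|) <= (F0 + CF * CW) * P.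
    have Y1 : 0 <= F0 * `|p - q| by rewrite mulr_ge0.
    have Y2 : 0 <= CF * CW * `|p - q| by rewrite !mulr_ge0.
    have Y3 : 0 <= F0 * (`|x - y| * `|p|) by rewrite !mulr_ge0.
    have Y4 : 0 <= CF * CW * `|x - y| by rewrite !mulr_ge0.
    rewrite /P; lra.
  have T4 : L * (`|x - y| * (F0 + CF * CW * `|p|)) <= L * ((F0 + CF * CW) * P) by rewrite ler_wpM2l.
  have := ler_norm (J y * (Fy - Fx)); have := ler_norm ((J y - J x) * Fx); lra.
lra.
Qed.

(** Near the boundary the intensity is at least delta and the reflectance at least a
    multiple of [sqrt (W + 1)], hence of [|p|]. *)
Lemma hamiltonian_coercive (R : realType) (Omega : set 'rV[R]_2) (f : R) (I IA : 'rV[R]_2 -> R) (M : reflectance R) :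
  0 < f -> admissible M -> ~~ is_oren_nayar M -> intensity_assumption Omega (intensity M I IA) ->
  exists2 c : R, 0 < c & forall x0, frontier Omega x0 -> exists2 rho : R, 0 < rho &
    forall x r p, closure Omega x -> `|x - x0| < rho ->
      hamiltonian f I IA M x r p <= 0 -> c * `|p| <= expR (- (2 * r)).
Proof.
move=> f0 aM nM [_ [delta [Gamma [d0 nG HG]]]].
have [_ /(_ nM)[c c0 Hc]] := F_of_root aM.
have f20 : 0 < f ^+ 2 by rewrite exprn_gt0.
exists (delta * f ^+ 2 * (c * f)); first by rewrite !mulr_gt0.
move=> x0 /nG /(@nbhs_normP R 'rV[R]_2)[rho /= rho0 Hrho]; exists rho => // x r p clx xr.
rewrite /hamiltonian => h.
have Jd : delta <= intensity M I IA x by apply: HG => //; apply: Hrho => /=; rewrite distrC.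
have F1 := Hc _ (W_ge0 f0 x p).
have F2 := sqrtW_ge f0 x p.
have F3 : c * (f * `|p|) <= F_of M (W f x p) by apply: le_trans F1; rewrite ler_pM2l.
have F40 : 0 <= c * (f * `|p|) by rewrite !mulr_ge0// ltW.
have F4 : delta * f ^+ 2 * (c * (f * `|p|)) <= intensity M I IA x * f ^+ 2 * F_of M (W f x p).
  apply: ler_pM => //; first by rewrite mulr_ge0// ltW.
  by rewrite ler_pM2r.
by rewrite -mulrA -(mulrA c); lra.
Qed.

(** By convexity, since [expR (- 2 r)] has slope at most [- 2 expR (- 2 M)] below M. *)
Lemma expR_gap (R : realType) (r s M d : R) : r <= M -> d <= r - s -> 0 <= d ->
  2 * expR (- (2 * M)) * d <= expR (- (2 * s)) - expR (- (2 * r)).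
Proof.
move=> rM drs d0.
have -> : - (2 * s) = - (2 * r) + 2 * (r - s) by ring.
rewrite expRD.
have e0 := expR_gt0 (- (2 * r)).
have e1 : 1 + 2 * (r - s) <= expR (2 * (r - s)) by exact: expR_ge1Dx.
have e2 : expR (- (2 * M)) <= expR (- (2 * r)) by rewrite ler_expR; lra.
have e3 : expR (- (2 * M)) * d <= expR (- (2 * r)) * (r - s) by rewrite ler_pM// expR_ge0.
have e4 : expR (- (2 * r)) * (1 + 2 * (r - s)) <= expR (- (2 * r)) * expR (2 * (r - s)).
  by rewrite ler_pM2l.
by lra.
Qed.

Section Contradiction.
Context {R : realType} {K : set 'rV[R]_2} {H : 'rV[R]_2 -> R -> 'rV[R]_2 -> R}
  {u v : 'rV[R]_2 -> R}.

(** The strict increase of [r |-> - expR (- 2 r)] on bounded sets beats any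
    vanishing modulus. *)
Lemma no_gap (C M m C2 beta0 : R) :
  0 <= C -> 0 <= C2 -> 0 < m -> 0 < beta0 ->
  (forall x y r s p q, K x -> K y -> H x r p <= 0 -> 0 <= H y s q ->
    expR (- (2 * s)) - expR (- (2 * r)) <= C * (`|p - q| + `|x - y| * (1 + `|p|))) ->
  (forall x, K x -> u x <= M) ->
  ~ (forall beta : R, 0 < beta <= beta0 -> exists x y p q,
      [/\ K x /\ K y, H x (u x) p <= 0, 0 <= H y (v y) q, m - 21 * beta <= u x - v y &
          `|p - q| + `|x - y| * (1 + `|p|) <= C2 * beta]).
Proof.
move=> C0 C20 m0 b0 HC uM Hb.
have k0 := expR_gt0 (- (2 * M)).
set k := expR (- (2 * M)) in k0.
pose beta := Num.min beta0 (Num.min (m / 42) (k * m / (2 * (C * C2 + 1)))).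
have CC : 0 <= C * C2 by rewrite mulr_ge0.
have beta_gt0 : 0 < beta.
  by rewrite !lt_min b0/= !divr_gt0// ?mulr_gt0//; lra.
have [b1 b2 b3] : [/\ beta <= beta0, beta <= m / 42 & beta <= k * m / (2 * (C * C2 + 1))].
  by split; rewrite !ge_min lexx ?orbT.
have [x [y [p [q [[Kx Ky] h1 h2 uv P]]]]] := Hb beta ltac:(by rewrite beta_gt0 b1).
have G := HC x y (u x) (v y) p q Kx Ky h1 h2.
have d0 : m / 2 <= u x - v y by lra.
have G2 := expR_gap (uM x Kx) d0 ltac:(lra).
have CP : C * (`|p - q| + `|x - y| * (1 + `|p|)) <= C * (C2 * beta) by rewrite ler_wpM2l.
move: b3; rewrite ler_pdivlMr ?mulr_gt0//; last lra.
rewrite -/k in G2; nra.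
Qed.

(** The gradients differ by [2 b] and the localising term, both of order beta, and
    [|p|] is of order [beta / eps] while [|x - y|] is of order eps. *)
Lemma doubling_bounds (xi a b xh x y : 'rV[R]_2) (kap beta eps : R) :
  1 <= kap -> 0 < beta <= 1 -> 0 < eps < beta -> `|b| <= beta ->
  kap * dotv (x - y - eps *: xi) (x - y - eps *: xi) <= 9 * beta ^+ 2 * eps ^+ 2 ->
  kap ^+ 2 * dotv (y - xh) (y - xh) <= 18 * beta ^+ 2 ->
  forall p0 p q, p0 = (2 * eps^-2) *: (x - y - eps *: xi) ->
  p = p0 + a + b -> q = p0 + a - b - (2 * kap) *: (y - xh) ->
  `|p - q| + `|x - y| * (1 + `|p|) <= (12 + (`|xi| + 3) * (8 + `|a|)) * beta.
Proof.
move=> kap1 /andP[b0 b1] /andP[e0 eb] bb h1 h2 p0 p q.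
set w := x - y - eps *: xi in h1 * => p0E pE qE.
have ww : `|w| <= 3 * beta * eps.
  have c0 : 0 <= 3 * beta * eps by rewrite !mulr_ge0// ltW.
  rewrite -(ler_pXn2r (n := 2)) ?nnegrE//.
  apply: (le_trans (dotvv_ge_norm w)).
  have := dotvv_ge0 w; rewrite !exprMn; nra.
have yx : kap * `|y - xh| <= 5 * beta.
  have c0 : 0 <= kap * `|y - xh| by rewrite mulr_ge0//; lra.
  have c1 : 0 <= 5 * beta by lra.
  rewrite -(ler_pXn2r (n := 2)) ?nnegrE//.
  rewrite exprMn; have := dotvv_ge_norm (y - xh) => D.
  have : kap ^+ 2 * `|y - xh| ^+ 2 <= kap ^+ 2 * dotv (y - xh) (y - xh) by rewrite ler_wpM2l// sqr_ge0.
  by rewrite [(5 * _) ^+ 2]exprMn; have := sqr_ge0 beta; lra.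
have pq : `|p - q| <= 12 * beta.
  have -> : p - q = 2 *: b + (2 * kap) *: (y - xh).
    by rewrite pE qE; apply/rowP => i; rewrite !mxE; ring.
  apply: (le_trans (ler_normD _ _)); rewrite !normrZ (ger0_norm (_ : 0 <= 2)) // ger0_norm; last by lra.
  lra.
have xy : `|x - y| <= (`|xi| + 3) * eps.
  have -> : x - y = w + eps *: xi by rewrite /w subrK.
  apply: (le_trans (ler_normD _ _)); rewrite normrZ (gtr0_norm e0).
  by nra.
have np0 : `|p0| * eps <= 6 * beta.
  rewrite p0E normrZ ger0_norm; last by rewrite mulr_ge0// invr_ge0 exprn_ge0// ltW.
  have -> : 2 * eps^-2 * `|w| * eps = 2 * (`|w| / eps) by field; rewrite gt_eqF.
  have : `|w| / eps <= 3 * beta by rewrite ler_pdivrMr.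
  by lra.
have np : `|p| <= `|p0| + `|a| + beta.
  by rewrite pE; apply: (le_trans (ler_normD _ _)); have := ler_normD p0 a; lra.
have a0 := normr_ge0 a; have xi0 := normr_ge0 xi; have P0 := normr_ge0 p0.
have step : `|x - y| * (1 + `|p|) <= (`|xi| + 3) * eps * (1 + (`|p0| + `|a| + beta)).
  by apply: ler_pM => //; rewrite ?addr_ge0// lerD2l.
have step2 : eps * (1 + (`|p0| + `|a| + beta)) <= (8 + `|a|) * beta by nra.
have : (`|xi| + 3) * (eps * (1 + (`|p0| + `|a| + beta))) <= (`|xi| + 3) * ((8 + `|a|) * beta).
  by rewrite ler_wpM2l//; lra.
by lra.
Qed.

End Contradiction.

Lemma sub_touch (R : realType) (Omega : set 'rV[R]_2) H bc u x p :
  viscosity_subsolution Omega H bc u -> touches_above (closure Omega) u x p ->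
  (Omega x -> H x (u x) p <= 0) /\
  (frontier Omega x -> (mine (H x (u x) p)%:E (boundary_operator Omega bc x (u x) p) <= 0)%E).
Proof.
move=> [_ Hs] [phi [D [sm <- lm]]].
by apply: (Hs phi D x (smooth_test_C1 _ sm) lm).
Qed.

Lemma super_touch (R : realType) (Omega : set 'rV[R]_2) H bc v y q :
  viscosity_supersolution Omega H bc v -> touches_below (closure Omega) v y q ->
  (Omega y -> 0 <= H y (v y) q) /\
  (frontier Omega y -> (0 <= maxe (H y (v y) q)%:E (boundary_operator Omega bc y (v y) q))%E).
Proof.
move=> [_ Hs] [phi [D [sm <- lm]]].
by apply: (Hs phi D y (smooth_test_C1 _ sm) lm).
Qed.

Lemma closure_open_or_frontier (R : realType) (Omega : set 'rV[R]_2) x : open Omega ->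
  closure Omega x -> Omega x \/ frontier Omega x.
Proof.
move=> oO clx; have [Ox|nOx] := pselect (Omega x); [by left|right].
by apply/open_frontierP.
Qed.

(** * Subsolutions of coercive equations near the boundary *)

Lemma tpow2_remainder (R : realType) (t k : R) :
  `|tpow 2 (t + k) - tpow 2 t - 2 * tpow 1 t * k| <= 1 * k ^+ 2.
Proof.
rewrite /tpow /Num.max.
rewrite ler_norml !expr1 !expr2; apply/andP; split; case: ifPn; case: ifPn; rewrite -?leNgt => *; nra.
Qed.

Definition rot {R : realType} (xi : 'rV[R]_2) : 'rV[R]_2 :=
  \row_(i < 2) (if i == 0 then - xi 0 1 else xi 0 0).

Lemma dotv_rot (R : realType) (xi : 'rV[R]_2) : dotv xi (rot xi) = 0.
Proof. by rewrite dotvE !mxE/=; ring. Qed.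

Lemma dotv_rot_unit (R : realType) (xi : 'rV[R]_2) : dotv (rot xi) (rot xi) = dotv xi xi.
Proof. by rewrite !dotvE !mxE/=; ring. Qed.

Lemma rot_decomp (R : realType) (xi v : 'rV[R]_2) : dotv xi xi = 1 ->
  v = dotv xi v *: xi + dotv (rot xi) v *: rot xi.
Proof.
rewrite dotvE => H; apply/rowP => i.
have : i = 0 \/ i = 1 by case: i => [[|[|m]] k]//; [left|right]; apply/val_inj.
case=> ->; rewrite !dotvE !mxE/=.
  transitivity ((xi 0 0 * xi 0 0 + xi 0 1 * xi 0 1) * v 0 0); first by rewrite H mul1r.
  by ring.
transitivity ((xi 0 0 * xi 0 0 + xi 0 1 * xi 0 1) * v 0 1); first by rewrite H mul1r.
by ring.
Qed.

Lemma usc_sub_continuous_max (R : realType) (K B : set 'rV[R]_2) (u phi : 'rV[R]_2 -> R) :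
  compact B -> B !=set0 -> B `<=` K -> usc_on K u -> continuous phi ->
  exists2 y, B y & forall y', B y' -> u y' - phi y' <= u y - phi y.
Proof.
move=> cB B0 BK uK cphi.
apply: (@usc_compact_max _ _ B (fun y => u y - phi y)) => // y By t ut.
have [e' e'0 tE] : exists2 e' : R, 0 < e' & t = u y - phi y + 2 * e'.
  exists ((t - (u y - phi y)) / 2); first by rewrite divr_gt0// subr_gt0.
  by field.
have [d1 d10 H1] := usc_onP uK (BK _ By) e'0.
have n1 : nbhs y [set y' | `|y' - y| < d1].
  by apply/(@nbhs_normP R 'rV[R]_2); exists d1 => //= y' /=; rewrite distrC.
have n2 : nbhs y [set y' | phi y - e' < phi y'].
  by apply: (cphi y [set t | phi y - e' < t]); apply: lt_nbhsr; rewrite ltrBlDr ltrDl.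
exists ([set y' | `|y' - y| < d1] `&` [set y' | phi y - e' < phi y']); first exact: filterI.
move=> y' [/= h1 h2] By'; have := H1 y' (BK _ By') h1.
by move: h2; rewrite tE; clear; lra.
Qed.

Lemma steep_gradient (R : realType) (n D : 'rV[R]_2) (c k r r0 : R) :
  dotv n n = 1 -> k <= dotv n D -> 0 < c -> c * `|D| <= expR (- (2 * r)) -> r0 <= r ->
  2 * expR (- (2 * r0)) < k * c -> False.
Proof.
move=> n1 kD c0 cD rr kc.
have D2 : dotv n D <= 2 * `|D|.
  apply: (le_trans (ler_norm _)); apply: (le_trans (normr_dotv_le _ _)).
  by apply: ler_wpM2r => //; rewrite ler_piMr// norm_unit.
have ex : expR (- (2 * r)) <= expR (- (2 * r0)) by rewrite ler_expR lerN2 ler_pM2l.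
have : k * c <= 2 * `|D| * c by rewrite ler_pM2r//; exact: le_trans D2.
by move: cD ex kc; clear; lra.
Qed.

(** A subsolution cannot decrease faster than the slope allowed by coercivity
    along an inward segment: the test function grows with that slope along the
    segment and is made large, smoothly, past its end and sideways, so that a
    violation produces an interior maximum with too steep a gradient. *)
Lemma directional_estimate (R : realType) (Omega : set 'rV[R]_2) H bc u (xh xi : 'rV[R]_2)
    (c rho b M : R) :
  open Omega -> compact (closure Omega) ->
  viscosity_subsolution Omega H bc u -> (forall x, closure Omega x -> u x <= M) ->
  dotv xi xi = 1 -> 0 < c -> 0 < rho ->
  (forall x r p, closure Omega x -> `|x - xh| < rho -> H x r p <= 0 -> c * `|p| <= expR (- (2 * r))) ->
  (forall y k, Omega y -> `|y - xh| < rho -> 0 < k < rho -> Omega (y + k *: xi)) ->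
  exists2 C : R, 0 < C & forall x h, Omega x -> `|x - xh| < rho / 4 -> b <= u x ->
    0 < h -> h < rho / 4 -> C * h <= 1 -> u x <= u (x + h *: xi) + C * h.
Proof.
move=> oO cK sub uM xi1 c0 rho0 coer cone.
pose P := expR (- (2 * (b - 1))) / c.
have P0 : 0 < P by rewrite divr_gt0// expR_gt0.
exists (2 * P + 1); first by lra.
set C := 2 * P + 1; have C0 : 0 < C by rewrite /C; lra.
move=> x h Ox xr bu h0 hr Ch.
set z := x + h *: xi.
have Oz : Omega z by apply: cone => //; [lra|rewrite h0; lra].
apply/ler_addgt0Pr => e e0.
rewrite leNgt; apply/negP => viol.
have K_z : closure Omega z by exact: subset_closure.
have K_x : closure Omega x by exact: subset_closure.
have [uK _] := sub.
have [d d0 Hd] := usc_onP uK K_z e0.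
have [r2 r20 Hr2] : exists2 r2 : R, 0 < r2 & forall y, `|y - x| < r2 -> Omega y.
  have /(@nbhs_normP R 'rV[R]_2)[r2 /= r20 Hr] : nbhs x Omega by exact: open_nbhs_nbhs.
  by exists r2 => // y yx; apply: Hr => /=; rewrite distrC.
pose a := Num.min (r2 / 4) (rho / 8).
have a0 : 0 < a by rewrite lt_min !divr_gt0.
have [a1 a2] : a <= r2 / 4 /\ a <= rho / 8 by rewrite !ge_min !lexx ?orbT.
have nxi := norm_unit xi1.
have nrot : `|rot xi| <= 1 by apply: norm_unit; rewrite dotv_rot_unit.
pose s y := dotv (- xi) y - dotv (- xi) z.
pose tau y := dotv (rot xi) y - dotv (rot xi) z.
have decomp y : y = x + (h - s y) *: xi + tau y *: rot xi.
  have -> : h - s y = h + dotv xi (y - z) by rewrite /s !dotvNl dotvBr; ring.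
  have -> : tau y = dotv (rot xi) (y - z) by rewrite /tau dotvBr.
  rewrite scalerDl addrA -/z -addrA -rot_decomp//.
  by rewrite addrC subrK.
have inO y : s y <= h + a -> 0 <= s y -> `|tau y| <= a -> Omega y /\ `|y - xh| < rho.
  move=> s1 s0 t1.
  pose k := Num.max 0 (h - s y); pose l := Num.min 0 (h - s y).
  have kl : k + l = h - s y by rewrite /k /l; case: (leP 0 (h - s y)) => _; rewrite ?addr0 ?add0r.
  have [k0 l0] : 0 <= k /\ - a <= l <= 0.
    by rewrite /k /l /Num.max /Num.min; clear - s1 a0; case: ifPn; rewrite -?leNgt => *; split; lra.
  have kh : k <= h by rewrite /k ge_max ltW//= lerBlDr lerDl.
  pose y' := x + l *: xi + tau y *: rot xi.
  have yE : y = y' + k *: xi.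
    by rewrite {1}(decomp y) -kl /y'; apply/rowP => i; rewrite !mxE; ring.
  have y'x : `|y' - x| <= 2 * a.
    have -> : y' - x = l *: xi + tau y *: rot xi by rewrite /y' -[x + _ + _]addrA addrAC subrr add0r.
    apply: (le_trans (ler_normD _ _)); rewrite !normrZ.
    have la : `|l| <= a.
      by case/andP: l0 => l1 l2; rewrite ler_norml l1 (le_trans l2)// ltW.
    rewrite mulr_natl mulr2n; apply: lerD.
      by apply: le_trans la; rewrite ler_piMr.
    by apply: le_trans t1; rewrite ler_piMr.
  have Oy' : Omega y'.
    by apply: Hr2; apply: (le_lt_trans y'x); move: a1 r20; clear; lra.
  have y'xh : `|y' - xh| < rho / 2.
    apply: (le_lt_trans (ler_distD x _ _)).
    by move: y'x xr a2 rho0; clear; lra.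
  split.
    have [k00|k00] := ltP 0 k; last first.
      by rewrite yE (_ : k = 0) ?scale0r ?addr0//; apply/eqP; rewrite eq_le k00.
    rewrite yE; apply: cone => //.
      by move: y'xh rho0; clear; lra.
    by rewrite k00 (le_lt_trans kh)// (lt_le_trans hr)//; move: rho0; clear; lra.
  rewrite yE addrAC; apply: (le_lt_trans (ler_normD _ _)); rewrite normrZ (ger0_norm k0).
  have kxi : k * `|xi| <= k by rewrite ler_piMr.
  by move: kxi y'xh kh hr rho0; clear; lra.
pose L' := (M - u x + 1) / a ^+ 2.
pose L := Num.max ((M - u z) / d ^+ 2) ((M - u x + C * h + 1) / a ^+ 2).
have a20 : 0 < a ^+ 2 by rewrite exprn_gt0.
have d20 : 0 < d ^+ 2 by rewrite exprn_gt0.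
have uxM := uM x K_x; have uzM := uM z K_z.
have L'0 : 0 <= L' by rewrite /L' divr_ge0// ?ltW//; lra.
have Lz : M - u z <= L * d ^+ 2 by rewrite -ler_pdivrMr// /L le_max lexx.
have Lx : M - u x + C * h + 1 <= L * a ^+ 2 by rewrite -ler_pdivrMr// /L le_max lexx orbT.
have Ch0 : 0 < C * h by rewrite mulr_gt0.
have L0 : 0 <= L.
  by apply: (@le_trans _ _ ((M - u z) / d ^+ 2)); [rewrite divr_ge0// ?ltW//; lra|rewrite /L le_max lexx].
have L'E : L' * a ^+ 2 = M - u x + 1 by rewrite divfK// gt_eqF.
pose phi y := C * s y + L' * tpow 2 (s y - h) + L * tau y ^+ 2.
pose D y := C *: (- xi) + (L' * (2 * tpow 1 (s y - h))) *: (- xi) + (L * (2 * tau y)) *: rot xi.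
have sphi : smooth_test phi D.
  have t1 := smooth_testZ C (smooth_testD (smooth_test_lin (- xi)) (smooth_test_cst (- dotv (- xi) z))).
  have ct : continuous (fun t : R => 2 * tpow 1 t).
    by move=> t; apply: cvgM; [exact: cvg_cst|exact: continuous_tpow1].
  have t2 := smooth_testZ L' (smooth_test_ridge (- xi) (dotv (- xi) z + h) ler01 ct (@tpow2_remainder R)).
  have cl : continuous (fun t : R => 2 * t).
    by move=> t; apply: cvgM; [exact: cvg_cst|exact: cvg_id].
  have sqrem (t k : R) : `|(t + k) ^+ 2 - t ^+ 2 - 2 * t * k| <= 1 * k ^+ 2.
    by rewrite (_ : _ - _ = k ^+ 2) ?mul1r ?ger0_norm ?sqr_ge0//; ring.
  have t3 := smooth_testZ L (smooth_test_ridge (rot xi) (dotv (rot xi) z) ler01 cl sqrem).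
  have := smooth_testD (smooth_testD t1 t2) t3.
  congr smooth_test; apply/funext => y.
    by rewrite /phi /s /tau; congr (_ + _ * tpow 2 _ + _); ring.
  rewrite /D /s /tau addr0; congr (_ + _ + _).
    by rewrite scalerA; congr (_ *: _); congr (_ * (_ * tpow 1 _)); ring.
  by rewrite scalerA.
have cphi (F : 'rV[R]_2 -> R) DF : smooth_test F DF -> continuous F.
  by move=> sF y; apply: differentiable_continuous; case: (smooth_test_differentiable y sF).
have cs : continuous s.
  apply: cphi (smooth_testD (smooth_test_lin (- xi)) (smooth_test_cst (- dotv (- xi) z))).
have ctau : continuous tau.
  apply: cphi (smooth_testD (smooth_test_lin (rot xi)) (smooth_test_cst (- dotv (rot xi) z))).
pose B := closure Omega `&` (s @^-1` [set t | t <= h + a]) `&` (s @^-1` [set t | 0 <= t])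
   `&` (tau @^-1` [set t | t <= a]) `&` (tau @^-1` [set t | - a <= t]).
have cB : compact B.
  apply: (subclosed_compact _ cK); last by move=> y [[[[]]]].
  have cle (F : 'rV[R]_2 -> R) k : continuous F -> closed (F @^-1` [set t | t <= k]).
    by move=> cF; apply: closed_comp; [move=> ? _; exact: cF|exact: closed_le].
  have cge (F : 'rV[R]_2 -> R) k : continuous F -> closed (F @^-1` [set t | k <= t]).
    by move=> cF; apply: closed_comp; [move=> ? _; exact: cF|exact: closed_ge].
  rewrite /B; apply: closedI; last exact: cge.
  apply: closedI; last exact: cle.
  apply: closedI; last exact: cge.
  by apply: closedI; [exact: closed_closure|exact: cle].
have sx : s x = h.
  by rewrite /s /z dotvDr dotvZr !dotvNl xi1; ring.
have tx : tau x = 0.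
  by rewrite /tau /z dotvDr dotvZr (dotvC (rot xi) xi) dotv_rot; ring.
have Bx : B x.
  by rewrite /B /= sx tx; do !split => //=; rewrite ?lerDl ?oppr_le0 ltW.
have [y [[[[Ky s1] s0] t1] t2] Max] : exists2 y, B y & forall y', B y' -> u y' - phi y' <= u y - phi y.
  by apply: usc_sub_continuous_max uK (cphi _ _ sphi) => //; [exists x|move=> y [[[[]]]]].
rewrite /= in s1 s0 t1 t2.
have T0 : 0 <= tpow 2 (s y - h) by rewrite /tpow sqr_ge0.
have LT0 : 0 <= L' * tpow 2 (s y - h) by rewrite mulr_ge0.
have Ltau : 0 <= L * tau y ^+ 2 by rewrite mulr_ge0// sqr_ge0.
have Cs0 : 0 <= C * s y by rewrite mulr_ge0// ltW.
have phi0 : 0 <= phi y by rewrite /phi; do 2 apply: addr_ge0 => //.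
have phix : phi x = C * h.
  by rewrite /phi sx tx subrr /tpow max_l// !expr0n/= !mulr0 !addr0.
have MaxX := Max x Bx; rewrite phix in MaxX.
have uyM := uM y Ky.
have [Oy yxh] := inO y s1 s0 ltac:(by rewrite ler_norml t1 t2).
have in1 : 0 < s y.
  rewrite lt_neqAle s0 andbT; apply/negP => /eqP sy0.
  have yz : y - z = tau y *: rot xi.
    by rewrite {1}(decomp y) -sy0 subr0 -/z addrAC subrr add0r.
  have [td|td] := ltP `|tau y| d.
    have : u y < u z + e.
      apply: Hd => //; rewrite yz normrZ.
      by apply: (le_lt_trans _ td); rewrite ler_piMr.
    by move: viol MaxX phi0; clear; lra.
  have : d ^+ 2 <= tau y ^+ 2 by rewrite -(real_normK (num_real (tau y))) ler_pXn2r ?nnegrE// ltW.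
  move=> dt; have this : L * d ^+ 2 <= L * tau y ^+ 2 by rewrite ler_wpM2l.
  rewrite /phi in MaxX; move: viol MaxX Cs0 LT0 this Lz uyM e0; clear.
  move: (C * h) (C * s y) (L' * _) (L * _ ^+ 2) (L * d ^+ 2) => *; lra.
have in2 : s y < h + a.
  rewrite lt_neqAle s1 andbT; apply/negP => /eqP sy.
  have E : tpow 2 (s y - h) = a ^+ 2.
    by rewrite sy (_ : h + a - h = a); [rewrite tpow_pos// ltW|ring].
  rewrite /phi E L'E in MaxX.
  have Csh : C * h <= C * s y by rewrite ler_pM2l// sy lerDl ltW.
  move: MaxX Csh Ltau uyM; clear; move: (C * h) (C * s y) (L * _ ^+ 2) => *; lra.
have edge : tau y ^+ 2 = a ^+ 2 -> False.
  move=> E; rewrite /phi E in MaxX; move: MaxX Cs0 LT0 Lx uyM; clear.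
  move: (C * h) (C * s y) (L' * _) (L * _ ^+ 2) => *; lra.
have in3 : tau y < a.
  by rewrite lt_neqAle t1 andbT; apply/negP => /eqP E; apply: edge; rewrite E.
have in4 : - a < tau y.
  by rewrite lt_neqAle t2 andbT; apply/negP => /eqP E; apply: edge; rewrite -E sqrrN.
have touch : touches_above (closure Omega) u y (D y).
  exists phi, D; split => //; split => //.
  have n1 : nbhs y [set y' | s y' < h + a] by apply: (cs y [set t | t < h + a]); exact: lt_nbhsl.
  have n2 : nbhs y [set y' | 0 < s y'] by apply: (cs y [set t | 0 < t]); exact: lt_nbhsr.
  have n3 : nbhs y [set y' | tau y' < a] by apply: (ctau y [set t | t < a]); exact: lt_nbhsl.
  have n4 : nbhs y [set y' | - a < tau y'] by apply: (ctau y [set t | - a < t]); exact: lt_nbhsr.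
  apply: filterS (filterI (filterI n1 n2) (filterI n3 n4)) => y' [[/= m1 m2] [m3 m4]] Ky'.
  by apply: Max; do !split => //=; exact: ltW.
have [/(_ Oy) Hy _] := sub_touch sub touch.
have coe := coer y (u y) (D y) Ky yxh Hy.
have Dxi : C <= dotv (- xi) (D y).
  rewrite /D !dotvDr !dotvZr dotvNN xi1 dotvNl dotv_rot.
  have t0 : 0 <= tpow 1 (s y - h) by rewrite /tpow expr1 le_max lexx.
  have t1' : 0 <= L' * (2 * tpow 1 (s y - h)) by apply: mulr_ge0 => //; apply: mulr_ge0.
  by rewrite oppr0 mulr0 addr0 !mulr1 lerDl.
have uy : b - 1 <= u y by move: MaxX phi0 bu Ch; clear; lra.
have Pc : P * c = expR (- (2 * (b - 1))) by rewrite divfK// gt_eqF.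
apply: (steep_gradient _ Dxi c0 coe uy); first by rewrite dotvNN.
by rewrite -Pc mulrA ltr_pM2r// /C ltrDl.
Qed.

Lemma continuous_dataP (R : realType) (A : set 'rV[R]_2) (g : 'rV[R]_2 -> R) :
  {within A, continuous g} -> forall x, A x -> forall e : R, 0 < e ->
  exists2 d : R, 0 < d & forall y, A y -> `|y - x| < d -> `|g y - g x| < e.
Proof.
move=> cg x Ax e e0.
have H := (@subspace_continuousP _ A _ g).1 cg x Ax.
have N : nbhs (g x) [set t | `|t - g x| < e].
  by apply/(@nbhs_normP R R^o); exists e => //= t /=; rewrite distrC.
have /(@nbhs_normP R 'rV[R]_2)[d /= d0 Hd] := H _ N.
by exists d => // y Ay yx; apply: Hd => //=; rewrite distrC.
Qed.

(** The test function falls with slope i away from xh in the outward direction and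
    rises quadratically, so u minus it is maximal near xh with a gradient too steep
    for the equation once i is large. Hence that maximum is on the boundary and the
    condition [u <= g] holds there; then i tends to infinity. *)
Lemma subsolution_le_data (R : realType) (Omega : set 'rV[R]_2) H g u (xh : 'rV[R]_2)
    (c rho M : R) :
  open Omega -> compact (closure Omega) -> W2infty_boundary Omega ->
  {within frontier Omega, continuous g} ->
  viscosity_subsolution Omega H (Dirichlet g) u -> (forall x, closure Omega x -> u x <= M) ->
  frontier Omega xh -> 0 < c -> 0 < rho ->
  (forall x r p, closure Omega x -> `|x - xh| < rho -> H x r p <= 0 -> c * `|p| <= expR (- (2 * r))) ->
  u xh <= g xh.
Proof.
move=> oO cK reg cg sub uM fxh c0 rho0 coer.
have Kxh : closure Omega xh by case: ((open_frontierP _ oO).1 fxh).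
have [C [rho1 [C0 rho10 HN]]] := boundary_geometry oO reg fxh.
have [n1 _ HC] := HN xh fxh ltac:(by rewrite subrr normr0).
set n := outward_unit_normal Omega xh in n1 HC.
apply/ler_addgt0Pr => e e0.
have [dg dg0 Hg] := continuous_dataP cg fxh e0.
pose r := Num.min (Num.min (rho / 2) (rho1 / 2)) (dg / 2).
have r0 : 0 < r by rewrite !lt_min !divr_gt0.
have [[r1 r2] r3] : (r <= rho / 2 /\ r <= rho1 / 2) /\ r <= dg / 2.
  by split; [split|]; rewrite !ge_min lexx ?orbT.
pose osc := M - u xh.
have osc0 : 0 <= osc by rewrite subr_ge0 uM.
pose E := expR (- (2 * u xh)) / c.
have E0 : 0 < E by rewrite divr_gt0// expR_gt0.
have Ec : E * c = expR (- (2 * u xh)) by rewrite divfK// gt_eqF.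
have den0 : 0 < 2 * E + 4 * C * osc + 1.
  have p1 : 0 <= 4 * C * osc by rewrite !mulr_ge0.
  by move: p1 E0; clear; lra.
pose eps := Num.min (Num.min (2 * C + 1)^-1 (r / (2 * osc + 2))) (2 * E + 4 * C * osc + 1)^-1.
have C21 : 0 < 2 * C + 1 by lra.
have o22 : 0 < 2 * osc + 2 by lra.
have eps0 : 0 < eps by rewrite !lt_min !invr_gt0 C21 den0 divr_gt0.
have [[e1 e2] e3] : (eps <= (2 * C + 1)^-1 /\ eps <= r / (2 * osc + 2)) /\ eps <= (2 * E + 4 * C * osc + 1)^-1.
  by split; [split|]; rewrite !ge_min lexx ?orbT.
pose i := eps^-1.
have i0 : 0 < i by rewrite invr_gt0.
have ie : i * eps = 1 by rewrite mulVf// gt_eqF.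
have i1 : 2 * C + 1 <= i by rewrite -[X in X <= _]invrK lef_pV2 ?posrE// invr_gt0.
have i3 : 2 * E + 4 * C * osc + 1 <= i by rewrite -[X in X <= _]invrK lef_pV2 ?posrE// invr_gt0.
move: e2; rewrite ler_pdivlMr// => e2.
pose phi y := i ^+ 2 * dotv (y - xh) (y - xh) + (- i) * (dotv n y + (- dotv n xh)).
pose D y := i ^+ 2 *: (2 *: (y - xh)) + (- i) *: (n + 0).
have sphi : smooth_test phi D.
  apply: smooth_testD; first exact: smooth_testZ (smooth_test_dist _).
  exact: smooth_testZ (smooth_testD (smooth_test_lin n) (smooth_test_cst _)).
have cphi : continuous phi.
  by move=> y; apply: differentiable_continuous; case: (smooth_test_differentiable y sphi).
pose B := closure Omega `&` ((fun y => dotv (y - xh) (y - xh)) @^-1` [set t | t <= r ^+ 2]).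
have cdist : continuous (fun y : 'rV[R]_2 => dotv (y - xh) (y - xh)).
  by move=> y; apply: differentiable_continuous; case: (smooth_test_differentiable y (smooth_test_dist xh)).
have cB : compact B.
  apply: (subclosed_compact _ cK); last by move=> y [].
  by apply: closedI; [exact: closed_closure|apply: closed_comp; [move=> y _; exact: cdist|exact: closed_le]].
have Bxh : B xh by split => //=; rewrite subrr dotv0l sqr_ge0.
have [uK _] := sub.
have [y [Ky yr] Max] : exists2 y, B y & forall y', B y' -> u y' - phi y' <= u y - phi y.
  by apply: usc_sub_continuous_max uK cphi => //; [exists xh|move=> y []].
rewrite /= in yr.
have nyr : `|y - xh| <= r.
  rewrite -(ler_pXn2r (n := 2)) ?nnegrE//; last exact: ltW.
  exact: le_trans (dotvv_ge_norm _) yr.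
have := Max xh Bxh; rewrite /phi !subrr dotv0l mulr0 add0r mulr0 subr0 -dotvBr => MaxX.
have yrho1 : `|y - xh| < rho1 by move: nyr r2 rho10; clear; lra.
have HCy := HC y Ky yrho1.
have yy := dotvv_ge0 (y - xh).
rewrite (dotvC n) in MaxX.
set dd := dotv (y - xh) (y - xh) in yr MaxX HCy yy; set dn := dotv (y - xh) n in MaxX HCy.
have Cd0 : 0 <= C * dd by rewrite mulr_ge0.
have key : i * dn <= i ^+ 2 * dd / 2.
  have k1 : i * dn <= i * (C * dd) by rewrite ler_pM2l.
  have k2 : C * dd <= i / 2 * dd by rewrite ler_wpM2r//; move: i1; clear; lra.
  have k3 : i * (C * dd) <= i * (i / 2 * dd) by rewrite ler_pM2l.
  by move: k1 k3; clear; lra.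
have uxy : u xh <= u y.
  have p1 : 0 <= i ^+ 2 * dd by rewrite mulr_ge0// sqr_ge0.
  by move: MaxX key p1; clear; lra.
have d_osc : i ^+ 2 * dd <= 2 * osc.
  by have := uM y Ky; move: MaxX key; rewrite /osc; clear; lra.
have ddE : dd <= 2 * osc * eps ^+ 2.
  have -> : dd = i ^+ 2 * dd * eps ^+ 2 by rewrite mulrAC -exprMn ie expr1n mul1r.
  by rewrite ler_wpM2r// sqr_ge0.
have str : dd < r ^+ 2.
  apply: (le_lt_trans ddE).
  have h1 : eps * (2 * osc + 2) * (eps * (2 * osc + 2)) <= r * r.
    by apply: ler_pM => //; rewrite mulr_ge0// ltW.
  have h2 : 0 < eps ^+ 2 by rewrite exprn_gt0.
  have h3 : 2 * osc * eps ^+ 2 < (2 * osc + 2) ^+ 2 * eps ^+ 2 by rewrite ltr_pM2r//; move: osc0; clear; nra.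
  by apply: (lt_le_trans h3); move: h1; clear; lra.
have touch : touches_above (closure Omega) u y (D y).
  exists phi, D; split => //; split => //.
  have m1 : nbhs y [set y' | dotv (y' - xh) (y' - xh) < r ^+ 2] by exact: nbhs_dotv_lt.
  apply: filterS m1 => y' /= h Ky'.
  by apply: Max; split => //=; exact: ltW.
have Hpos : H y (u y) (D y) <= 0 -> False.
  have yrho : `|y - xh| < rho by move: nyr r1 rho0; clear; lra.
  move=> /(coer y (u y) (D y) Ky yrho) coe.
  have Dn : i - 4 * C * osc <= dotv (- n) (D y).
    rewrite /D addr0 dotvDr !dotvZr dotvNl dotvNl (dotvC n) -/dn n1.
    have : i ^+ 2 * dn <= C * (2 * osc).
      apply: (@le_trans _ _ (C * (i ^+ 2 * dd))); last by rewrite ler_wpM2l.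
      by rewrite mulrCA ler_wpM2l// sqr_ge0.
    by clear; lra.
  apply: (steep_gradient _ Dn c0 coe uxy); first by rewrite dotvNN.
  by rewrite -Ec mulrA ltr_pM2r//; move: i3; clear; lra.
have [SO Sf] := sub_touch sub touch.
have [Oy|fy] := closure_open_or_frontier oO Ky.
  by exfalso; exact: (Hpos (SO Oy)).
have := Sf fy; rewrite ge_min => /orP[].
  by rewrite lee_fin => Hy; exfalso; exact: (Hpos Hy).
rewrite /= lee_fin => ug.
have ydg : `|y - xh| < dg by move: nyr r3 dg0; clear; lra.
have := ler_norm (g y - g xh); have := Hg y fy ydg; move: uxy ug; clear; lra.
Qed.

(** * Comparison *)

Lemma sup_attained (R : realType) (K A : set 'rV[R]_2) (u v : 'rV[R]_2 -> R) (m : R) (xh : 'rV[R]_2) :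
  A `<=` K -> usc_on K u -> lsc_on K v -> K xh ->
  (forall t d : R, 0 < t -> 0 < d -> exists x y, [/\ A x, K y, `|x - xh| < d, `|y - xh| < d &
      m - t < u x - v y]) ->
  m <= u xh - v xh.
Proof.
move=> AK uK vK Kx P2; apply/ler_addgt0Pr => e e0.
have e3 : 0 < e / 3 by rewrite divr_gt0.
have [d1 d10 H1] := usc_onP uK Kx e3; have [d2 d20 H2] := lsc_onP vK Kx e3.
have d0 : 0 < Num.min d1 d2 by rewrite lt_min d10.
have [x [y [Ax Ky]]] := P2 _ _ e3 d0; rewrite !lt_min => /andP[x1 _] /andP[_ y2] mm.
have := H1 x (AK _ Ax) x1; have := H2 y Ky y2; lra.
Qed.

(** The common core: doubling around xh contradicts the structure of the equation
    as soon as the parameters can be chosen so that the boundary conditions are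
    inactive at the doubled points. *)
Lemma comparison_step (R : realType) (K A : set 'rV[R]_2) (H : 'rV[R]_2 -> R -> 'rV[R]_2 -> R)
    (u v : 'rV[R]_2 -> R) (xh xi a : 'rV[R]_2) (m cc rho eps1 beta0 C M : R) :
  compact K -> closed K -> usc_on K u -> lsc_on K v -> K xh ->
  (forall t : R, 0 < t -> exists2 d : R, 0 < d & forall x y, A x -> K y -> `|x - y| < d ->
      u x - v y < m + t) ->
  0 < m -> 0 <= C ->
  (forall x y r s p q, K x -> K y -> H x r p <= 0 -> 0 <= H y s q ->
    expR (- (2 * s)) - expR (- (2 * r)) <= C * (`|p - q| + `|x - y| * (1 + `|p|))) ->
  (forall x, K x -> u x <= M) ->
  0 < cc -> 0 < rho -> 0 < eps1 -> 0 < beta0 <= 1 ->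
  (forall eps x y, 0 < eps < eps1 -> K x -> K y -> dotv (y - xh) (y - xh) <= rho ^+ 2 ->
     dotv (x - y - eps *: xi) (x - y - eps *: xi) <= (cc * eps) ^+ 2 -> A x) ->
  (forall t : R, 0 < t -> exists2 d : R, 0 < d & forall eps, 0 < eps < d ->
     K (xh + eps *: xi) /\ m - t < u (xh + eps *: xi) - v xh) ->
  (forall beta : R, 0 < beta <= beta0 -> exists kap t : R, exists b : 'rV[R]_2,
     [/\ 1 <= kap, 0 < t, `|b| <= beta, 9 * beta ^+ 2 < cc ^+ 2 * kap & 18 * beta ^+ 2 < rho ^+ 2 * kap] /\
     forall eps x y p0 p q, 0 < eps < t -> A x -> K x -> K y ->
       kap * dotv (x - y - eps *: xi) (x - y - eps *: xi) <= 9 * beta ^+ 2 * eps ^+ 2 ->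
       kap ^+ 2 * dotv (y - xh) (y - xh) <= 18 * beta ^+ 2 ->
       m - 21 * beta <= u x - v y ->
       p0 = (2 * eps^-2) *: (x - y - eps *: xi) ->
       p = p0 + a + b -> q = p0 + a - b - (2 * kap) *: (y - xh) ->
       touches_above K u x p -> touches_below K v y q ->
       H x (u x) p <= 0 /\ 0 <= H y (v y) q) ->
  False.
Proof.
move=> cK clK uK vK Kxh P1 m0 C0 HC uM cc0 rho0 e10 /andP[b0 b01] HA HL HB.
apply: (@no_gap R K H u v C M m (12 + (`|xi| + 3) * (8 + `|a|)) beta0) => //.
move=> beta /andP[beta_gt0 beta_le].
have [kap [t [b [[kap1 t0 bb small1 small2] Hpts]]]] := HB beta ltac:(by rewrite beta_gt0).
have tb0 : 0 < Num.min t beta by rewrite lt_min t0.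
have beta1 : 0 < beta <= 1 by rewrite beta_gt0 (le_trans beta_le b01).
have [eps [x [y [[/andP[e0 et] Ax Kx Ky] [h1 h2 h3 h4 h5]]]]] :=
  doubling cK clK uK vK Kxh a P1 cc0 rho0 kap1 beta1 e10 bb HA HL small1 small2 tb0.
move: et; rewrite lt_min => /andP[et eb].
have [Hx Hy] := Hpts eps x y _ _ _ ltac:(by rewrite e0 et) Ax Kx Ky h1 h2 h3 erefl erefl erefl h4 h5.
exists x, y; do 2 eexists; split; [by split|exact: Hx|exact: Hy|exact: h3|].
apply: (doubling_bounds kap1 beta1 _ bb h1 h2 erefl erefl erefl).
by rewrite e0 eb.
Qed.

Lemma norm_le_of_scaled (R : realType) (k b : R) (w : 'rV[R]_2) :
  1 <= k -> 0 <= b -> k ^+ 2 * dotv w w <= 18 * b ^+ 2 -> k * `|w| <= 5 * b.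
Proof.
move=> k1 b0 H.
have c0 : 0 <= k * `|w| by rewrite mulr_ge0//; lra.
have c1 : 0 <= 5 * b by lra.
rewrite -(ler_pXn2r (n := 2)) ?nnegrE// [(k * _) ^+ 2]exprMn [(5 * _) ^+ 2]exprMn.
have : k ^+ 2 * `|w| ^+ 2 <= k ^+ 2 * dotv w w by rewrite ler_wpM2l ?sqr_ge0// dotvv_ge_norm.
by have := sqr_ge0 b; lra.
Qed.

Lemma norm_le_of_gap (R : realType) (k b eps : R) (w : 'rV[R]_2) :
  1 <= k -> 0 <= b -> 0 <= eps -> k * dotv w w <= 9 * b ^+ 2 * eps ^+ 2 -> `|w| <= 3 * b * eps.
Proof.
move=> k1 b0 e0 H.
have c1 : 0 <= 3 * b * eps by rewrite !mulr_ge0.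
rewrite -(ler_pXn2r (n := 2)) ?nnegrE// !exprMn.
have := dotvv_ge_norm w; have := dotvv_ge0 w; nra.
Qed.

(** Hypotheses shared by the three possible locations of the maximum point. *)
Record comparison_data {R : realType} (Omega A : set 'rV[R]_2)
    (H : 'rV[R]_2 -> R -> 'rV[R]_2 -> R) (bc : boundary_condition R)
    (u v : 'rV[R]_2 -> R) (xh : 'rV[R]_2) (m C M : R) : Prop := ComparisonData {
  cd_open : open Omega;
  cd_compact : compact (closure Omega);
  cd_sub : viscosity_subsolution Omega H bc u;
  cd_super : viscosity_supersolution Omega H bc v;
  cd_m : 0 < m;
  cd_C : 0 <= C;
  cd_gap : forall x y r s p q, closure Omega x -> closure Omega y -> H x r p <= 0 -> 0 <= H y s q ->
    expR (- (2 * s)) - expR (- (2 * r)) <= C * (`|p - q| + `|x - y| * (1 + `|p|));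
  cd_above : forall x, closure Omega x -> u x <= M;
  cd_below : forall x, closure Omega x -> - M <= v x;
  cd_OA : Omega `<=` A;
  cd_AK : A `<=` closure Omega;
  cd_merge : forall t : R, 0 < t -> exists2 d : R, 0 < d &
    forall x y, A x -> closure Omega y -> `|x - y| < d -> u x - v y < m + t;
  cd_approx : forall t d : R, 0 < t -> 0 < d -> exists x y,
    [/\ A x, closure Omega y, `|x - xh| < d, `|y - xh| < d & m - t < u x - v y] }.

Lemma interior_case (R : realType) (Omega A : set 'rV[R]_2) H bc u v xh (m C M : R) :
  comparison_data Omega A H bc u v xh m C M -> Omega xh -> False.
Proof.
move=> D Oxh.
have oO := cd_open D; have sub := cd_sub D; have sup := cd_super D.
have Kxh : closure Omega xh by exact: subset_closure.
have [r r0 Hr] : exists2 r : R, 0 < r & forall y, `|y - xh| < r -> Omega y.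
  have /(@nbhs_normP R 'rV[R]_2)[r /= r0 Hr] : nbhs xh Omega by exact: open_nbhs_nbhs.
  by exists r => // y yx; apply: Hr => /=; rewrite distrC.
have mE := sup_attained (cd_AK D) sub.1 sup.1 Kxh (cd_approx D).
have near y : dotv (y - xh) (y - xh) <= (r / 2) ^+ 2 -> `|y - xh| <= r / 2.
  move=> h; rewrite -(ler_pXn2r (n := 2)) ?nnegrE//; last by lra.
  exact: le_trans (dotvv_ge_norm _) h.
apply: (@comparison_step R (closure Omega) Omega H u v xh 0 0 m 1 (r / 2) (r / 2)
  (Num.min (1 / 4) (r / 10)) C M) => //.
- exact: cd_compact D.
- exact: closed_closure.
- exact: sub.1.
- exact: sup.1.
- move=> t t0; have [d d0 Hd] := cd_merge D t0; exists d => // x y Ox; apply: Hd.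
  exact: (cd_OA D).
- exact: cd_m D.
- exact: cd_C D.
- exact: cd_gap D.
- exact: cd_above D.
- by lra.
- by lra.
- by apply/andP; split; [rewrite lt_min; apply/andP; split; lra|rewrite ge_min; apply/orP; left; lra].
- move=> eps x y /andP[e0 er] _ _ yr xyr; apply: Hr.
  have := near _ yr; rewrite scaler0 subr0 mul1r in xyr.
  have : `|x - y| <= eps.
    rewrite -(ler_pXn2r (n := 2)) ?nnegrE ?(ltW e0)//.
    exact: le_trans (dotvv_ge_norm _) xyr.
  by have := ler_distD y x xh; lra.
- move=> t t0; exists 1 => // eps _; rewrite scaler0 addr0; split => //; lra.
- move=> beta /andP[b0]; rewrite le_min => /andP[b1 b2].
  have s1 : beta ^+ 2 <= beta / 4 by nra.
  have s2 : beta ^+ 2 <= (r / 10) ^+ 2 by rewrite ler_pXn2r ?nnegrE//; lra.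
  exists 1, r, 0; split.
    split => //; first by rewrite normr0 ltW.
      by rewrite expr1n mulr1; lra.
    by rewrite mulr1; have : 0 < r ^+ 2 by [rewrite exprn_gt0]; lra.
  move=> eps x y p0 p q _ Ox Kx Ky _ yk _ _ _ _ tx ty.
  have Oy : Omega y.
    rewrite expr1n mul1r in yk; apply: Hr.
    have r2 : 0 < r ^+ 2 by rewrite exprn_gt0.
    by have := near y ltac:(lra); lra.
  by split; [exact: (sub_touch sub tx).1|exact: (super_touch sup ty).1].
Qed.

(** By uniform exterior tangency the quadratic penalties contribute to the normal
    derivatives only on the favourable side, up to errors small compared to beta.
    The linear term [g(xh) n] matches the data, and [beta n] tips the balance: the
    Neumann alternative fails at both points. *)
Lemma neumann_case (R : realType) (Omega : set 'rV[R]_2) H g u v xh (m C M : R) :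
  W2infty_boundary Omega -> {within frontier Omega, continuous g} ->
  comparison_data Omega (closure Omega) H (Neumann g) u v xh m C M -> frontier Omega xh -> False.
Proof.
move=> reg cg D fxh.
have oO := cd_open D; have sub := cd_sub D; have sup := cd_super D.
have Kxh : closure Omega xh by case: ((open_frontierP _ oO).1 fxh).
have mE := sup_attained (cd_AK D) sub.1 sup.1 Kxh (cd_approx D).
have [Cg [rho1 [Cg0 rho10 HN]]] := boundary_geometry oO reg fxh.
set N := outward_unit_normal Omega in HN.
have [n1 _ _] := HN xh fxh ltac:(by rewrite subrr normr0).
have nn := norm_unit n1.
pose G := g xh.
apply: (@comparison_step R (closure Omega) (closure Omega) H u v xh 0 (G *: N xh) m 1 1 1 (1 / 5) C M) => //.
- exact: cd_compact D.
- exact: closed_closure.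
- exact: sub.1.
- exact: sup.1.
- exact: cd_merge D.
- exact: cd_m D.
- exact: cd_C D.
- exact: cd_gap D.
- exact: cd_above D.
- by apply/andP; split; lra.
- by move=> t t0; exists 1 => // eps _; rewrite scaler0 addr0; split => //; lra.
- move=> beta /andP[b0 b5].
  have b8 : 0 < beta / 8 by rewrite divr_gt0.
  have [dg dg0 Hg] := continuous_dataP cg fxh b8.
  pose d := Num.min (Num.min dg (rho1 / 2)) (beta / (8 * ((`|G| + 1) * Cg + 1))).
  have GC : 0 <= (`|G| + 1) * Cg by rewrite mulr_ge0// addr_ge0.
  have d0 : 0 < d by rewrite !lt_min dg0 !divr_gt0//; move: GC; clear; lra.
  have [[d1 d2] d3] : (d <= dg /\ d <= rho1 / 2) /\ d <= beta / (8 * ((`|G| + 1) * Cg + 1)).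
    by split; [split|]; rewrite !ge_min lexx ?orbT.
  move: d3; rewrite ler_pdivlMr; last by move: GC; clear; lra.
  have -> : d * (8 * ((`|G| + 1) * Cg + 1)) = 8 * (`|G| * (Cg * d) + Cg * d) + 8 * d by ring.
  move=> d3.
  have dr : d < rho1 by move: d2 rho10; clear; lra.
  have xzr (w z : 'rV[R]_2) : `|w - z| < d / 2 -> `|w - z| < rho1.
    by move=> wz; apply: (lt_trans wz); move: dr d0; clear; lra.
  (* [500 Cg <= kap] makes the tangency errors at most [beta / 100], and
     [20 <= kap d] puts x and y within d of xh *)
  pose kap := 1 + 500 * Cg + 20 / d.
  have d20 : 0 < 20 / d by rewrite divr_gt0.
  have kap1 : 1 <= kap by move: d20 Cg0; rewrite /kap; clear; lra.
  have kd : 20 <= kap * d.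
    have : 20 / d * d = 20 by rewrite divfK// gt_eqF.
    have : 0 <= Cg * d by rewrite mulr_ge0// ltW.
    have -> : kap * d = d + 500 * (Cg * d) + 20 / d * d by rewrite /kap; ring.
    move: d0; clear.
    by move: (Cg * d) (20 / d * d) => *; lra.
  have kC : 500 * Cg <= kap by move: d20 Cg0; rewrite /kap; clear; lra.
  have bb2 : beta ^+ 2 <= beta / 5 by move: b0 b5; clear; nra.
  exists kap, (d / 2), (beta *: N xh); split.
    split => //.
    - by rewrite divr_gt0.
    - by rewrite normrZ (gtr0_norm b0) ler_piMr// ltW.
    - by rewrite expr1n mul1r; move: kap1 b0 b5 bb2; clear; move: (beta ^+ 2) => *; lra.
    - by rewrite expr1n mul1r; move: kap1 b0 b5 bb2; clear; move: (beta ^+ 2) => *; lra.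
  move=> eps x y p0 p q /andP[e0 ed] _ Kx Ky; rewrite scaler0 subr0 => xyk yk _ p0E pE qE tx ty.
  have kyx : kap * `|y - xh| <= 5 * beta by apply: norm_le_of_scaled => //; exact: ltW.
  have yxd : `|y - xh| < d / 2.
    rewrite ltNge; apply/negP => dy.
    have : kap * (d / 2) <= kap * `|y - xh|.
      by rewrite ler_wpM2l// (le_trans ler01).
    by move: kyx kd b5; clear; move: (kap * `|_|) => *; lra.
  have xyd : `|x - y| < d / 2.
    have := norm_le_of_gap kap1 (ltW b0) (ltW e0) xyk.
    have : beta * eps <= 1 / 5 * eps by rewrite ler_pM2r.
    by move: ed e0; clear; lra.
  have xxd : `|x - xh| < d by have := ler_distD y x xh; move: xyd yxd; clear; lra.
  have yxd' : `|y - xh| < d by move: yxd d0; clear; lra.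
  have dxy : dotv (y - x) (y - x) = dotv (x - y) (x - y) by rewrite -(dotvNN (x - y)) opprB.
  have quad : eps^-2 * dotv (x - y) (x - y) * kap <= 9 * beta ^+ 2.
    have e2 : 0 < eps ^+ 2 by rewrite exprn_gt0.
    have -> : eps^-2 * dotv (x - y) (x - y) * kap = kap * dotv (x - y) (x - y) / eps ^+ 2 by ring.
    by rewrite ler_pdivrMr.
  set Z := eps^-2 * dotv (x - y) (x - y) in quad.
  have Z0 : 0 <= Z by rewrite mulr_ge0 ?dotvv_ge0// invr_ge0 exprn_ge0// ltW.
  have CZ : Cg * Z <= beta / 100.
    have : 500 * Cg * Z <= kap * Z by rewrite ler_wpM2r.
    by move: quad bb2 b0; rewrite mulrC; clear; move: (beta ^+ 2) => *; lra.
  pose T := dotv (y - xh) (y - xh).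
  have T0 : 0 <= T := dotvv_ge0 _.
  have CT : kap * (Cg * T) <= beta / 100.
    have : 500 * Cg * (kap * T) <= kap * (kap * T) by rewrite ler_wpM2r// mulr_ge0// (le_trans ler01).
    by rewrite expr2 -mulrA -/T in yk; move: yk bb2 b0; clear; move: T (beta ^+ 2) => *; lra.
  have bnd z : frontier Omega z -> `|z - xh| < d ->
     [/\ dotv (N z) (N z) = 1, `|g z - G| < beta / 8, 7 / 8 <= dotv (N z) (N xh) <= 1,
         `|G * dotv (N z) (N xh) - G| <= beta / 8 &
         forall w, closure Omega w -> `|w - z| < rho1 -> dotv (w - z) (N z) <= Cg * dotv (w - z) (w - z)].
    move=> fz zd; have [m1 /andP[m2 m3] m4] := HN z fz (lt_trans zd dr).
    have gz := Hg z fz (lt_le_trans zd d1).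
    have dd : Cg * `|z - xh| <= Cg * d by rewrite ler_wpM2l// ltW.
    have Gdd : `|G| * (Cg * `|z - xh|) <= `|G| * (Cg * d) by rewrite ler_wpM2l.
    have cgd : 0 <= Cg * d by rewrite mulr_ge0// ltW.
    have gcgd : 0 <= `|G| * (Cg * d) by rewrite mulr_ge0.
    split => //.
      by rewrite m3 andbT; move: m2 dd d3 d0 gcgd b5; clear; lra.
    rewrite -[X in _ - X]mulr1 -mulrBr normrM.
    have /(ler_wpM2l (normr_ge0 G)) : `|dotv (N z) (N xh) - 1| <= Cg * `|z - xh|.
      by rewrite ler0_norm ?subr_le0// opprB lerBlDr addrC -lerBlDr.
    move=> /le_trans; apply; apply: (le_trans Gdd).
    by move: d3 d0 cgd; clear; lra.
  have p0N z : dotv (N z) p0 = 2 * (eps^-2 * dotv (x - y) (N z)).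
    by rewrite p0E dotvZr (dotvC (N z)) mulrA.
  have e20 : 0 <= eps^-2 by rewrite invr_ge0 exprn_ge0// ltW.
  split.
  - have [Ox|fx] := closure_open_or_frontier oO Kx; first exact: (sub_touch sub tx).1.
    have := (sub_touch sub tx).2 fx; rewrite ge_min => /orP[]; first by rewrite lee_fin.
    have [_ m2 /andP[m3 m3'] m4 m5] := bnd x fx xxd.
    have tang := m5 y Ky ltac:(by rewrite distrC; exact: xzr).
    rewrite /= lee_fin -/N pE !dotvDr p0N !dotvZr => hb; exfalso.
    have hx : - (Cg * Z) <= eps^-2 * dotv (x - y) (N x).
      have -> : dotv (x - y) (N x) = - dotv (y - x) (N x) by rewrite -dotvNl opprB.
      rewrite mulrN lerN2 /Z mulrCA -dxy; exact: ler_wpM2l.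
    have hb2 : beta * (7 / 8) <= beta * dotv (N x) (N xh) by rewrite ler_pM2l.
    move: m2 m4; rewrite ltr_norml ler_norml => /andP[u1 u2] /andP[w1 w2].
    move: hb hx hb2 CZ b0 u1 u2 w1 w2; clear.
    move: (eps^-2 * _) (Cg * Z) (beta * dotv _ _) (G * dotv _ _) => *; lra.
  - have [Oy|fy] := closure_open_or_frontier oO Ky; first exact: (super_touch sup ty).1.
    have := (super_touch sup ty).2 fy; rewrite le_max => /orP[]; first by rewrite lee_fin.
    have [_ m2 /andP[m3 m3'] m4 m5] := bnd y fy yxd'.
    have tang := m5 x Kx (xzr _ _ xyd).
    have tang2 := m5 xh Kxh ltac:(by rewrite distrC; exact: xzr).
    rewrite /= lee_fin -/N qE !dotvBr dotvDr p0N !dotvZr => hb; exfalso.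
    have hx : eps^-2 * dotv (x - y) (N y) <= Cg * Z by rewrite /Z mulrCA; exact: ler_wpM2l.
    have hb2 : beta * (7 / 8) <= beta * dotv (N y) (N xh) by rewrite ler_pM2l.
    have hc : - (Cg * T) <= dotv (N y) (y - xh).
      have -> : dotv (N y) (y - xh) = - dotv (xh - y) (N y) by rewrite -dotvNl opprB dotvC.
      by rewrite lerN2 /T -(dotvNN (y - xh)) opprB.
    have hk : - (kap * (Cg * T)) <= kap * dotv (N y) (y - xh).
      by rewrite -mulrN ler_wpM2l// (le_trans ler01).
    move: m2 m4; rewrite ltr_norml ler_norml => /andP[u1 u2] /andP[w1 w2].
    clear -hb hx hb2 hk CZ CT b0 u1 u2 w1 w2; lra.
Qed.

(** The penalty is centred at [x - y = eps xi] with xi inward, which keeps x in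
    Omega whatever the behaviour of u on the boundary; the values of u along xi
    are controlled by [directional_estimate]. *)
Lemma coercive_case (R : realType) (Omega : set 'rV[R]_2) H bc u v xh (m c rho C M : R) :
  W2infty_boundary Omega ->
  0 < c -> 0 < rho ->
  (forall x r p, closure Omega x -> `|x - xh| < rho -> H x r p <= 0 -> c * `|p| <= expR (- (2 * r))) ->
  (exists2 d : R, 0 < d & forall x y q, Omega x -> frontier Omega y -> `|x - xh| < d -> `|y - xh| < d ->
     m / 2 <= u x - v y ->
     (0 <= maxe (H y (v y) q)%:E (boundary_operator Omega bc y (v y) q))%E -> 0 <= H y (v y) q) ->
  comparison_data Omega Omega H bc u v xh m C M -> frontier Omega xh -> False.
Proof.
move=> reg c0 rho0 coer [d d0 Hd] D fxh.
have oO := cd_open D; have sub := cd_sub D; have sup := cd_super D; have m0 := cd_m D.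
have Kxh : closure Omega xh by case: ((open_frontierP _ oO).1 fxh).
have [r [ O [gam ch]]] := reg xh fxh.
have [xi [cc [rhoc [xi1 cc0 rhoc0 cone]]]] := chart_cone oO ch.
pose r1 := Num.min rho rhoc.
have r10 : 0 < r1 by rewrite lt_min rho0.
have [r1a r1b] : r1 <= rho /\ r1 <= rhoc by rewrite !ge_min !lexx ?orbT.
have cone' y k : closure Omega y -> `|y - xh| < r1 -> 0 < k < r1 -> Omega (y + k *: xi).
  move=> Ky yr /andP[k0 kr]; apply: (cone _ y k Ky) => //; first lra.
    by rewrite k0; lra.
  have -> : y + k *: xi - y - k *: xi = 0 by rewrite [y + _]addrC addrK subrr.
  by rewrite dotv0l sqr_ge0.
have [Cd Cd0 dir] := @directional_estimate R Omega H bc u xh xi c r1 (- M - 1) M oO (cd_compact D) sub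
  (cd_above D) xi1 c0 r10 (fun x r p Kx xr => coer x r p Kx (lt_le_trans xr r1a))
  (fun y k Oy => cone' y k (@subset_closure _ Omega y Oy)).
have nxi := norm_unit xi1.
have HL (t : R) : 0 < t -> exists2 d : R, 0 < d & forall eps, 0 < eps < d ->
     closure Omega (xh + eps *: xi) /\ m - t < u (xh + eps *: xi) - v xh.
  move=> t0.
  pose h0 := Num.min (Num.min (r1 / 4) (1 / Cd)) (t / (4 * Cd)).
  exists h0; first by rewrite !lt_min !divr_gt0// mulr_gt0.
  move=> h /andP[hp]; rewrite !lt_min => /andP[/andP[h1 h2] h3].
  have Oz : Omega (xh + h *: xi) by apply: cone' => //; [rewrite subrr normr0|rewrite hp; lra].
  split; first exact: subset_closure.
  have t1 : 0 < Num.min (t / 8) 1 by rewrite lt_min ltr01 divr_gt0.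
  pose t' := Num.min (t / 8) 1; rewrite -/t' in t1.
  have [t'1 t'2] : t' <= t / 8 /\ t' <= 1 by rewrite !ge_min !lexx ?orbT.
  have [d1 d10 H1] := usc_onP sub.1 (@subset_closure _ Omega _ Oz) t1.
  have [d2 d20 H2] := lsc_onP sup.1 Kxh t1.
  have dm : 0 < Num.min (Num.min d1 d2) (r1 / 4) by rewrite !lt_min d10 d20 divr_gt0.
  have [x [y [Ox Ky]]] := cd_approx D t1 dm.
  rewrite !lt_min => /andP[/andP[x1 _] x2] /andP[/andP[_ y2] _] mm.
  have vy := cd_below D Ky.
  have bu : - M - 1 <= u x by lra.
  have Ch : Cd * h <= 1 by move: h2; rewrite ltr_pdivlMr// mulrC => /ltW.
  have Ch4 : Cd * h <= t / 4.
    by move: h3; rewrite ltr_pdivlMr ?mulr_gt0// => ?; lra.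
  have U1 := dir x h Ox x2 bu hp h1 Ch.
  have Oxh : Omega (x + h *: xi).
    by apply: cone'; [exact: subset_closure|lra|rewrite hp; lra].
  have U2 := H1 (x + h *: xi) (@subset_closure _ Omega _ Oxh).
  rewrite opprD addrACA subrr addr0 in U2.
  have := U2 x1; have := H2 y Ky y2; lra.
pose dd := Num.min d r1.
have dd0 : 0 < dd by rewrite lt_min d0.
have dd1 : dd <= d by rewrite ge_min lexx.
have dd2 : dd <= r1 by rewrite ge_min lexx orbT.
pose beta0 := Num.min (Num.min (1 / 4) (m / 42)) (Num.min (cc / 4) (dd / 20)).
apply: (@comparison_step R (closure Omega) Omega H u v xh xi 0 m cc (dd / 2) (dd / 2) beta0 C M) => //.
- exact: cd_compact D.
- exact: closed_closure.
- exact: sub.1.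
- exact: sup.1.
- exact: cd_merge D.
- exact: cd_C D.
- exact: cd_gap D.
- exact: cd_above D.
- by lra.
- by lra.
- apply/andP; split; first by rewrite !lt_min !divr_gt0.
  by rewrite !ge_min; apply/orP; left; apply/orP; left; lra.
- move=> eps x y /andP[e0 er] _ Ky yr xyr; apply: (cone x y eps) => //.
    have : `|y - xh| <= dd / 2.
      rewrite -(ler_pXn2r (n := 2)) ?nnegrE//; last by lra.
      exact: le_trans (dotvv_ge_norm _) yr.
    by lra.
  by rewrite e0; lra.
- move=> beta /andP[b0]; rewrite !le_min => /andP[/andP[b1 b2] /andP[b3 b4]].
  have sq1 : beta ^+ 2 <= (cc / 4) ^+ 2 by rewrite ler_pXn2r ?nnegrE//; lra.
  have sq2 : beta ^+ 2 <= (dd / 20) ^+ 2 by rewrite ler_pXn2r ?nnegrE//; lra.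
  have cc2 : 0 < cc ^+ 2 by rewrite exprn_gt0.
  have dd22 : 0 < dd ^+ 2 by rewrite exprn_gt0.
  exists 1, (dd / 8), 0; split.
    split => //; [by rewrite divr_gt0|by rewrite normr0 ltW| |]; by rewrite mulr1; lra.
  move=> eps x y p0 p q /andP[e0 ed] Ox Kx Ky xyk yk mb _ _ _ tx ty.
  split; first exact: (sub_touch sub tx).1.
  have [Oy|fy] := closure_open_or_frontier oO Ky; first exact: (super_touch sup ty).1.
  have ky : 1 * `|y - xh| <= 5 * beta by apply: norm_le_of_scaled => //; exact: ltW.
  rewrite mul1r in ky.
  have kw := norm_le_of_gap (lexx 1) (ltW b0) (ltW e0) xyk.
  have be : beta * eps <= eps / 4 by nra.
  have xy : `|x - y| <= 2 * eps.
    rewrite -(subrK (eps *: xi) (x - y)); apply: (le_trans (ler_normD _ _)).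
    rewrite normrZ (gtr0_norm e0); nra.
  apply: (Hd x y q Ox fy) => //.
  - by have := ler_distD y x xh; lra.
  - by lra.
  - by lra.
  - exact: (super_touch sup ty).2.
Qed.

Lemma semicontinuous_bounds (R : realType) (K : set 'rV[R]_2) (u v : 'rV[R]_2 -> R) :
  compact K -> K !=set0 -> usc_on K u -> lsc_on K v ->
  exists M : R, forall x, K x -> u x <= M /\ - M <= v x.
Proof.
move=> cK K0 uK vK.
have vK' : usc_on K (fun x => - v x).
  rewrite /usc_on; have -> : (fun x => - - v x) = v by apply/funext => x; rewrite opprK.
  exact: vK.
have [x1 _ H1] := usc_on_compact_max cK K0 uK.
have [x2 _ H2] := usc_on_compact_max cK K0 vK'.
exists (Num.max (u x1) (- v x2)) => x Kx; rewrite le_max H1//=; split => //.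
by rewrite lerNl le_max H2// orbT.
Qed.

(** On the Dirichlet and state-constraint boundaries the supersolution inequality
    is the equation itself at the points selected by the doubling: in the former
    case because v lies strictly below the data there. *)
Lemma super_active (R : realType) (Omega : set 'rV[R]_2) H bc u v xh (c rho M m : R) :
  open Omega -> compact (closure Omega) -> W2infty_boundary Omega ->
  continuous_data Omega bc -> (if bc is Neumann _ then False else True) ->
  viscosity_subsolution Omega H bc u -> (forall x, closure Omega x -> u x <= M) ->
  frontier Omega xh -> 0 < c -> 0 < rho -> 0 < m ->
  (forall x r p, closure Omega x -> `|x - xh| < rho -> H x r p <= 0 -> c * `|p| <= expR (- (2 * r))) ->
  exists2 d : R, 0 < d & forall x y q, Omega x -> frontier Omega y -> `|x - xh| < d -> `|y - xh| < d ->
     m / 2 <= u x - v y ->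
     (0 <= maxe (H y (v y) q)%:E (boundary_operator Omega bc y (v y) q))%E -> 0 <= H y (v y) q.
Proof.
move=> oO cK reg cg nN sub uM fxh c0 rho0 m0 coer.
case: bc cg nN sub => [g|g|] //= cg _ sub.
- have ug := subsolution_le_data oO cK reg cg sub uM fxh c0 rho0 coer.
  have Kxh : closure Omega xh by case: ((open_frontierP _ oO).1 fxh).
  have m8 : 0 < m / 8 by rewrite divr_gt0.
  have [d1 d10 H1] := usc_onP sub.1 Kxh m8.
  have [d2 d20 H2] := continuous_dataP cg fxh m8.
  exists (Num.min d1 d2); first by rewrite lt_min d10.
  move=> x y q Ox fy; rewrite !lt_min => /andP[x1 _] /andP[_ y2] uv.
  have := H1 x (@subset_closure _ Omega _ Ox) x1; have := H2 y fy y2.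
  rewrite ltr_norml => /andP[g1 g2] u1.
  rewrite le_max !lee_fin => /orP[//|vg].
  by exfalso; lra.
- by exists 1 => // x y q _ _ _ _ _; rewrite le_max lee_fin => /orP[//|].
Qed.

Lemma comparison_principle (R : realType) (Omega : set 'rV[R]_2) (f : R)
    (I IA : 'rV[R]_2 -> R) (M : reflectance R) (bc : boundary_condition R) :
  open Omega -> bounded_set Omega -> W2infty_boundary Omega -> 0 < f ->
  admissible M -> intensity_assumption Omega (intensity M I IA) -> continuous_data Omega bc ->
  (is_oren_nayar M -> if bc is Neumann _ then True else False) ->
  maximum_principle Omega (hamiltonian f I IA M) bc.
Proof.
move=> oO bO reg f0 aM int cg ON u v sub sup x Ax.
rewrite leNgt; apply/negP => vu.
have [[MK MK0 HK] cK] := bounded_closure bO.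
have OA : Omega `<=` comparison_set Omega bc.
  by case: (bc) => [g|g|] // y; exact: subset_closure.
have AK : comparison_set Omega bc `<=` closure Omega.
  by case: (bc) => [g|g|] //= y; exact: subset_closure.
have K0 : closure Omega !=set0 by exists x; exact: AK.
have [Mb HM] := semicontinuous_bounds cK K0 sub.1 sup.1.
have [C C0 gap] := hamiltonian_gap f0 aM MK0 HK int.1.
have [xh [m [Kxh um P1 P2]]] := merging_sup cK AK (fun y Ky => (HM y Ky).1) (fun y Ky => (HM y Ky).2) Ax.
have m0 : 0 < m by lra.
have D : comparison_data Omega (comparison_set Omega bc) (hamiltonian f I IA M) bc u v xh m C Mb.
  by split => // y Ky; case: (HM y Ky).
have [Oxh|fxh] := closure_open_or_frontier oO Kxh; first exact: interior_case D Oxh.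
have coercive_bc : (if bc is Neumann _ then False else True) -> False.
  move=> nN.
  have nM : ~~ is_oren_nayar M by apply/negP => /ON; case: (bc) nN.
  have [c c0 Hc] := hamiltonian_coercive f0 aM nM int.
  have [rho rho0 coer] := Hc xh fxh.
  have act := super_active v oO cK reg cg nN sub (fun y Ky => (HM y Ky).1) fxh c0 rho0 m0 coer.
  have AE : comparison_set Omega bc = Omega by case: (bc) nN.
  by rewrite AE in D; exact: (coercive_case reg c0 rho0 coer act D fxh).
case: bc cg coercive_bc D {sub sup Ax OA AK P1 P2 ON} => [g|g|] cg cb D; [exact: cb| |exact: cb].
exact: (neumann_case reg cg D fxh).
Qed.

(** Two solutions agree where the maximum principle applies, and then on the whole
    closure since solutions are continuous there. *)
Lemma uniqueness_of_maximum_principle (R : realType) (Omega : set 'rV[R]_2) H bc :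
  maximum_principle Omega H bc -> at_most_one_solution Omega H bc.
Proof.
move=> mp.
suff le u v : viscosity_solution Omega H bc u -> viscosity_solution Omega H bc v ->
    forall x, closure Omega x -> u x <= v x.
  by move=> u v su sv x Kx; apply/eqP; rewrite eq_le !le.
move=> [su1 su2] [sv1 sv2] x Kx.
have OA y : Omega y -> u y <= v y.
  move=> Oy; apply: (mp u v su1 sv2).
  by case: (bc) => [g|g|] //=; exact: subset_closure.
apply/ler_addgt0Pr => e e0.
have e2 : 0 < e / 2 by rewrite divr_gt0.
have [d1 d10 H1] := lsc_onP su2.1 Kx e2; have [d2 d20 H2] := usc_onP sv1.1 Kx e2.
have d0 : 0 < Num.min d1 d2 by rewrite lt_min d10.
have [y Oy] := (@closure_ballP R Omega x).1 Kx _ d0; rewrite lt_min => /andP[y1 y2].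
have Ky := @subset_closure _ Omega _ Oy.
have := H1 y Ky y1; have := H2 y Ky y2; have := OA y Oy; lra.
Qed.

Unset Implicit Arguments.

Theorem corollary4p4 (R : realType) (Omega : set 'rV[R]_2) (f : R)
    (I IA : 'rV[R]_2 -> R)
    (Omega_open : open Omega) (Omega_bounded : bounded_set Omega)
    (Omega_regular : W2infty_boundary Omega) (f_gt0 : 0 < f) :
  (forall (M : reflectance R) (bc : boundary_condition R),
      ~~ is_oren_nayar M -> admissible M ->
      intensity_assumption Omega (intensity M I IA) ->
      continuous_data Omega bc ->
      maximum_principle Omega (hamiltonian f I IA M) bc /\
      at_most_one_solution Omega (hamiltonian f I IA M) bc)
  /\
  (forall (sigma : R) (g : 'rV[R]_2 -> R),
      admissible (OrenNayar sigma) ->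
      intensity_assumption Omega (intensity (OrenNayar sigma) I IA) ->
      continuous_data Omega (Neumann g) ->
      maximum_principle Omega (hamiltonian f I IA (OrenNayar sigma)) (Neumann g) /\
      at_most_one_solution Omega (hamiltonian f I IA (OrenNayar sigma)) (Neumann g)).
Proof.
split=> [M bc nM aM int cg|sigma g aM int cg].
- have mp : maximum_principle Omega (hamiltonian f I IA M) bc.
    by apply: comparison_principle => //; rewrite (negPf nM).
  by split => //; exact: uniqueness_of_maximum_principle.
- have mp : maximum_principle Omega (hamiltonian f I IA (OrenNayar sigma)) (Neumann g).
    exact: comparison_principle.
  by split => //; exact: uniqueness_of_maximum_principle.
Qed.
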